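(* Let $f^\varepsilon$ be smooth solutions, in a region of $(x,t)$-space, of $$\varepsilon(\partial_tf+\omega\cdot\nabla_xf)+K_2\eta^2\big[\nabla_\omega\cdot(P_{\omega^\perp}\ell_f\,f)-m_f\,\Delta_\omega f\big]=Q(f)+\mathcal O(\eta^4),$$ where $\eta=\eta(\varepsilon)\to0$ is such that $K_2\frac{\eta^2}\varepsilon\to\mathcal K_2\in[0,\infty)$ as $\varepsilon\to0$. Suppose that $f^\varepsilon$ converges as $\varepsilon\to0$ towards $\rho(x,t)M_{\kappa(\rho(x,t))\Omega(x,t)}$, for a positive density $\rho(x,t)$ and an orientation $\Omega(x,t)\in\mathbb S$, where $\rho\mapsto\kappa(\rho)>0$ is a (differentiable) branch of solutions of the compatibility equation $\frac{j(\kappa)}{c(\kappa)}=\rho$, and that the convergence of $f^\varepsilon$ and of all its derivatives is sufficiently strong (e.g. uniform on the region). Then $\rho$ and $\Omega$ satisfy $$\partial_t\rho+\nabla_x\cdot(\rho\,c_1\Omega)=0,$$ $$\rho\left(\partial_t\Omega+c_2(\Omega\cdot\nabla_x)\Omega\right)+\Theta\,P_{\Omega^\perp}\nabla_x\rho=\mathcal K_2\,\delta\,P_{\Omega^\perp}\Delta_x(\rho\,c_1\Omega),$$ where the coefficients are the following functions of $\rho$ (with $\kappa=\kappa(\rho)$, and $c,\widetilde c,j$ evaluated at $\kappa(\rho)$): $$c_1(\rho)=c(\kappa),\qquad c_2(\rho)=\widetilde c(\kappa)=\frac{\int_0^\pi\cos\theta\,h_\kappa(\cos\theta)\,e^{\kappa\cos\theta}\sin^n\theta\,d\theta}{\int_0^\pi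 h_\kappa(\cos\theta)\,e^{\kappa\cos\theta}\sin^n\theta\,d\theta},$$ $$\Theta(\rho)=\frac1\kappa+(\widetilde c-c)\frac\rho\kappa\frac{d\kappa}{d\rho}=\frac{n-\frac\kappa c+\kappa\widetilde c-1+\frac\kappa j\frac{dj}{d\kappa}}{\kappa\left(n-\frac\kappa c+\kappa c-1+\frac\kappa j\frac{dj}{d\kappa}\right)},\qquad \delta(\rho)=\frac{\nu(j)}{c}\left(\frac{n-1}\kappa+\widetilde c\right).$$
   Context: Let $n\ge2$, $\mathbb S$ the unit sphere of $\mathbb R^n$ with uniform probability measure $d\omega$; $x\in\mathbb R^n$, $\omega\in\mathbb S$, $t>0$. $\nabla_\omega\cdot$ and $\Delta_\omega$ are the divergence and Laplace–Beltrami operator on $\mathbb S$; $P_{\omega^\perp}=\mathrm{Id}-\omega\otimes\omega$ for $\omega\in\mathbb S$. The functions $\nu,\tau$ on $[0,\infty)$ (independent of $\varepsilon$) are as smooth as needed, $\nu\ge0$, $\tau>0$, with $r\mapsto\nu(r)/r$ and $\tau$ Lipschitz and bounded; $k=\nu/\tau$ is increasing and $j$ is its inverse function. For $f(x,\omega,t)$, put $J_f(x,t)=\int_{\mathbb S}f\,\omega\,d\omega$, $\Omega_f=J_f/|J_f|$, $$Q(f)=-\nu(|J_f|)\nabla_\omega\cdot(P_{\omega^\perp}\Omega_f\,f)+\tau(|J_f|)\Delta_\omega f,$$ $$\ell_f=\frac{\nu(|J_f|)}{|J_f|}P_{\Omega_f^\perp}\Delta_xJ_f+(\Omega_f\cdot\Delta_xJ_f)\,\nu'(|J_f|)\,\Omega_f,\qquad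 m_f=(\Omega_f\cdot\Delta_xJ_f)\,\tau'(|J_f|).$$ $K_2=\frac1{2n}\int_{\mathbb R^n}K(|\xi|)|\xi|^2d\xi$ is a fixed positive constant, $K$ being the observation kernel with $\int K(|\xi|)\,d\xi=1$. The model is the expansion in the interaction range $\eta$ of the kinetic equation $\varepsilon(\partial_tf+\omega\cdot\nabla_xf)+\nu(|\mathcal J_f|)\nabla_\omega\cdot(P_{\omega^\perp}\frac{\mathcal J_f}{|\mathcal J_f|}f)=\tau(|\mathcal J_f|)\Delta_\omega f$ with $\mathcal J_f=K_\eta*J_f$ (convolution in $x$), $K_\eta(x)=\eta^{-n}K(x/\eta)$; in particular the remainder $\mathcal O(\eta^4)$ has zero integral over $\omega\in\mathbb S$, so that $\partial_t\int_{\mathbb S} f\,d\omega+\nabla_x\cdot J_f=0$. The two scalings of interest are $\eta=\mathcal O(\varepsilon)$ (then $\mathcal K_2=0$) and $\eta=\mathcal O(\sqrt\varepsilon)$ with $\mathcal K_2>0$. $M_{\kappa\Omega}(\omega)=e^{\kappa\,\omega\cdot\Omega}/\int_{\mathbb S}e^{\kappa\,\upsilon\cdot\Omega}d\upsilon$, and $c(\kappa)=\frac{\int_0^\pi\cos\theta\,e^{\kappa\cos\theta}\sin^{n-2}\theta\,d\theta}{\int_0^\pi e^{\kappa\cos\theta}\sin^{n-2}\theta\,d\theta}$, so that $J_{M_{\kappa\Omega}}=c(\kappa)\Omega$. The positive function $h_\kappa:[-1,1]\to\mathbb R$ is $h_\kappa(\cos\theta)=\frac{g_\kappa(\theta)}{\sin\theta}$,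 where $g_\kappa$ is the unique solution in the space $V=\{g\,:\,(n-2)(\sin\theta)^{\frac n2-2}g\in L^2(0,\pi),\ (\sin\theta)^{\frac n2-1}g\in H^1_0(0,\pi)\}$ of $$-\sin^{2-n}\theta\,e^{-\kappa\cos\theta}\frac{d}{d\theta}\left(\sin^{n-2}\theta\,e^{\kappa\cos\theta}g'(\theta)\right)+\frac{n-2}{\sin^2\theta}g(\theta)=\sin\theta.$$ *)

(* Defs.v *)
From HB Require Import structures.
From mathcomp Require Import all_boot all_order all_algebra.
From mathcomp Require Import all_classical all_reals all_analysis.

Set Implicit Arguments.
Unset Strict Implicit.
Unset Printing Implicit Defensive.

Import Order.TTheory GRing.Theory Num.Theory.
Import numFieldNormedType.Exports.
Local Open Scope classical_set_scope.
Local Open Scope ring_scope.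

(* The norm that the library puts on 'rV[R]_n is the sup norm; it is used only
   for topology and differentiation. *)
Definition dotp (R : realType) (n : nat) (u v : 'rV[R]_n) : R :=
  \sum_(i < n) u 0 i * v 0 i.

Definition enorm (R : realType) (n : nat) (u : 'rV[R]_n) : R :=
  Num.sqrt (dotp u u).

Definition sphere (R : realType) (n : nat) : set 'rV[R]_n :=
  [set u | enorm u = 1].

Definition unitv (R : realType) (n : nat) (u : 'rV[R]_n) : 'rV[R]_n :=
  (enorm u)^-1 *: u.

(* P_{a^perp} v, for a unit vector a *)
Definition Pperp (R : realType) (n : nat) (a v : 'rV[R]_n) : 'rV[R]_n :=
  v - dotp a v *: a.

Definition ei (R : realType) (n : nat) (i : 'I_n) : 'rV[R]_n := delta_mx 0 i.

Definition grad (R : realType) (n : nat) (F : 'rV[R]_n -> R) (x : 'rV[R]_n) :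
    'rV[R]_n :=
  \row_i 'D_(ei R i) F x.

Definition div (R : realType) (n : nat) (V : 'rV[R]_n -> 'rV[R]_n)
    (x : 'rV[R]_n) : R :=
  \sum_(i < n) 'D_(ei R i) (fun y => V y 0 i) x.

Definition vlaplacian (R : realType) (n : nat) (V : 'rV[R]_n -> 'rV[R]_n)
    (x : 'rV[R]_n) : 'rV[R]_n :=
  \sum_(i < n) 'D_(ei R i) ('D_(ei R i) V) x.

Definition convective (R : realType) (n : nat) (a : 'rV[R]_n)
    (V : 'rV[R]_n -> 'rV[R]_n) (x : 'rV[R]_n) : 'rV[R]_n :=
  \sum_(i < n) a 0 i *: 'D_(ei R i) V x.

(* A function or tangent vector field on the sphere is given by a map on
   R^n of which only the values on the sphere matter. Its intrinsic gradient or
   divergence is the Euclidean one of its extension by homogeneity of degree 0;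
   for the divergence this uses that the field is tangent. *)
Definition sph_grad (R : realType) (n : nat) (g : 'rV[R]_n -> R) :
    'rV[R]_n -> 'rV[R]_n :=
  grad (fun u => g (unitv u)).

Definition sph_div (R : realType) (n : nat) (V : 'rV[R]_n -> 'rV[R]_n) :
    'rV[R]_n -> R :=
  div (fun u => V (unitv u)).

Definition sph_laplacian (R : realType) (n : nat) (g : 'rV[R]_n -> R) :
    'rV[R]_n -> R :=
  sph_div (sph_grad g).

Notation borel_rV R n := (g_sigma_algebraType (@open 'rV[R]_n)).

(* The uniform probability measure on the sphere, as a Borel probability
   measure on R^n carried by the sphere. *)
Definition uniform_sphere (R : realType) (n : nat)
    (sigma : probability (borel_rV R n) R) : Prop :=
  sigma (@sphere R n) = 1%E /\
  forall O : 'M[R]_n, O *m O^T = 1%:M ->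
    forall A : set (borel_rV R n), measurable A ->
      sigma ((fun u : 'rV[R]_n => u *m O) @^-1` A) = sigma A.

(* lam is the Lebesgue measure of R^n, restricted to Borel sets. *)
Definition lebesgue_rV (R : realType) (n : nat)
    (lam : {measure set (borel_rV R n) -> \bar R}) : Prop :=
  lam [set u : 'rV[R]_n | forall i, 0 <= u 0 i <= 1] = 1%E /\
  forall (a : 'rV[R]_n) (A : set (borel_rV R n)), measurable A ->
    lam ((fun u : 'rV[R]_n => u + a) @^-1` A) = lam A.

Definition observation_kernel (R : realType) (n : nat)
    (lam : {measure set (borel_rV R n) -> \bar R}) (K : R -> R) : Prop :=
  [/\ lam.-integrable setT (fun xi : 'rV[R]_n => (K (enorm xi))%:E),
      lam.-integrable setT
        (fun xi : 'rV[R]_n => (K (enorm xi) * enorm xi ^+ 2)%:E) &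
      (\int[lam]_xi K (enorm (xi : 'rV[R]_n)) = 1)%R].

Definition kernel_K2 (R : realType) (n : nat)
    (lam : {measure set (borel_rV R n) -> \bar R}) (K : R -> R) : R :=
  (2 * n%:R)^-1 *
  (\int[lam]_xi (K (enorm (xi : 'rV[R]_n)) * enorm (xi : 'rV[R]_n) ^+ 2))%R.

Definition iter_derive (R : realType) (E : normedModType R) (vs : seq E)
    (F : E -> R^o) : E -> R^o :=
  foldr (fun v G => 'D_v G) F vs.

(* F is of class C^oo on the open set U. *)
Definition smooth_on (R : realType) (E : normedModType R) (U : set E)
    (F : E -> R^o) : Prop :=
  forall (vs : seq E) (z : E), U z -> differentiable (iter_derive vs F) z.

Definition phase_space (R : realType) (n : nat) : normedModType R :=
  ('rV[R]_n * 'rV[R]_n * R^o)%type.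

(* f(x, omega, t), extended by homogeneity of degree 0 in omega *)
Definition extend0 (R : realType) (n : nat)
    (f : 'rV[R]_n -> 'rV[R]_n -> R -> R) : phase_space R n -> R^o :=
  fun z => f z.1.1 (unitv z.1.2) z.2.

Definition smooth_density (R : realType) (n : nat) (D : set ('rV[R]_n * R))
    (f : 'rV[R]_n -> 'rV[R]_n -> R -> R) : Prop :=
  smooth_on [set z : phase_space R n | D (z.1.1, z.2) /\ z.1.2 != 0]
    (extend0 f).

(* Uniform convergence as eps -> 0+, together with all derivatives in
   (x, omega, t), to a smooth limit. *)
Definition smooth_cvg (R : realType) (n : nat) (D : set ('rV[R]_n * R))
    (f : R -> 'rV[R]_n -> 'rV[R]_n -> R -> R)
    (f0 : 'rV[R]_n -> 'rV[R]_n -> R -> R) : Prop :=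
  smooth_density D f0 /\
  forall vs : seq (phase_space R n),
    {uniform [set z : phase_space R n | D (z.1.1, z.2) /\ sphere z.1.2],
      (fun eps => iter_derive vs (extend0 (f eps))) @ 0^'+
        --> iter_derive vs (extend0 f0)}.

Definition flux (R : realType) (n : nat) (sigma : probability (borel_rV R n) R)
    (g : 'rV[R]_n -> R) : 'rV[R]_n :=
  \row_i (\int[sigma]_(w in @sphere R n) (g w * (w : 'rV[R]_n) 0 i))%R.

Definition Qop (R : realType) (n : nat) (sigma : probability (borel_rV R n) R)
    (nu tau : R -> R) (g : 'rV[R]_n -> R) (w : 'rV[R]_n) : R :=
  let J := flux sigma g in
  - nu (enorm J) * sph_div (fun u => g u *: Pperp u (unitv J)) w
  + tau (enorm J) * sph_laplacian g w.

(* ell_f and m_f in terms of J = J_f(x, t) and L = (Delta_x J_f)(x, t) *)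
Definition ell (R : realType) (n : nat) (nu : R -> R) (J L : 'rV[R]_n) :
    'rV[R]_n :=
  (nu (enorm J) / enorm J) *: Pperp (unitv J) L
  + (dotp (unitv J) L * derive1 nu (enorm J)) *: unitv J.

Definition mcoef (R : realType) (n : nat) (tau : R -> R) (J L : 'rV[R]_n) : R :=
  dotp (unitv J) L * derive1 tau (enorm J).

(* left-hand side of the expanded kinetic equation, with K2eta2 = K_2 eta^2 *)
Definition kinetic_lhs (R : realType) (n : nat)
    (sigma : probability (borel_rV R n) R) (nu tau : R -> R) (eps K2eta2 : R)
    (f : 'rV[R]_n -> 'rV[R]_n -> R -> R) (x w : 'rV[R]_n) (t : R) : R :=
  let J := flux sigma (fun u => f x u t) in
  let L := vlaplacian (fun y => flux sigma (fun u => f y u t)) x in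
  eps * (derive1 (fun s => f x w s) t + dotp w (grad (fun y => f y w t) x))
  + K2eta2 * (sph_div (fun u => f x u t *: Pperp u (ell nu J L)) w
              - mcoef tau J L * sph_laplacian (fun u => f x u t) w).

Definition vonMises (R : realType) (n : nat)
    (sigma : probability (borel_rV R n) R) (kappa : R) (Om w : 'rV[R]_n) : R :=
  expR (kappa * dotp w Om) /
  (\int[sigma]_(u in @sphere R n) expR (kappa * dotp (u : 'rV[R]_n) Om))%R.

Definition int0pi (R : realType) (F : R -> R) : R :=
  (\int[lebesgue_measure]_(th in `[0, pi]) F th)%R.

Definition c_of (R : realType) (n : nat) (kappa : R) : R :=
  int0pi (fun th : R => cos th * expR (kappa * cos th) * sin th ^+ (n - 2)) /
  int0pi (fun th : R => expR (kappa * cos th) * sin th ^+ (n - 2)).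

Definition L2_0pi (R : realType) (u : R -> R) : Prop :=
  measurable_fun `]0, pi[ u /\
  lebesgue_measure.-integrable `]0, pi[ (fun th : R => (u th ^+ 2)%:E).

Definition test_0pi (R : realType) (phi : R -> R) : Prop :=
  smooth_on [set: R^o] phi /\
  exists a b : R, [/\ 0 < a, b < pi & forall th, ~~ (a <= th <= b) -> phi th = 0].

(* H^1_0(0, pi): closure of the test functions in H^1, v being the weak
   derivative of u *)
Definition H10_0pi (R : realType) (u : R -> R) : Prop :=
  L2_0pi u /\
  exists v : R -> R, L2_0pi v /\
  exists phi : nat -> R -> R,
    [/\ forall k, test_0pi (phi k),
        int0pi (fun th : R => (phi k th - u th) ^+ 2) @[k --> \oo] --> (0 : R) &
        int0pi (fun th : R => (derive1 (phi k) th - v th) ^+ 2) @[k --> \oo]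
          --> (0 : R)].

Definition spaceV (R : realType) (n : nat) (g : R -> R) : Prop :=
  L2_0pi (fun th => (n%:R - 2) * sin th `^ (n%:R / 2 - 2) * g th) /\
  H10_0pi (fun th => sin th `^ (n%:R / 2 - 1) * g th).

(* g is g_kappa: the solution in V of the ordinary differential equation for
   the generalized collision invariants. *)
Definition gci_profile (R : realType) (n : nat) (kappa : R) (g : R -> R) :
    Prop :=
  let q := fun th : R => sin th ^+ (n - 2) * expR (kappa * cos th) * derive1 g th in
  spaceV n g /\
  forall th : R, 0 < th < pi ->
    [/\ derivable g th 1, derivable q th 1 &
        - (sin th ^- (n - 2) * expR (- (kappa * cos th)) * derive1 q th)
        + (n%:R - 2) / sin th ^+ 2 * g th = sin th].

(* h_kappa(cos th) = g_kappa(th) / sin th *)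
Definition h_of (R : realType) (g : R -> R) (s : R) : R :=
  g (acos s) / sin (acos s).

Definition ctilde_of (R : realType) (n : nat) (kappa : R) (g : R -> R) : R :=
  int0pi (fun th : R =>
    cos th * h_of g (cos th) * expR (kappa * cos th) * sin th ^+ n) /
  int0pi (fun th : R => h_of g (cos th) * expR (kappa * cos th) * sin th ^+ n).

(* Main.v *)
(* Testing the kinetic equation against 1 and against
   psi(w) = h_kappa(w.Om) (w.A), with A orthogonal to Om = J_f / |J_f| and
   kappa = k(|J_f|), kills Q(f): psi solves the adjoint linearized problem
   (profile ODE), and the Lagrange multiplier that it leaves is J_f.A = 0.
   Dividing by epsilon, only transport and K_2 eta^2 / epsilon times the
   perturbation survive in the limit.
   The profile g_kappa is only given in V. From H^1_0 one gets the bounds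
   sin^(n-2) g^2 <= C theta and <= C (pi - theta), which the equation for
   g / sin improves step by step to |h_kappa|, |h_kappa'| <= M on (-1, 1);
   a maximum principle gives h_kappa >= 1 / (n + kappa) and the
   continuity of kappa -> h_kappa. At the poles w = +-Om, where h_of has a junk
   value, psi vanishes; the integrations by parts use h(lambda s), lambda -> 1.
   The limit integrals are computed by reflections. The fields rho and Om are
   derivable because rho and rho c Om are moments of the smooth limit density;
   Theta = Theta' is c' = 1 - (n - 1) c / kappa - c^2. *)

Require Import Defs.
From HB Require Import structures.
From mathcomp Require Import all_boot all_order all_algebra.
From mathcomp Require Import all_classical all_reals all_analysis.
From mathcomp Require Import measurable_realfun zify ring lra.
Set Implicit Arguments.
Unset Strict Implicit.
Unset Printing Implicit Defensive.
Import Order.TTheory GRing.Theory Num.Theory.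
Import numFieldNormedType.Exports.
Local Open Scope classical_set_scope.
Local Open Scope ring_scope.

(** * Derivatives, dot product and sphere *)

(** Two constraints shape the proof. The collision term has order one while transport carries a
    factor epsilon, so [Q(f)] must be cancelled exactly at each epsilon, before any limit: the test
    function is built on the flux of f^epsilon itself, with its own orientation and its own kappa,
    and converges only afterwards. Each profile being given separately, this calls for estimates
    that compare [h_kappa] at different kappa, uniformly up to the poles. The measure [sigma] is
    known only through its invariance under orthogonal maps. The divergence theorem on the sphere is
    therefore obtained by differentiating means along rotations of coordinate planes, and the
    formula for zonal means in the polar angle by matching the recursions of the moments on both
    sides, followed by polynomial approximation. The remainder disappears because eta^4 / epsilon is
    the product of eta^2 / epsilon, which stays bounded, with eta^2. *)

Section derive_rules.
Variables (R : realType) (V : normedModType R).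
Implicit Types (f g : V -> R) (x v : V) (df dg c : R).

Lemma is_dcst c x v : is_derive x v (fun=> c) 0.
Proof. exact: is_derive_cst. Qed.

Lemma is_dD f g x v df dg : is_derive x v f df -> is_derive x v g dg ->
  is_derive x v (fun y => f y + g y) (df + dg).
Proof. by move=> hf hg; exact: is_deriveD. Qed.

Lemma is_dN f x v df : is_derive x v f df -> is_derive x v (fun y => - f y) (- df).
Proof. by move=> hf; exact: is_deriveN. Qed.

Lemma is_dB f g x v df dg : is_derive x v f df -> is_derive x v g dg ->
  is_derive x v (fun y => f y - g y) (df - dg).
Proof. by move=> hf hg; exact: is_deriveB. Qed.

Lemma is_dM f g x v df dg : is_derive x v f df -> is_derive x v g dg ->
  is_derive x v (fun y => f y * g y) (df * g x + f x * dg).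
Proof.
move=> hf hg; apply: (is_derive_eq (is_deriveM hf hg)).
by rewrite addrC; congr (_ + _); rewrite /GRing.scale /= mulrC.
Qed.

Lemma is_dZ c f x v df : is_derive x v f df -> is_derive x v (fun y => c * f y) (c * df).
Proof. by move=> hf; apply: is_derive_eq (is_dM (is_dcst c x v) hf) _; rewrite mul0r add0r. Qed.

Lemma is_dV f x v df : f x != 0 -> is_derive x v f df ->
  is_derive x v (fun y => (f y)^-1) (- df / f x ^+ 2).
Proof.
move=> fx0 hf; apply: DeriveDef.
  by apply: derivableV => //; case: hf.
by rewrite deriveV //; case: hf => _ ->; rewrite /GRing.scale /= mulrC mulrN mulNr.
Qed.

Lemma is_d_eq f x v df dg : is_derive x v f df -> df = dg -> is_derive x v f dg.
Proof. by move=> h <-. Qed.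

Lemma is_dX f x v df k : is_derive x v f df ->
  is_derive x v (fun y => f y ^+ k) (k%:R * f x ^+ k.-1 * df).
Proof.
move=> hf; elim: k => [|k IH].
  by apply: is_d_eq (is_dcst 1 x v) _; rewrite !mul0r.
have := is_dM hf IH; rewrite (_ : (fun y => f y * f y ^+ k) = fun y => f y ^+ k.+1); last first.
  by apply/funext => y; rewrite exprS.
move=> h; apply: is_d_eq h _; case: k IH => [|k] _.
  by rewrite /= !expr0; ring.
by rewrite /= -[in RHS]natr1 !exprS; ring.
Qed.

Lemma is_d_sum (J : finType) (F : J -> V -> R) (dF : J -> R) x v :
  (forall j, is_derive x v (F j) (dF j)) ->
  is_derive x v (fun y => \sum_j F j y) (\sum_j dF j).
Proof.
move=> h; elim: (index_enum J) => [|j s IH].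
  rewrite big_nil (_ : (fun _ => _) = fun=> 0); first exact: is_dcst.
  by apply/funext => y; rewrite big_nil.
rewrite big_cons (_ : (fun _ => _) = fun y => F j y + \sum_(i <- s) F i y); first exact: is_dD.
by apply/funext => y; rewrite big_cons.
Qed.

(** A directional derivative is a one-variable derivative along a line; this reduces the vector
    rules below to those on the real line. *)
Lemma is_derive_lineP (W : normedModType R) (f : V -> W) x v (df : W) :
  is_derive x v f df <-> is_derive (0 : R) 1 (fun h : R => f (h *: v + x)) df.
Proof.
have E : (fun h : R => h^-1 *: (f (h *: v + x) - f x)) =
    (fun h : R => h^-1 *: ((fun h : R => f (h *: v + x)) (h *: 1 + 0) - (fun h : R => f (h *: v + x)) 0)).
  by apply/funext => h /=; rewrite scaler1 addr0 scale0r add0r.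
by split=> -[h1 h2]; split; rewrite /derivable /derive ?E // -E.
Qed.

(** Chain rule that asks only for a directional derivative of the inner function, not for its
    differentiability: restrict to the line through [x]. *)
Lemma is_d_comp f (g : R -> R) x v df dg :
  is_derive x v f df -> is_derive (f x) 1 g dg ->
  is_derive x v (fun y => g (f y)) (dg * df).
Proof.
move=> /is_derive_lineP hf hg; apply/is_derive_lineP.
apply: (@is_derive1_comp _ g (fun h : R => f (h *: v + x)) 0) => //.
by rewrite scale0r add0r.
Qed.

Lemma is_d_continuous (g : R -> R) (x : R) dg : is_derive x 1 g dg -> {for x, continuous g}.
Proof. by move=> [hg _]; apply: differentiable_continuous; apply/derivable1_diffP. Qed.

Lemma is_d_val f x v df dg : is_derive x v f df -> is_derive x v f dg -> df = dg.
Proof. by move=> [_ <-] [_ <-]. Qed.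

End derive_rules.

Section segment.
Variable R : realType.
Implicit Types f df : R -> R.

Lemma MVT_cc f df (p q : R) : p < q ->
  (forall x, p <= x <= q -> is_derive x 1 f (df x)) ->
  exists2 c, p < c < q & f q - f p = df c * (q - p).
Proof.
move=> pq hd.
have [||c] := @MVT R f df p q pq.
- by move=> x; rewrite in_itv /= => hx; apply: hd; lra.
- apply: derivable_within_continuous => x; rewrite in_itv /= => hx.
  by have [] := hd x hx.
by rewrite in_itv /= => hc E; exists c.
Qed.

Lemma segment_bounded f (p q : R) :
  (forall x, p <= x <= q -> {for x, continuous f}) ->
  exists2 M, 0 <= M & forall x, p <= x <= q -> `|f x| <= M.
Proof.
move=> cf; have [pq|qp] := leP p q; last first.
  by exists 0 => // x hx; exfalso; lra.
have cn : {within `[p, q], continuous (fun x => `|f x|)}.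
  apply: continuous_in_subspaceT => x; rewrite inE /= in_itv /= => hx.
  by apply: cvg_norm; exact: cf.
have [c _ hM] := EVT_max pq cn.
by exists `|f c| => // x hx; apply: hM; rewrite in_itv.
Qed.

End segment.

Lemma cvg_sumr (R : realType) (T : Type) (F : set_system T) {FF : Filter F}
    (J : Type) (s : seq J) (f : J -> T -> R) (l : J -> R) :
  (forall j, f j x @[x --> F] --> l j) ->
  \sum_(j <- s) f j x @[x --> F] --> \sum_(j <- s) l j.
Proof.
move=> h; elim: s => [|j s IH].
  by rewrite big_nil; under eq_fun do rewrite big_nil; exact: cvg_cst.
by rewrite big_cons; under eq_fun do rewrite big_cons; exact: cvgD.
Qed.

Lemma cvg_row (R : realType) (T : Type) (F : set_system T) {FF : Filter F}
    n (f : T -> 'rV[R]_n) (l : 'rV[R]_n) :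
  (forall i, f x 0 i @[x --> F] --> l 0 i) -> f x @[x --> F] --> l.
Proof.
move=> h; apply/cvgrPdist_le => /= e e0; near=> x.
rewrite /Num.Def.normr/= mx_normrE (bigmax_le _ (ltW e0))//= => -[i j] _.
rewrite !mxE ord1 /=; move: j {i}; near: x; apply: filter_forall => j.
by have /cvgrPdist_le := h j; apply.
Unshelve. all: by end_near. Qed.

Section euclid.
Variables (R : realType) (n : nat).
Implicit Types u v w a : 'rV[R]_n.

Lemma dotpC u v : dotp u v = dotp v u.
Proof. by apply: eq_bigr => i _; rewrite mulrC. Qed.

Lemma dotpDl u v w : dotp (u + v) w = dotp u w + dotp v w.
Proof. by rewrite /dotp -big_split; apply: eq_bigr => i _; rewrite mxE mulrDl. Qed.

Lemma dotpZl (c : R) u w : dotp (c *: u) w = c * dotp u w.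
Proof. by rewrite /dotp mulr_sumr; apply: eq_bigr => i _; rewrite mxE mulrA. Qed.

Lemma dotpDr u v w : dotp w (u + v) = dotp w u + dotp w v.
Proof. by rewrite dotpC dotpDl !(dotpC w). Qed.

Lemma dotpZr (c : R) u w : dotp w (c *: u) = c * dotp w u.
Proof. by rewrite dotpC dotpZl dotpC. Qed.

Lemma dotpNl u w : dotp (- u) w = - dotp u w.
Proof. by rewrite -scaleN1r dotpZl mulN1r. Qed.

Lemma dotpNr u w : dotp w (- u) = - dotp w u.
Proof. by rewrite dotpC dotpNl dotpC. Qed.

Lemma dotpBl u v w : dotp (u - v) w = dotp u w - dotp v w.
Proof. by rewrite dotpDl dotpNl. Qed.

Lemma dotpBr u v w : dotp w (u - v) = dotp w u - dotp w v.
Proof. by rewrite dotpDr dotpNr. Qed.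

Lemma dotp0l w : dotp 0 w = 0 :> R.
Proof. by rewrite /dotp big1 // => i _; rewrite mxE mul0r. Qed.

Lemma dotp0r w : dotp w 0 = 0 :> R.
Proof. by rewrite dotpC dotp0l. Qed.

Lemma dotp_suml (J : finType) (F : J -> 'rV[R]_n) w :
  dotp (\sum_j F j) w = \sum_j dotp (F j) w.
Proof.
apply: (big_ind2 (fun x y => dotp x w = y)) => //; first exact: dotp0l.
by move=> x1 y1 x2 y2 <- <-; rewrite dotpDl.
Qed.

Lemma dotp_sumr (J : finType) (F : J -> 'rV[R]_n) w :
  dotp w (\sum_j F j) = \sum_j dotp w (F j).
Proof. by rewrite dotpC dotp_suml; apply: eq_bigr => j _; rewrite dotpC. Qed.

Lemma dotp_ei (i : 'I_n) w : dotp w (ei R i) = w 0 i.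
Proof.
rewrite /dotp (bigD1 i) //= big1 => [|j ji].
  by rewrite addr0 !mxE !eqxx mulr1.
by rewrite !mxE eqxx /= (negbTE ji) mulr0.
Qed.

Lemma dotp_ge0 u : 0 <= dotp u u.
Proof. by apply: sumr_ge0 => i _; rewrite -expr2 sqr_ge0. Qed.

Lemma dotp_eq0 u : (dotp u u == 0) = (u == 0).
Proof.
apply/idP/eqP => [|->]; last by rewrite dotp0l.
rewrite psumr_eq0 => [/allP h|i _]; last by rewrite -expr2 sqr_ge0.
apply/rowP => i; have := h i (mem_index_enum _); rewrite mxE.
by rewrite mulf_eq0 orbb => /eqP.
Qed.

Lemma dotp_gt0 u : (0 < dotp u u) = (u != 0).
Proof. by rewrite lt_neqAle dotp_ge0 andbT eq_sym dotp_eq0. Qed.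

Lemma enorm_sqr u : enorm u ^+ 2 = dotp u u.
Proof. by rewrite sqr_sqrtr // dotp_ge0. Qed.

Lemma enorm_gt0 u : (0 < enorm u) = (u != 0).
Proof. by rewrite sqrtr_gt0 dotp_gt0. Qed.

Lemma enorm_ge0 u : 0 <= enorm u.
Proof. exact: sqrtr_ge0. Qed.

Lemma enorm_eq0 u : (enorm u == 0) = (u == 0).
Proof. by rewrite -[u == 0]negbK -enorm_gt0 lt_neqAle enorm_ge0 andbT negbK eq_sym. Qed.

Lemma enormZ (c : R) u : enorm (c *: u) = `|c| * enorm u.
Proof. by rewrite /enorm dotpZl dotpZr mulrA -expr2 sqrtrM ?sqr_ge0 // sqrtr_sqr. Qed.

Lemma sphereE w : sphere w <-> dotp w w = 1.
Proof.
split=> [h|h]; first by rewrite -enorm_sqr h expr1n.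
by rewrite /sphere /= /enorm h sqrtr1.
Qed.

Lemma sphere_neq0 w : sphere w -> w != 0.
Proof. by move=> /sphereE h; rewrite -dotp_eq0 h oner_eq0. Qed.

Lemma unitvE w : sphere w -> unitv w = w.
Proof. by rewrite /sphere/unitv /= => ->; rewrite invr1 scale1r. Qed.

Lemma sphere_unitv w : w != 0 -> sphere (unitv w).
Proof.
move=> w0; rewrite /sphere /= /unitv enormZ ger0_norm ?invr_ge0 ?enorm_ge0 //.
by rewrite mulVf // enorm_eq0.
Qed.

(* From [0 <= |u - (u.v) v|^2]. *)
Lemma dotp_le_sphere u v : sphere v -> dotp u v ^+ 2 <= dotp u u.
Proof.
move=> /sphereE hv; have := dotp_ge0 (u - dotp u v *: v).
by rewrite !dotpBl !dotpBr !dotpZl !dotpZr hv (dotpC v u); nra.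
Qed.

Lemma dotp_norm_le1 u v : sphere u -> sphere v -> `|dotp u v| <= 1.
Proof.
move=> /sphereE hu hv; rewrite -(expr_le1 (n := 2)) // real_normK ?num_real //.
by rewrite -hu dotp_le_sphere.
Qed.

Lemma dotp_itv u v : sphere u -> sphere v -> -1 <= dotp u v <= 1.
Proof. by move=> hu hv; rewrite -ler_norml dotp_norm_le1. Qed.

Lemma coord_norm_le1 w i : sphere w -> `|w 0 i| <= 1.
Proof.
move=> /sphereE hw; rewrite -(expr_le1 (n := 2)) // real_normK ?num_real // -hw.
by rewrite /dotp (bigD1 i) //= -expr2 lerDl sumr_ge0 // => j _; rewrite -expr2 sqr_ge0.
Qed.

(** Equality case of Cauchy-Schwarz: [|u - (u.v) v|^2 = 1 - (u.v)^2] vanishes. It serves to show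
    that [w.a = 0] at the poles [w = +-Om] when [a] is orthogonal to [Om]. *)
Lemma dotp_pole u v : sphere u -> sphere v -> `|dotp u v| = 1 -> u = dotp u v *: v.
Proof.
move=> /sphereE hu /sphereE hv h; apply/eqP; rewrite -subr_eq0 -dotp_eq0.
rewrite !dotpBl !dotpBr !dotpZl !dotpZr hu hv (dotpC v u) mulr1.
have : dotp u v * dotp u v = 1 by rewrite -expr2 -[_ ^+ 2]real_normK ?num_real // h expr1n.
by move=> ->; rewrite !subrr.
Qed.

Lemma continuous_dotp2 : continuous (fun u : 'rV[R]_n => dotp u u).
Proof.
move=> u; rewrite /continuous_at /dotp; apply: (cvg_sumr (F := nbhs u)) => i.
by apply: cvgM; exact: coord_continuous.
Qed.

Lemma continuous_enorm : continuous (@enorm R n).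
Proof.
move=> u; apply: continuous_comp; first exact: continuous_dotp2.
exact: sqrt_continuous.
Qed.

Lemma closed_sphere : closed (@sphere R n).
Proof.
rewrite (_ : @sphere R n = @enorm R n @^-1` [set 1]) //.
by apply: preimage_closed; [move=> u _; exact: continuous_enorm|exact: closed_eq].
Qed.

Lemma compact_sphere : compact (@sphere R n).
Proof.
apply: bounded_closed_compact; last exact: closed_sphere.
exists 1; split=> // M M1 w hw; rewrite /= /Num.norm/= mx_normrE.
apply: bigmax_le; first by rewrite ltW // (lt_trans ltr01).
by move=> [i j] _ /=; rewrite ord1 (le_trans (coord_norm_le1 j hw)) // ltW.
Qed.

Lemma measurable_sphere : measurable (@sphere R n : set (borel_rV R n)).
Proof.
rewrite -[X in measurable X]setCK; apply: measurableC.
apply: sub_sigma_algebra; rewrite openC; exact: closed_sphere.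
Qed.

End euclid.

(** * The mean over the sphere *)

Section sphere_mean.
Variables (R : realType) (n : nat) (sigma : probability (borel_rV R n) R).
Hypothesis hsigma : uniform_sphere sigma.
Implicit Types F G : 'rV[R]_n -> R.

Definition smean F : R := \int[sigma]_(w in @sphere R n) F w.

(** The working class of integrands. Continuity would be too restrictive, since [h_of g (dotp w Om)]
    jumps at the poles. *)
Definition bmeas F : Prop :=
  measurable_fun (@sphere R n : set (borel_rV R n)) F /\
  exists M : R, forall w, sphere w -> `|F w| <= M.

Let mS : measurable (@sphere R n : set (borel_rV R n)).
Proof. exact: measurable_sphere. Qed.

Lemma sigma_sphere_fin : (sigma (@sphere R n : set (borel_rV R n)) < +oo)%E.
Proof. by rewrite (hsigma.1) ltry. Qed.

Lemma bmeas_integrable F : bmeas F ->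
  sigma.-integrable (@sphere R n : set (borel_rV R n)) (EFin \o F).
Proof.
move=> [mF [M hM]]; apply: measurable_bounded_integrable => //.
  exact: sigma_sphere_fin.
by exists M; split => [|x Mx w Sw]; [exact: num_real|exact: le_trans (hM w Sw) (ltW Mx)].
Qed.

(** Continuity is asked away from the origin only, because extensions of degree 0 are in general
    discontinuous there. The preimage of an interval is cut with the open set [u != 0], which
    contains the sphere. *)
Lemma measurable_continuous_at F :
  (forall u, u != 0 -> {for u, continuous F}) ->
  measurable_fun (@sphere R n : set (borel_rV R n)) F.
Proof.
move=> cF; apply: (measurability _ (RGenOpens.measurableE R)).
move=> _ [_ [a [b ->] <-]].
have -> : @sphere R n `&` F @^-1` `]a, b[%classic =
    @sphere R n `&` [set u | u != 0 /\ F u \in `]a, b[].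
  by apply/seteqP; split => u [Su /= h]; split => //; [split => //; exact: sphere_neq0|case: h].
apply: measurableI => //; apply: sub_sigma_algebra.
rewrite openE => u /= [u0 Fu]; rewrite /interior.
have h1 : \forall v \near u, v != 0 :> 'rV[R]_n.
  have : {for u, continuous (@enorm R n)} by exact: continuous_enorm.
  move/cvgr_gt => /(_ 0); rewrite enorm_gt0 => /(_ u0).
  by apply: filterS => v; rewrite enorm_gt0.
have h2 : \forall v \near u, F v \in `]a, b[.
  have : nbhs (F u) (fun y : R => y \in `]a, b[) by exact: near_in_itvoo.
  exact: (cF u u0).
by near=> v; split; near: v.
Unshelve. all: by end_near. Qed.

Lemma eq_smean F G : (forall w, sphere w -> F w = G w) -> smean F = smean G.
Proof. by move=> FG; apply: eq_Rintegral => w; rewrite inE => /FG. Qed.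

Lemma bmeas_ext F G : (forall w, sphere w -> F w = G w) -> bmeas F -> bmeas G.
Proof.
move=> FG [mF [M hM]]; split.
  by apply: eq_measurable_fun mF => w; rewrite inE => /FG.
by exists M => w Sw; rewrite -FG // hM.
Qed.

Lemma bmeas_cst c : bmeas (fun=> c).
Proof. by split; [exact: measurable_cst|exists `|c|]. Qed.

Lemma bmeasD F G : bmeas F -> bmeas G -> bmeas (fun w => F w + G w).
Proof.
move=> [mF [M hM]] [mG [N hN]]; split; first exact: measurable_funD.
by exists (M + N) => w Sw; rewrite (le_trans (ler_normD _ _)) // lerD ?hM ?hN.
Qed.

Lemma bmeasM F G : bmeas F -> bmeas G -> bmeas (fun w => F w * G w).
Proof.
move=> [mF [M hM]] [mG [N hN]]; split; first exact: measurable_funM.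
by exists (M * N) => w Sw; rewrite normrM ler_pM ?hM ?hN.
Qed.

Lemma bmeasZ c F : bmeas F -> bmeas (fun w => c * F w).
Proof. by apply: bmeasM; exact: bmeas_cst. Qed.

Lemma bmeasN F : bmeas F -> bmeas (fun w => - F w).
Proof. by move=> /(bmeasZ (-1)); apply: bmeas_ext => w _; rewrite mulN1r. Qed.

Lemma bmeasB F G : bmeas F -> bmeas G -> bmeas (fun w => F w - G w).
Proof. by move=> hF /bmeasN; exact: bmeasD. Qed.

Lemma bmeas_sum (J : finType) (F : J -> 'rV[R]_n -> R) :
  (forall j, bmeas (F j)) -> bmeas (fun w => \sum_j F j w).
Proof.
move=> hF; elim: (index_enum J) => [|j s IH].
  by apply: bmeas_ext (bmeas_cst 0) => w _; rewrite big_nil.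
by apply: bmeas_ext (bmeasD (hF j) IH) => w _; rewrite big_cons.
Qed.

Lemma bmeas_coord i : bmeas (fun w => w 0 i).
Proof.
split; first by apply: measurable_continuous_at => u _; exact: coord_continuous.
by exists 1 => w; exact: coord_norm_le1.
Qed.

Lemma bmeas_dotp (V W : 'rV[R]_n -> 'rV[R]_n) :
  (forall i, bmeas (fun w => V w 0 i)) -> (forall i, bmeas (fun w => W w 0 i)) ->
  bmeas (fun w => dotp (V w) (W w)).
Proof. by move=> hV hW; apply: bmeas_sum => i; exact: bmeasM. Qed.

Lemma bmeas_dotpl a : bmeas (fun w => dotp w a).
Proof. by apply: bmeas_dotp => i; [exact: bmeas_coord|exact: bmeas_cst]. Qed.

Lemma smean_cst c : smean (fun=> c) = c.
Proof. by rewrite /smean Rintegral_cst //= (hsigma.1) mulr1. Qed.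

Lemma smeanD F G : bmeas F -> bmeas G ->
  smean (fun w => F w + G w) = smean F + smean G.
Proof. by move=> hF hG; apply: RintegralD => //; exact: bmeas_integrable. Qed.

Lemma smeanZ c F : bmeas F -> smean (fun w => c * F w) = c * smean F.
Proof. by move=> hF; apply: RintegralZl => //; exact: bmeas_integrable. Qed.

Lemma smeanN F : bmeas F -> smean (fun w => - F w) = - smean F.
Proof. by move=> hF; rewrite -mulN1r -smeanZ //; apply: eq_smean => w _; rewrite mulN1r. Qed.

Lemma smeanB F G : bmeas F -> bmeas G ->
  smean (fun w => F w - G w) = smean F - smean G.
Proof. by move=> hF hG; rewrite smeanD ?smeanN //; exact: bmeasN. Qed.

Lemma smean_sum (J : finType) (F : J -> 'rV[R]_n -> R) :
  (forall j, bmeas (F j)) -> smean (fun w => \sum_j F j w) = \sum_j smean (F j).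
Proof.
move=> hF.
suff : bmeas (fun w => \sum_(j <- index_enum J) F j w) /\
    smean (fun w => \sum_(j <- index_enum J) F j w) = \sum_(j <- index_enum J) smean (F j) by case.
elim: (index_enum J) => [|j s [IHm IH]].
  split; first by apply: bmeas_ext (bmeas_cst 0) => w _; rewrite big_nil.
  by rewrite big_nil -[RHS](smean_cst 0); apply: eq_smean => w _; rewrite big_nil.
split; first by apply: bmeas_ext (bmeasD (hF j) IHm) => w _; rewrite big_cons.
by rewrite big_cons -IH -smeanD //; apply: eq_smean => w _; rewrite big_cons.
Qed.

Lemma le_smean F G : bmeas F -> bmeas G ->
  (forall w, sphere w -> F w <= G w) -> smean F <= smean G.
Proof. by move=> hF hG FG; apply: le_Rintegral => //; exact: bmeas_integrable. Qed.

Lemma le_norm_smean F M : bmeas F -> (forall w, sphere w -> `|F w| <= M) ->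
  `|smean F| <= M.
Proof.
move=> hF hM; rewrite ler_norml; apply/andP; split.
  rewrite -(smean_cst (- M)); apply: le_smean => //; first exact: bmeas_cst.
  by move=> w /hM; rewrite ler_norml => /andP[].
rewrite -(smean_cst M); apply: le_smean => //; first exact: bmeas_cst.
by move=> w /hM; rewrite ler_norml => /andP[].
Qed.

(** Used for functions that are reached from regular ones only by pointwise limits, such as the
    profile with its jump at the poles. *)
Lemma bmeas_cvg (F_ : nat -> 'rV[R]_n -> R) F (M : R) :
  (forall m, bmeas (F_ m)) -> (forall m w, sphere w -> `|F_ m w| <= M) ->
  (forall w, sphere w -> F_ ^~ w @ \oo --> F w) -> bmeas F.
Proof.
move=> hF hM cF; split.
  by apply: (@measurable_fun_cvg _ (borel_rV R n) R _ F_) => // m; case: (hF m).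
exists M => w Sw; have /cvg_norm := cF w Sw => cn.
apply: (@closed_cvg _ _ _ _ (fun m => `|F_ m w|) [set x : R | x <= M]) cn.
  exact: closed_le.
by apply: nearW => m; exact: hM.
Qed.

Lemma smean_cvg (F_ : nat -> 'rV[R]_n -> R) F (M : R) :
  (forall m, bmeas (F_ m)) -> (forall m w, sphere w -> `|F_ m w| <= M) ->
  (forall w, sphere w -> F_ ^~ w @ \oo --> F w) -> smean \o F_ @ \oo --> smean F.
Proof.
move=> hF hM cF; have bF := bmeas_cvg hF hM cF.
have [|||||_ _] := @dominated_convergence _ _ _ sigma _ mS
  (fun m => EFin \o F_ m) (EFin \o F) (fun=> M%:E).
- by move=> m; apply/measurable_EFinP; case: (hF m).
- by apply/measurable_EFinP; case: bF.
- by apply: aeW => w Sw; apply: cvg_comp (cF w Sw) _; exact: cvg_id.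
- exact: (bmeas_integrable (bmeas_cst M)).
- by apply: aeW => w m Sw; rewrite lee_fin hM.
move=> h; apply: fine_cvg; move: h.
rewrite (_ : (\int[sigma]_(x in _) _)%E = (smean F)%:E) //.
by rewrite /smean /Rintegral fineK //; apply: integrable_fin_num => //; exact: bmeas_integrable.
Qed.

Lemma measurable_rotation (O : 'M[R]_n) :
  measurable_fun [set: borel_rV R n] ((fun u => u *m O) : borel_rV R n -> borel_rV R n).
Proof.
apply: (@measurability _ _ (borel_rV R n) (borel_rV R n) _ _ (@open 'rV[R]_n)) => //.
move=> _ [A oA <-]; rewrite setTI.
apply: sub_sigma_algebra; apply: open_comp => // u _.
rewrite /continuous_at; apply: (cvg_row (F := nbhs u)) => i; rewrite mxE; under eq_fun do rewrite mxE.
apply: (cvg_sumr (F := nbhs u)) => j; apply: cvgM; [exact: coord_continuous|exact: cvg_cst].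
Qed.

Lemma dotp_orthogonal (O : 'M[R]_n) u v : O *m O^T = 1%:M ->
  dotp (u *m O) (v *m O) = dotp u v.
Proof.
move=> hO; have dE a b : dotp a b = (a *m b^T) 0 0.
  by rewrite mxE; apply: eq_bigr => i _; rewrite mxE.
by rewrite !dE trmx_mul mulmxA -(mulmxA u) hO mulmx1.
Qed.

Lemma sphere_orthogonal (O : 'M[R]_n) u : O *m O^T = 1%:M ->
  sphere (u *m O) <-> sphere u.
Proof. by move=> hO; rewrite !sphereE dotp_orthogonal. Qed.

Lemma smean_rot (O : 'M[R]_n) F : O *m O^T = 1%:M -> bmeas F ->
  smean (fun w => F (w *m O)) = smean F.
Proof.
move=> hO hF; have hO' := sphere_orthogonal _ hO.
pose phi := (fun u => u *m O) : borel_rV R n -> borel_rV R n.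
have mphi : measurable_fun setT phi := measurable_rotation O.
rewrite /smean /Rintegral; congr fine.
have pS : phi @^-1` (@sphere R n) = @sphere R n.
  by apply/seteqP; split => u /hO'.
pose F1 : borel_rV R n -> R := F \_ (@sphere R n).
have F1E w : sphere w -> F1 w = F w by move=> Sw; rewrite /F1 patchE mem_set.
have mF1 : measurable_fun setT F1.
  by apply: (iffLR (@measurable_restrictT _ _ (borel_rV R n) R (@sphere R n) F mS)); case: hF.

have bF1 : [bounded F1 w | w in [set: 'rV[R]_n]].
  case: hF => _ [M hM]; exists `|M|; split => [|N MN w _]; first exact: num_real.
  rewrite /= /F1 patchE; case: ifPn => [|_]; last by rewrite normr0 ltW // (le_lt_trans _ MN).
  by rewrite inE => /hM h; rewrite (le_trans h) // (le_trans (ler_norm _)) // ltW.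
transitivity (\int[pushforward sigma phi]_(w in @sphere R n : set (borel_rV R n)) (F1 w)%:E)%E.
  rewrite integral_pushforward // ?pS.
  - by apply: eq_integral => w; rewrite inE => Sw; rewrite /= F1E // hO'.
  - by apply/measurable_EFinP.
  - apply: measurable_bounded_integrable => //; first exact: sigma_sphere_fin.
      by apply: measurable_funTS; apply: measurableT_comp.
    case: bF1 => M [Mr hM]; exists M; split => // N MN w _; exact: hM.
transitivity (\int[sigma]_(w in @sphere R n : set (borel_rV R n)) (F1 w)%:E)%E.
  by apply: eq_measure_integral => A mA _; exact: hsigma.2.
by apply: eq_integral => w; rewrite inE => Sw; rewrite F1E.
Qed.

Lemma bmeas_rot (O : 'M[R]_n) F : O *m O^T = 1%:M -> bmeas F ->
  bmeas (fun w => F (w *m O)).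
Proof.
move=> hO [mF [M hM]]; split; last first.
  by exists M => w Sw; apply: hM; apply/sphere_orthogonal.
apply: (@measurable_comp _ _ _ (borel_rV R n) (borel_rV R n) R (@sphere R n)) => //.
  by move=> _ [w Sw <-]; apply/sphere_orthogonal.
exact: measurable_funTS (measurable_rotation O).
Qed.

(** Differentiation under the mean with a constant as dominating function, which is integrable
    because [sigma] is finite. *)
Lemma is_derive_smean (F : R -> 'rV[R]_n -> R) (F' : 'rV[R]_n -> R) (a e M : R) :
  0 < e -> (forall h, `|h - a| < e -> bmeas (F h)) ->
  (forall h w, `|h - a| < e -> sphere w -> derivable (F ^~ w) h 1 /\ `|'D_1 (F ^~ w) h| <= M) ->
  (forall w, sphere w -> 'D_1 (F ^~ w) a = F' w) ->
  is_derive a 1 (fun h => smean (F h)) (smean F').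
Proof.
move=> e0 bF dF F'E.
have hI h : `]a - e, a + e[%classic h -> `|h - a| < e.
  by rewrite /= in_itv /= ltr_distl.
have Ia : `]a - e, a + e[%classic a by rewrite /= in_itv /=; lra.
(* The sphere is not empty because it has mass 1; a point on it yields [0 <= M]. *)
have [w0 Sw0] : exists w : 'rV[R]_n, sphere w.
  apply: contrapT => h; have := smean_cst 1.
  rewrite (@eq_smean (fun=> 1) (fun=> 0)); last by move=> w Sw; exfalso; apply: h; exists w.
  by rewrite smean_cst => /eqP; rewrite eq_sym oner_eq0.
have M0 : 0 <= M.
  by apply: le_trans (dF a w0 _ Sw0).2; rewrite ?normr_ge0 // subrr normr0.
have intF h : `]a - e, a + e[%classic h -> sigma.-integrable (@sphere R n : set (borel_rV R n)) (EFin \o F h).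
  by move=> /hI /bF; exact: bmeas_integrable.
have der h w : `]a - e, a + e[%classic h -> sphere w -> derivable (F ^~ w) h 1.
  by move=> /hI hh Sw; case: (dF h w hh Sw).
have bnd h w : `]a - e, a + e[%classic h -> sphere w -> `|partial1of2 F h w| <= M.
  by move=> /hI hh Sw; rewrite partial1of2E; case: (dF h w hh Sw).
have intM := bmeas_integrable (bmeas_cst M).
have D := @derivable_under_integral R _ (borel_rV R n) sigma F _ mS a _ _ Ia intF der (fun=> M) (fun=> M0) intM bnd.
apply: DeriveDef => //; rewrite -derive1E.
rewrite (@differentiation_under_integral R _ (borel_rV R n) sigma F _ mS a _ _ Ia intF der
  (fun=> M) (fun=> M0) intM bnd).
by apply: eq_smean => w Sw; rewrite partial1of2E F'E.
Qed.

End sphere_mean.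

(** * Regularity and continuity in kappa of the profiles *)

Section h10_bound.
Variable R : realType.
Local Notation leb := (@lebesgue_measure R).
Implicit Types F u v phi : R -> R.

Lemma int0pi_oo F : measurable_fun `]0, pi[ F ->
  int0pi F = \int[leb]_(x in `]0, pi[) F x.
Proof.
move=> mF; rewrite /int0pi /Rintegral; congr fine.
have mE : measurable_fun `]0, pi[ (EFin \o F) by apply/measurable_EFinP.
rewrite -integral_itv_obnd_cbnd; last by apply/emeasurable_fun_itv_bndo_bndcP.
by rewrite integral_itv_bndo_bndc.
Qed.

Lemma smooth_derivable phi x : smooth_on [set: R^o] phi -> derivable phi x 1.
Proof. by move=> h; apply/derivable1_diffP; exact: (h [::] x I). Qed.

Lemma smooth_derive1_continuous phi : smooth_on [set: R^o] phi -> continuous (derive1 phi).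
Proof.
move=> h x; apply: differentiable_continuous.
have := h [:: (1 : R^o)] x I; rewrite /iter_derive /=.
by rewrite (_ : derive1 phi = 'D_1 phi) //; apply/funext => y; rewrite derive1E.
Qed.

(** Cauchy-Schwarz for the increment, read off from the nonnegative integral of [(phi' - A)^2],
    where [A] is the mean slope on [[p, q]]. *)
Lemma ftc_increment_sqr phi (p q : R) : smooth_on [set: R^o] phi -> p < q ->
  (phi q - phi p) ^+ 2 <= (q - p) * \int[leb]_(x in `[p, q]) (derive1 phi x ^+ 2).
Proof.
move=> sphi pq.
have dphi x : derivable phi x 1 by exact: smooth_derivable.
have cphi' : continuous (derive1 phi) by exact: smooth_derive1_continuous.
have cphi : continuous phi by move=> x; apply/differentiable_continuous/derivable1_diffP.
have ftc : \int[leb]_(x in `[p, q]) derive1 phi x = phi q - phi p.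
  have E : (\int[leb]_(x in `[p, q]) (derive1 phi x)%:E = (phi q)%:E - (phi p)%:E)%E.
    apply: (@continuous_FTC2 R _ phi p q pq).
    - exact: continuous_subspaceT.
    - split; [by move=> x _; exact: dphi|exact/cvg_at_right_filter/cphi|].
      exact/cvg_at_left_filter/cphi.
    - by move=> x _.
  by rewrite /Rintegral E.
set A := (phi q - phi p) / (q - p).
have cint (F : R -> R) : continuous F -> leb.-integrable `[p, q] (EFin \o F).
  move=> cF; apply: continuous_compact_integrable; first exact: segment_compact.
  exact: continuous_subspaceT.
have c2 : continuous (fun x => derive1 phi x ^+ 2).
  by move=> x; apply: cvgM; exact: cphi'.
have : 0 <= \int[leb]_(x in `[p, q]) ((derive1 phi x - A) ^+ 2).
  by apply: Rintegral_ge0 => x _; exact: sqr_ge0.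
rewrite (_ : \int[leb]_(x in `[p, q]) _ =
    \int[leb]_(x in `[p, q]) (derive1 phi x ^+ 2 - 2 * A * derive1 phi x + A ^+ 2)); last first.
  by apply: eq_Rintegral => x _; ring.
have c1 : continuous (fun x => 2 * A * derive1 phi x).
  by move=> x; apply: cvgM; [exact: cvg_cst|exact: cphi'].
rewrite RintegralD //; last 2 first.
- by apply: cint => x; apply: cvgB; [exact: c2|exact: c1].
- by apply: cint; exact: cst_continuous.
rewrite RintegralB //; last 2 first.
- exact: cint.
- exact: cint.
rewrite RintegralZl // ?ftc; last exact: cint.
rewrite Rintegral_cst //= lebesgue_measure_itv /= lte_fin pq /=.
set X := \int[_]_(x in _) _ => h.
have qp : 0 < q - p by rewrite subr_gt0.
rewrite -ler_pdivrMl //.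
have -> : (q - p)^-1 * (phi q - phi p) ^+ 2 = 2 * A * (phi q - phi p) - A ^+ 2 * (q - p).
  by rewrite /A; field; rewrite gt_eqF.
lra.
Qed.

Lemma test_0pi_bound phi (x : R) : test_0pi phi -> 0 < x < pi ->
  let S := \int[leb]_(x in `]0, pi[) (derive1 phi x ^+ 2) in
  phi x ^+ 2 <= x * S /\ phi x ^+ 2 <= (pi - x) * S.
Proof.
move=> [sphi [a [b [a0 bpi out]]]] /andP[x0 xpi] S.
have p0 : phi 0 = 0 by apply: out; lra.
have ppi : phi pi = 0 by apply: out; lra.
have cphi' : continuous (derive1 phi) by exact: smooth_derive1_continuous.
have c2 : continuous (fun x => derive1 phi x ^+ 2).
  by move=> y; apply: cvgM; exact: cphi'.
have m2 (A : set R) : measurable A -> measurable_fun A (fun x => derive1 phi x ^+ 2).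
  by move=> mA; apply: measurable_funTS; exact: continuous_measurable_fun.
have S_E : S = \int[leb]_(x in `[0, pi]) (derive1 phi x ^+ 2).
  by rewrite /S -int0pi_oo //; exact: m2.
have sub (p q : R) : 0 <= p -> p < q -> q <= pi ->
    \int[leb]_(x in `[p, q]) (derive1 phi x ^+ 2) <= S.
  move=> p0' pq qpi; rewrite S_E /Rintegral fine_le //.
  - apply: integrable_fin_num => //; apply: continuous_compact_integrable.
      exact: segment_compact.
    exact: continuous_subspaceT.
  - apply: integrable_fin_num => //; apply: continuous_compact_integrable.
      exact: segment_compact.
    exact: continuous_subspaceT.
  apply: ge0_subset_integral => //.
  - by apply/measurable_EFinP; exact: m2.
  - by move=> y _; rewrite lee_fin sqr_ge0.
  - by move=> y /=; rewrite !in_itv /= => /andP[py yq]; lra.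
split.
- have := ftc_increment_sqr sphi x0; rewrite p0 !subr0 => /le_trans; apply.
  by rewrite ler_pM2l // sub // ltW.
- have := ftc_increment_sqr sphi xpi; rewrite ppi sub0r sqrrN => /le_trans; apply.
  by rewrite ler_pM2l ?subr_gt0 // sub // ltW.
Qed.

Lemma sqr_split (a b : R) : a ^+ 2 <= 2 * (a - b) ^+ 2 + 2 * b ^+ 2.
Proof. by have := sqr_ge0 (a - 2 * b); nra. Qed.

Lemma integrable_oo_continuous F : continuous F ->
  leb.-integrable `]0, pi[ (fun x => (F x)%:E).
Proof.
move=> cF.
have h : leb.-integrable `[0, pi] (EFin \o F).
  apply: continuous_compact_integrable; first exact: segment_compact.
  exact: continuous_subspaceT.
by apply: integrableS h => //; exact: subset_itv_oo_cc.
Qed.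

Lemma integrable_oo_scale (A : set R) F (c : R) : measurable A ->
  leb.-integrable A (fun x => (F x)%:E) -> leb.-integrable A (fun x => (c * F x)%:E).
Proof. by move=> mA h; under eq_fun do rewrite EFinM; exact: integrableZl. Qed.

Lemma integrable_oo_add (A : set R) F v : measurable A ->
  leb.-integrable A (fun x => (F x)%:E) -> leb.-integrable A (fun x => (v x)%:E) ->
  leb.-integrable A (fun x => (F x + v x)%:E).
Proof. by move=> mA h1 h2; under eq_fun do rewrite EFinD; exact: integrableD. Qed.

Lemma L2_sub_integrable F v : continuous F -> L2_0pi v ->
  leb.-integrable `]0, pi[ (fun x => ((F x - v x) ^+ 2)%:E).
Proof.
move=> cF [mv iv].
have iF : leb.-integrable `]0, pi[ (fun x => (F x ^+ 2)%:E).
  by apply: integrable_oo_continuous => x; apply: cvgM; exact: cF.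
have mF : measurable_fun `]0, pi[ F.
  by apply: measurable_funTS; exact: continuous_measurable_fun.
have mI : measurable (`]0, pi[ : set R) by exact: measurable_itv.
have iD := integrable_oo_add mI (integrable_oo_scale 2 mI iF) (integrable_oo_scale 2 mI iv).
apply: le_integrable iD => //.
  by apply/measurable_EFinP; apply: measurable_funX; exact: measurable_funB.
move=> x _; rewrite !abse_EFin lee_fin.
rewrite !ger0_norm; do ?[exact: sqr_ge0 | exact: ler0n | apply: addr_ge0 | apply: mulr_ge0].
by have := sqr_ge0 (F x + v x); nra.
Qed.

(** If [|u x| > B x], then by continuity [|u| - B] stays above half of the excess on an interval
    around [x]. There every [phi_ k] bounded by [B] is at distance at least [c] from [u], which
    keeps the L^2 distance away from 0. *)
Lemma L2_cvg_le (phi_ : nat -> R -> R) u (B : R -> R) :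
  (forall k, continuous (phi_ k)) -> L2_0pi u ->
  int0pi (fun x => (phi_ k x - u x) ^+ 2) @[k --> \oo] --> (0 : R) ->
  (forall x, 0 < x < pi -> {for x, continuous u}) ->
  (forall x, 0 < x < pi -> {for x, continuous B}) ->
  (\forall k \near \oo, forall x, 0 < x < pi -> `|phi_ k x| <= B x) ->
  forall x, 0 < x < pi -> `|u x| <= B x.
Proof.
move=> cphi L2u cvg0 cu cB leB x hx; rewrite leNgt; apply/negP => Bu.
pose c := (`|u x| - B x) / 2.
have c0 : 0 < c by rewrite /c divr_gt0 // subr_gt0.
have : \forall y \near x, c < `|u y| - B y.
  have /cvgr_gt : `|u y| - B y @[y --> x] --> `|u x| - B x.
    by apply: cvgB; [apply: cvg_norm; exact: cu|exact: cB].
  by apply; rewrite /c ltr_pdivrMr // ltr_pMr ?subr_gt0 // ltr1n.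
move=> /nbhs_ballP[d /= d0 hd].
pose e := Num.min (d / 2) (Num.min (x / 2) ((pi - x) / 2)).
have [x0 xpi] := andP hx.
have e0 : 0 < e by rewrite /e !lt_min !divr_gt0 // subr_gt0.
have [ed ex exp] : [/\ e <= d / 2, e <= x / 2 & e <= (pi - x) / 2].
  by rewrite /e; split; rewrite !ge_min lexx ?orbT.
have low k y : (forall x, 0 < x < pi -> `|phi_ k x| <= B x) ->
    y \in `[x - e, x + e] -> c ^+ 2 <= (phi_ k y - u y) ^+ 2.
  move=> hk; rewrite in_itv /= => hy.
  have hy' : 0 < y < pi by lra.
  have by_ : ball x d y by rewrite /ball /= ltr_distl; lra.
  have h1 := hd y by_; have h2 := hk y hy'.
  have h3 : c <= `|phi_ k y - u y|.
    by rewrite distrC; apply: le_trans (lerB_dist _ _); lra.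
  by rewrite -[leRHS]real_normK ?num_real // lerXn2r // nnegrE ?normr_ge0 // ltW.
have Lpos : 0 < c ^+ 2 * (e *+ 2) by rewrite mulr_gt0 ?exprn_gt0 // mulrn_wgt0.
have small : \forall k \near \oo, int0pi (fun x => (phi_ k x - u x) ^+ 2) < c ^+ 2 * (e *+ 2).
  exact: cvgr_lt cvg0 _ Lpos.
have [k [hk1 hk2]] := filter_ex (filterI small leB).
move: hk1; apply/negP; rewrite -leNgt.
have iphi := L2_sub_integrable (cphi k) L2u.
have mphi : measurable_fun `]0, pi[ (fun x => (phi_ k x - u x) ^+ 2).
  by have /integrableP[/measurable_EFinP] := iphi.
rewrite int0pi_oo //.
have sub : `[x - e, x + e] `<=` (`]0, pi[ : set R).
  by move=> y /=; rewrite !in_itv /=; lra.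
have iphi' : leb.-integrable `[x - e, x + e] (fun x => ((phi_ k x - u x) ^+ 2)%:E).
  by apply: integrableS iphi.
apply: (@le_trans _ _ (\int[leb]_(y in `[x - e, x + e]) ((phi_ k y - u y) ^+ 2))).
  have -> : c ^+ 2 * (e *+ 2) = \int[leb]_(y in `[x - e, x + e]) (c ^+ 2).
    rewrite Rintegral_cst //= lebesgue_measure_itv /= lte_fin.
    rewrite ifT; last by lra.
    by rewrite /= mulr2n; congr (_ * _); ring.
  apply: le_Rintegral => //.
  - apply: continuous_compact_integrable; first exact: segment_compact.
    by apply: continuous_subspaceT; exact: cst_continuous.
  - by move=> y hy; apply: low.
rewrite /Rintegral fine_le //.
- exact: integrable_fin_num.
- exact: integrable_fin_num.
apply: ge0_subset_integral => //.
- by apply/measurable_EFinP.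
- by move=> y _; rewrite lee_fin sqr_ge0.
Unshelve. all: by end_near. Qed.

Lemma H10_bound u : H10_0pi u -> (forall x, 0 < x < pi -> {for x, continuous u}) ->
  exists2 C : R, 0 <= C & forall x, 0 < x < pi -> u x ^+ 2 <= C * x /\ u x ^+ 2 <= C * (pi - x).
Proof.
move=> [L2u [v [L2v [phi_ [tphi cvgu cvgv]]]]] cu.
have cphi k : continuous (phi_ k).
  by move=> x; apply/differentiable_continuous/derivable1_diffP/smooth_derivable; case: (tphi k).
have cphi' k : continuous (derive1 (phi_ k)).
  by apply: smooth_derive1_continuous; case: (tphi k).
pose V := \int[leb]_(x in `]0, pi[) (v x ^+ 2).
have V0 : 0 <= V by apply: Rintegral_ge0 => x _; exact: sqr_ge0.
(* Eventually the integral of [(phi_k' - v)^2] is below 1, so by [sqr_split] that of [phi_k'^2] is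
   at most [2 * 1 + 2 * V]. *)
pose C := 2 + 2 * V.
have bS : \forall k \near \oo, \int[leb]_(x in `]0, pi[) (derive1 (phi_ k) x ^+ 2) <= C.
  have : \forall k \near \oo, int0pi (fun x => (derive1 (phi_ k) x - v x) ^+ 2) < 1.
    exact: cvgr_lt cvgv _ _.
  apply: filterS => k hk.
  have i1 := L2_sub_integrable (cphi' k) L2v.
  have mI : measurable (`]0, pi[ : set R) by exact: measurable_itv.
  have i2 := integrable_oo_scale 2 mI i1.
  have i3 := integrable_oo_scale 2 mI L2v.2.
  apply: (@le_trans _ _ (\int[leb]_(x in `]0, pi[)
      (2 * (derive1 (phi_ k) x - v x) ^+ 2 + 2 * v x ^+ 2))).
    apply: le_Rintegral => //.
    - by apply: integrable_oo_continuous => x; apply: cvgM; exact: cphi'.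
    - exact: (integrable_oo_add mI i2 i3).
    - by move=> x _; exact: sqr_split.
  rewrite RintegralD // !RintegralZl //; last exact: L2v.2.
  rewrite int0pi_oo in hk; last by have /integrableP[/measurable_EFinP] := i1.
  rewrite /C -/V; move: hk; set X := Rintegral _ _ _ => hk; lra.
have C0 : 0 <= C by rewrite /C; lra.
(* Both ends are treated at once: [r] is the distance to 0 or to [pi]. *)
have key (r : R -> R) : (forall x, 0 < x < pi -> 0 < r x) ->
    (forall x, {for x, continuous r}) ->
    (forall k x, 0 < x < pi -> phi_ k x ^+ 2 <= r x *
      \int[leb]_(x in `]0, pi[) (derive1 (phi_ k) x ^+ 2)) ->
    forall x, 0 < x < pi -> u x ^+ 2 <= C * r x.
  move=> r0 cr h x hx.
  have := @L2_cvg_le phi_ u (fun x => Num.sqrt (C * r x)) cphi L2u cvgu cu _ _ x hx.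
  move=> /(_ _ _)/wrap[].
  - move=> y _; apply: continuous_comp; last exact: sqrt_continuous.
    by apply: cvgM; [exact: cvg_cst|exact: cr].
  - apply: filterS bS => k hk y hy.
    rewrite -sqrtr_sqr ler_wsqrtr // (le_trans (h k y hy)) // mulrC ler_wpM2r //.
    by rewrite ltW // r0.
  rewrite -sqrtr_sqr ler_sqrt // mulr_ge0 // ltW // r0 //.
exists C => // x hx; split.
  apply: (key id) => // [y /andP[]//|y|k y hy]; first exact: cvg_id.
  by case: (test_0pi_bound (tphi k) hy).
apply: (key (fun y => pi - y)) => // [y /andP[]|y|k y hy]; first by rewrite subr_gt0.
  by apply: cvgB; [exact: cvg_cst|exact: cvg_id].
by case: (test_0pi_bound (tphi k) hy).
Qed.

End h10_bound.
Ltac nn := repeat (first [ done | exact: sqr_ge0 | exact: normr_ge0 | apply: addr_ge0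
  | apply: mulr_ge0 | apply: exprn_ge0 | apply: ltW; done | apply: invr_ge0 | lra ]).

(** * Regularity at an end point of a function [H] whose flux [Y] is comparable to [x ^ n * H'] *)

Section regular_end.
Variable R : realType.

Variables (m : nat) (H Y H' Y' : R -> R) (d c C B : R).
Hypotheses (d0 : 0 < d) (c0 : 0 < c).
Let n := m.+2.
Hypothesis dH : forall x, 0 < x <= d -> is_derive x 1 H (H' x).
Hypothesis dY : forall x, 0 < x <= d -> is_derive x 1 Y (Y' x).
Hypothesis Y_ge : forall x, 0 < x <= d -> c * x ^+ n * `|H' x| <= `|Y x|.
Hypothesis Y_le : forall x, 0 < x <= d -> `|Y x| <= C * x ^+ n * `|H' x|.
Hypothesis Y'_le : forall x, 0 < x <= d -> `|Y' x| <= C * x ^+ n * (`|H x| + 1).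
Hypothesis H_le : forall x, 0 < x <= d -> x ^+ m.+1 * H x ^+ 2 <= B.

Let C0 : 0 <= C.
Proof.
have hd : 0 < d <= d by rewrite d0 lexx.
have h := le_trans (normr_ge0 _) (Y'_le hd).
move: h; rewrite -mulrA pmulr_lge0 // mulr_gt0 ?exprn_gt0 //.
Qed.

(* If [|Y|] stayed above [l] then [|H'| >= l / (C x^n)], and the increment of
   [H] between [x] and [2 x] would be of order [x^(1-n)], against [H_le]. *)
Lemma regular_end_liminf (l x : R) : 0 < l -> 0 < x <= d ->
  exists2 y, 0 < y < x & `|Y y| < l.
Proof.
move=> l0 /andP[x0 xd]; apply: contrapT => hno.
have hge y : 0 < y < x -> l <= `|Y y|.
  by move=> hy; rewrite leNgt; apply/negP => h; apply: hno; exists y.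
have hdd : 0 < d <= d by rewrite d0 lexx.
have B0 : 0 <= B.
  by apply: le_trans (H_le hdd); nn.
pose K := 4 * B * C ^+ 2 * (2 ^+ n) ^+ 2.
have K0 : 0 <= K by rewrite /K; nn.
(* The bound [x / 4] keeps [2 * e] inside the interval, [e <= 1] absorbs surplus powers of [e], and
   the last bound contradicts the inequality [l ^ 2 <= K * e] reached at the end. *)
pose e := Num.min (x / 4) (Num.min 1 (l ^+ 2 / (2 * (K + 1)))).
have e0 : 0 < e by rewrite /e !lt_min !divr_gt0 ?ltr01 ?exprn_gt0 ?mulr_gt0 // ltr_wpDl.
have [ex e1 el] : [/\ e <= x / 4, e <= 1 & e <= l ^+ 2 / (2 * (K + 1))].
  by rewrite /e; split; rewrite !ge_min lexx ?orbT.
have [xi hxi E] : exists2 xi, e < xi < 2 * e & H (2 * e) - H e = H' xi * (2 * e - e).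
  by apply: MVT_cc => [|y hy]; [lra|apply: dH; lra].
have h1 : l <= C * (2 * e) ^+ n * `|H' xi|.
  apply: le_trans (hge xi _) _; first lra.
  apply: le_trans (Y_le _) _; first lra.
  rewrite ler_wpM2r // ler_wpM2l // lerXn2r ?nnegrE; lra.
have h2 : l * e <= C * (2 * e) ^+ n * `|H (2 * e) - H e|.
  rewrite E (_ : 2 * e - e = e); last by ring.
  by rewrite normrM (gtr0_norm e0) mulrA ler_wpM2r // ltW.
have h3 : (l * e) ^+ 2 <= (C * (2 * e) ^+ n) ^+ 2 * (H (2 * e) - H e) ^+ 2.
  rewrite -[(H _ - _) ^+ 2]real_normK ?num_real // -exprMn lerXn2r // nnegrE.
    by rewrite mulr_ge0 // ltW.
  by apply: le_trans h2; rewrite mulr_ge0 // ltW.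
have He : e ^+ m.+1 * H e ^+ 2 <= B by apply: H_le; lra.
have H2e : e ^+ m.+1 * H (2 * e) ^+ 2 <= B.
  have : (2 * e) ^+ m.+1 * H (2 * e) ^+ 2 <= B by apply: H_le; lra.
  apply: le_trans; rewrite ler_wpM2r ?sqr_ge0 // lerXn2r ?nnegrE; lra.
have h4 : e ^+ m.+1 * (H (2 * e) - H e) ^+ 2 <= 4 * B.
  have : (H (2 * e) - H e) ^+ 2 <= 2 * H (2 * e) ^+ 2 + 2 * H e ^+ 2.
    by have := sqr_ge0 (H (2 * e) + H e); nra.
  have e0' : 0 <= e ^+ m.+1 by rewrite exprn_ge0 // ltW.
  by move=> /(ler_wpM2l e0') /le_trans; apply; rewrite mulrDr; nra.
have h5 : (l * e) ^+ 2 <= K * e ^+ m.+3.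
  apply: (le_trans h3).
  have -> : (C * (2 * e) ^+ n) ^+ 2 * (H (2 * e) - H e) ^+ 2 =
      C ^+ 2 * (2 ^+ n) ^+ 2 * e ^+ m.+3 * (e ^+ m.+1 * (H (2 * e) - H e) ^+ 2).
    have ee : (e ^+ n) ^+ 2 = e ^+ m.+3 * e ^+ m.+1.
      by rewrite -exprM -exprD /n muln2 -addnn !addSn !addnS.
    rewrite (exprMn _ 2 e) [in LHS]exprMn [(_ * e ^+ n) ^+ 2]exprMn ee.
    by move: (2 ^+ n) (e ^+ m.+3) (e ^+ m.+1) => u v w; ring.
  apply: le_trans (ler_wpM2l _ h4) _.
    have ep : 0 <= e ^+ m.+3 by rewrite exprn_ge0 // ltW.
    by rewrite mulr_ge0 // mulr_ge0 // sqr_ge0.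
  rewrite (_ : K * _ = C ^+ 2 * 2 ^+ n ^+ 2 * e ^+ m.+3 * (4 * B)) // /K.
  by move: (2 ^+ n) (e ^+ m.+3) => u v; ring.
have h6 : e ^+ m.+3 <= e ^+ 2 * e.
  have : e ^+ m <= 1 by rewrite exprn_ile1 // ltW.
  rewrite !exprS expr0 mulr1 => h.
  by rewrite mulrA mulrA -[leRHS]mulr1 ler_wpM2l // !mulr_ge0 // ltW.
have h7 : l ^+ 2 <= K * e.
  have := le_trans h5 (ler_wpM2l K0 h6).
  rewrite exprMn (_ : K * (e ^+ 2 * e) = K * e * e ^+ 2); last by rewrite mulrA mulrAC.
  by rewrite ler_pM2r // exprn_gt0.
move: el; rewrite ler_pdivlMr ?mulr_gt0 ?ltr_wpDl // => el.
have : 0 < l ^+ 2 by rewrite exprn_gt0.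
nra.
Qed.

(** The bound on [H] bounds [Y'], which is integrated from a point [y < x] where [|Y|] is as small
    as desired; [regular_end_liminf] supplies it. Thus [Y] behaves as if it vanished at the end
    point, and one power of [x] is gained. *)
Lemma regular_end_step a K : (a <= m.+1)%N ->
  (forall x, 0 < x <= d -> `|H x| * x ^+ a <= K) ->
  exists2 K', 0 <= K' & forall x, 0 < x <= d -> `|Y x| <= K' * x ^+ (n - a) * x.
Proof.
move=> am hK.
have hdd : 0 < d <= d by rewrite d0 lexx.
have K0 : 0 <= K.
  by apply: le_trans (hK d hdd); rewrite mulr_ge0 ?normr_ge0 // exprn_ge0 // ltW.
pose K' := C * (K + d ^+ a).
have K'0 : 0 <= K' by rewrite /K' mulr_ge0 // addr_ge0 // exprn_ge0 // ltW.
have an : (a <= n)%N by rewrite (leq_trans am).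
have hY' x : 0 < x <= d -> `|Y' x| <= K' * x ^+ (n - a).
  move=> hx; have [x0 xd] := andP hx; apply: le_trans (Y'_le hx) _.
  rewrite -{1}(subnK an) exprD mulrA -mulrA [leLHS]mulrAC /K' -!mulrA ler_wpM2l //.
  rewrite mulrA ler_wpM2r //; first by nn.
  by rewrite mulrDr mulr1 mulrC lerD ?hK // lerXn2r // nnegrE; nn.
exists K' => // x hx; have [x0 xd] := andP hx.
apply/ler_addgt0Pr => e e0.
have [y hy ye] := regular_end_liminf e0 hx.
have [xi hxi E] : exists2 xi, y < xi < x & Y x - Y y = Y' xi * (x - y).
  by apply: MVT_cc => [|z hz]; [lra|apply: dY; lra].
have hxi' : 0 < xi <= d by lra.
have h1 : `|Y x - Y y| <= K' * x ^+ (n - a) * x.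
  rewrite E normrM; apply: ler_pM => //; last by rewrite ger0_norm; lra.
  apply: le_trans (hY' xi hxi') _; rewrite ler_wpM2l // lerXn2r ?nnegrE; lra.
rewrite -(subrK (Y y) (Y x)); apply: le_trans (ler_normD _ _) _.
by rewrite lerD // ltW.
Qed.

(** Induction that lowers by one, at each round, the exponent [a] in [|H| * x ^ a <= K]. From
    exponent [a + 1] the previous lemma bounds [|H'| * x ^ a], and the mean value theorem between
    [x] and [d] turns this into a bound on [|H| * x ^ a]. The initial exponent [m + 1] comes from
    [H_le]; exponent 0 is the claim. *)
Lemma regular_end : exists M : R, forall x, 0 < x <= d ->
  `|H x| <= M /\ `|Y x| <= M * x ^+ n.+1.
Proof.
have hdd : 0 < d <= d by rewrite d0 lexx.
have B0 : 0 <= B.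
  by apply: le_trans (H_le hdd); nn.
have bnd j : (j <= m.+1)%N -> exists K, forall x, 0 < x <= d -> `|H x| * x ^+ (m.+1 - j) <= K.
  elim: j => [_|j IH jm].
    exists (Num.sqrt (B * d ^+ m.+1)) => x hx; have [x0 xd] := andP hx.
    have n0 : 0 <= `|H x| * x ^+ m.+1 by nn.
    rewrite subn0 -[leLHS]ger0_norm // -sqrtr_sqr.
    rewrite ler_wsqrtr // exprMn real_normK ?num_real // (_ : _ * _ = x ^+ m.+1 * H x ^+ 2 * x ^+ m.+1); last by ring.
    apply: ler_pM; [by nn|by nn|by have := H_le hx|by rewrite lerXn2r // nnegrE; nn].
  have [K hK] := IH (ltnW jm).
  have [K' K'0 hK'] := regular_end_step (leq_subr _ _) hK.
  pose a := (m.+1 - j.+1)%N.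
  have ea : (m.+1 - j = a.+1)%N by rewrite /a subnSK.
  have hH' x : 0 < x <= d -> `|H' x| * x ^+ a <= K' / c.
    move=> hx; have [x0 xd] := andP hx.
    have := le_trans (Y_ge hx) (hK' x hx); rewrite ea.
    have en : n = (n - a.+1 + a.+1)%N by rewrite subnK // /n; lia.
    rewrite {1}en exprD exprSr ler_pdivlMr //.
    have xp : 0 < x ^+ (n - a.+1) * x by rewrite mulr_gt0 // exprn_gt0.
    rewrite (_ : c * _ * _ = `|H' x| * x ^+ a * c * (x ^+ (n - a.+1) * x)); last by ring.
    by rewrite -(mulrA K') ler_pM2r.
  have K'c : 0 <= K' / c by rewrite divr_ge0 // ltW.
  exists (`|H d| * d ^+ a + K' / c * d) => x hx; have [x0 xd] := andP hx.
  move: xd; rewrite le_eqVlt => /predU1P[->|xd].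
    by rewrite lerDl mulr_ge0 // ltW.
  have [xi hxi E] : exists2 xi, x < xi < d & H d - H x = H' xi * (d - x).
    by apply: MVT_cc => [|z hz]; [lra|apply: dH; lra].
  have xa : 0 <= x ^+ a by rewrite exprn_ge0 // ltW.
  have -> : H x = H d - H' xi * (d - x) by rewrite -E; ring.
  apply: le_trans (ler_wpM2r xa (ler_normB _ _)) _; rewrite mulrDl lerD //.
    by rewrite ler_wpM2l // lerXn2r ?nnegrE; lra.
  rewrite normrM mulrAC; apply: ler_pM => //; first by rewrite mulr_ge0.
    apply: le_trans (hH' xi _); last lra.
    by rewrite ler_wpM2l // lerXn2r ?nnegrE; lra.
  by rewrite ger0_norm; lra.
have [K hK] := bnd m.+1 (leqnn _); rewrite subnn in hK.
have [K' K'0 hK'] := regular_end_step (leq0n _) hK.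
exists (Num.max K K') => x hx; split.
  by have := hK x hx; rewrite expr0 mulr1 => h; rewrite le_max h.
apply: le_trans (hK' x hx) _; rewrite subn0 -mulrA -exprSr ler_wpM2r //.
  by rewrite exprn_ge0 // ltW //; case/andP: hx.
by rewrite le_max lexx orbT.
Qed.

End regular_end.

(** * Maximum principle for an equation in divergence form *)

Section max_principle.
Variable R : realType.

(* At a negative minimum of [z] one has [Q = W z' = 0], while [Q' < 0] makes [z]
   decrease to the right. *)
Lemma max_principle (z z' W Q Q' : R -> R) (b : R) :
  (forall x, 0 < x < b -> is_derive x 1 z (z' x)) ->
  (forall x, 0 < x < b -> 0 < W x) ->
  (forall x, 0 < x < b -> Q x = W x * z' x) ->
  (forall x, 0 < x < b -> is_derive x 1 Q (Q' x)) ->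
  (forall x, 0 < x < b -> z x < 0 -> Q' x < 0) ->
  (forall e : R, 0 < e -> exists2 d, 0 < d & forall x, 0 < x < b ->
     (x < d) || (b - d < x) -> - e <= z x) ->
  forall x, 0 < x < b -> 0 <= z x.
Proof.
move=> dz W0 QE dQ Qneg zb x0 hx0; rewrite leNgt; apply/negP => z0.
have e0 : 0 < - z x0 / 2 by lra.
have [d d0 hd] := zb _ e0.
(* [p] and [q = b - p] are closer than [d] to the two ends, where [z] is at least [z x0 / 2], which
   exceeds the negative number [z x0]. The minimum of [z] over [[p, q]] is therefore interior. *)
pose p := Num.min x0 (Num.min d (b / 2)) / 2.
pose q := b - p.
have [px pd pb] : [/\ p <= x0 / 2, p <= d / 2 & p <= b / 4].
  have h1 : Num.min x0 (Num.min d (b / 2)) <= x0 by rewrite ge_min lexx.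
  have h2 : Num.min x0 (Num.min d (b / 2)) <= d by rewrite !ge_min lexx orbT.
  have h3 : Num.min x0 (Num.min d (b / 2)) <= b / 2 by rewrite !ge_min lexx !orbT.
  by rewrite /p; split; lra.
have p0 : 0 < p by rewrite /p divr_gt0 // !lt_min; lra.
have hxp : p < x0 by lra.
have hxq : x0 < q.
  rewrite /q ltNge; apply/negP => h.
  have hor : (x0 < d) || (b - d < x0) by apply/orP; right; lra.
  have := hd x0 hx0 hor; lra.
have hp : 0 < p < b by lra.
have hq : 0 < q < b by rewrite /q; lra.
have zp : z x0 < z p.
  have hor : (p < d) || (b - d < p) by apply/orP; left; lra.
  have := hd p hp hor; lra.
have zq : z x0 < z q.
  have hor : (q < d) || (b - d < q) by apply/orP; right; rewrite /q; lra.
  have := hd q hq hor; lra.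
have sub x : p <= x <= q -> 0 < x < b by rewrite /q; lra.
have pq : p <= q by lra.
have cz : {within `[p, q], continuous z}.
  apply: derivable_within_continuous => x; rewrite in_itv /= => /sub hx.
  by have [] := dz x hx.
have [c] := EVT_min pq cz; rewrite in_itv /= => hc hmin.
have zc0 : z c <= z x0 by apply: hmin; rewrite in_itv /=; lra.
have hcb := sub c hc.
have hpc : p < c.
  by rewrite lt_neqAle; case/andP: hc => -> _; rewrite andbT; apply/eqP => E; move: zp; rewrite E; lra.
have hcq : c < q.
  by rewrite lt_neqAle; case/andP: hc => _ ->; rewrite andbT; apply/eqP => E; move: zq; rewrite -E; lra.
have z'c : z' c = 0.
  have : is_derive c 1 z 0.
    apply: (@derive1_at_min R z p q c) => //.
    - by move=> x; rewrite in_itv /= => hx; have [] := dz x (sub x _); [lra|].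
    - by rewrite in_itv /= hpc hcq.
    - by move=> x; rewrite in_itv /= => hx; apply: hmin; rewrite in_itv /=; lra.
  by move=> h; have [_ <-] := dz c hcb; have [_ ->] := h.
have Qc : Q c = 0 by rewrite QE // z'c mulr0.
have Q'c : Q' c < 0 by apply: Qneg => //; lra.
have [r r0 hr] : exists2 r, 0 < r & forall x, c < x < c + r -> Q x < 0.
  have [dQc EQc] := dQ c hcb.
  have /cvgr_lt : h^-1 *: (Q (h *: 1 + c) - Q c) @[h --> 0^'] --> Q' c.
    by rewrite -EQc; exact: dQc.
  move=> /(_ 0 Q'c); rewrite near_withinE => /nbhs_ballP[r /= r0 hr].
  exists r => // x hx; have := hr (x - c).
  rewrite /ball /= sub0r normrN gtr0_norm; last lra.
  rewrite ltrBlDr addrC => /(_ _ _)/wrap[]; [lra|by rewrite subr_eq0 gt_eqF //; lra|].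
  rewrite Qc subr0 scaler1 subrK /= pmulr_rlt0 // invr_gt0; lra.
pose y := c + Num.min r (q - c) / 2.
have [yr yq] : y < c + r /\ y < q.
  have h1 : Num.min r (q - c) <= r by rewrite ge_min lexx.
  have h2 : Num.min r (q - c) <= q - c by rewrite ge_min lexx orbT.
  have h3 : 0 < Num.min r (q - c) by rewrite lt_min; lra.
  by rewrite /y; split; lra.
have yc : c < y.
  have h3 : 0 < Num.min r (q - c) by rewrite lt_min; lra.
  by rewrite /y; lra.
have [xi hxi E] : exists2 xi, c < xi < y & z y - z c = z' xi * (y - c).
  by apply: MVT_cc => // x hx; apply: dz; apply: sub; lra.
have hxib : 0 < xi < b by apply: sub; lra.
have : z' xi < 0.
  have : Q xi < 0 by apply: hr; lra.
  by rewrite QE // pmulr_rlt0 // W0.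
have zy : z c <= z y by apply: hmin; rewrite in_itv /=; lra.
move=> h; have : z' xi * (y - c) < 0 by rewrite nmulr_rlt0 // subr_gt0.
by rewrite -E; lra.
Qed.

End max_principle.

(** * The profile equation and the equation satisfied by [g / sin] *)

Section profile.
Variables (R : realType) (m : nat) (k : R) (g : R -> R).
Let n := m.+2.
Hypothesis hg : gci_profile n k g.

(** [pfW] is the weight of the equation in divergence form, [pfq] the flux, and [pfq'] the value
    that the equation prescribes for the derivative of the flux. *)
Definition pfW x := sin x ^+ m * expR (k * cos x).
Definition pfq x := pfW x * derive1 g x.
Definition pfq' x := pfW x * (m%:R / sin x ^+ 2 * g x - sin x).

Let nE : (n%:R - 2 : R) = m%:R.
Proof. by rewrite /n -addn2 natrD; ring. Qed.

Let n2 : (n - 2)%N = m.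
Proof. by rewrite /n subSS subSS subn0. Qed.

Lemma profile_is_derive x : 0 < x < pi -> is_derive x 1 g (derive1 g x).
Proof.
move=> hx; have [_ /(_ x hx) [dg _ _]] := hg.
by apply: DeriveDef => //; rewrite derive1E.
Qed.

Lemma profile_is_derive_flux x : 0 < x < pi -> is_derive x 1 pfq (pfq' x).
Proof.
move=> hx; have [_ /(_ x hx) [_ dq E]] := hg.
have qE : (fun th => sin th ^+ (n - 2) * expR (k * cos th) * derive1 g th) = pfq.
  by apply/funext => y; rewrite n2.
rewrite qE in dq; apply: DeriveDef => //; rewrite -derive1E.
have s0 : 0 < sin x by apply: sin_gt0_pi.
move: E; rewrite qE n2 nE expRN => E.
have e0 := expR_gt0 (k * cos x).
rewrite /pfq' /pfW.
set D := derive1 pfq x; set e := expR _.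
have sm0 : sin x ^+ m != 0 by rewrite expf_neq0 // gt_eqF.
have en0 : e != 0 by rewrite gt_eqF.
have -> : m%:R / sin x ^+ 2 * g x - sin x = sin x ^- m / e * D.
  by move: E; rewrite -/e -/D; set A := _ * D; set B := _ * g x => <-; ring.
by field; rewrite sm0 en0.
Qed.

Definition pfH x := g x / sin x.
Definition pfH' x := (derive1 g x * sin x - g x * cos x) / sin x ^+ 2.
(** Flux of the quotient [pfH]: it equals [sin ^ n * exp (k cos) * pfH']. It is written through
    [pfq] because the flux of [g], and not [derive1 g], is what the hypotheses declare derivable. In
    its derivative [pfY'] the singular term [m / sin^2] of the original equation has cancelled. *)
Definition pfY x := sin x * pfq x - cos x * pfW x * g x.
Definition pfY' x := pfW x * sin x ^+ 2 * ((m%:R + 1 + k * cos x) * pfH x - 1).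

Let sgt0 (x : R) : 0 < x < pi -> 0 < sin x.
Proof. exact: sin_gt0_pi. Qed.

Lemma pfW_derive x : 0 < x < pi -> is_derive x 1 pfW ((m%:R * cos x / sin x - k * sin x) * pfW x).
Proof.
move=> hx; have s0 := sgt0 hx.
have h1 := is_dX m (is_derive_sin x).
have h2 := is_d_comp (is_dZ k (is_derive_cos x)) (is_derive_expR _).
apply: is_d_eq (is_dM h1 h2) _; rewrite /pfW.
case: m => [|m']; first by rewrite /= !expr0; ring.
by rewrite /= !exprS; field; rewrite gt_eqF.
Qed.

Lemma profile_quot_derive x : 0 < x < pi -> is_derive x 1 pfH (pfH' x).
Proof.
move=> hx; have s0 := sgt0 hx; have s0' : sin x != 0 by rewrite gt_eqF.
apply: is_d_eq (is_dM (profile_is_derive hx) (is_dV s0' (is_derive_sin x))) _.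
by rewrite /pfH'; field.
Qed.

Lemma profile_quot_flux_derive x : 0 < x < pi -> is_derive x 1 pfY (pfY' x).
Proof.
move=> hx; have s0 := sgt0 hx; have s0' : sin x != 0 by rewrite gt_eqF.
have h1 := is_dM (is_derive_sin x) (profile_is_derive_flux hx).
have h2 := is_dM (is_dM (is_derive_cos x) (pfW_derive hx)) (profile_is_derive hx).
apply: is_d_eq (is_dB h1 h2) _; rewrite /pfY' /pfq' /pfq /pfH.
have c2 : cos x ^+ 2 = 1 - sin x ^+ 2 by rewrite -(cos2Dsin2 x); ring.
have -> : sin x * (pfW x * (m%:R / sin x ^+ 2 * g x - sin x)) =
  pfW x * (m%:R / sin x * g x - sin x ^+ 2) by field.
rewrite (_ : _ - _ = pfW x * (m%:R / sin x * g x * (1 - cos x ^+ 2) - sin x ^+ 2 + sin x * g x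
  + k * sin x * cos x * g x)); last by field.
by rewrite c2; field.
Qed.

Lemma profile_quot_fluxE x : 0 < x < pi ->
  pfY x = sin x ^+ n * expR (k * cos x) * pfH' x.
Proof.
move=> hx; have s0 := sgt0 hx; have s0' : sin x != 0 by rewrite gt_eqF.
by rewrite /pfY /pfq /pfW /pfH' /n !exprS; field.
Qed.

(** Here [sin ^ n * pfH ^ 2 = sin ^ m * g ^ 2] is the square of [sin ^ (n / 2 - 1) * g], the
    function that [spaceV] places in H^1_0. *)
Lemma profile_quot_bound0 : exists2 B, 0 <= B & forall x, 0 < x < pi ->
  sin x ^+ n * pfH x ^+ 2 <= B * x /\ sin x ^+ n * pfH x ^+ 2 <= B * (pi - x).
Proof.
have [[_ hu] _] := hg.
pose u := fun th : R => sin th `^ (n%:R / 2 - 1) * g th.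
have cu y : 0 < y < pi -> {for y, continuous u}.
  move=> hy; have s0 := sgt0 hy.
  apply: cvgM; last first.
    by apply: (is_d_continuous (profile_is_derive hy)).
  apply: (@continuous_comp _ _ _ sin (fun s : R => s `^ (n%:R / 2 - 1))); first exact: continuous_sin.
  by apply: is_d_continuous (is_derive1_powR _ s0).
have [B B0 hB] := H10_bound hu cu.
exists B => // y hy; have s0 := sgt0 hy.
suff -> : sin y ^+ n * pfH y ^+ 2 = u y ^+ 2 by exact: hB.
have E : (n%:R / 2 - 1) * 2%:R = m%:R :> R by rewrite -nE; field.
have -> : u y ^+ 2 = sin y ^+ m * g y ^+ 2.
  by rewrite /u exprMn -(@powR_mulrn _ (_ `^ _)) ?powR_ge0 // -powRrM E powR_mulrn // ltW.
rewrite /pfH /n !exprS; field.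
by rewrite gt_eqF.
Qed.

End profile.

Section sin_linear.
Variable R : realType.

Lemma cos_le1_ge (x : R) : 0 <= x <= 1 -> cos 1 <= cos x.
Proof.
move=> /andP[x0]; rewrite le_eqVlt => /predU1P[->//|x1].
have [c hc E] := MVT_cc x1 (fun y _ => is_derive_cos y).
have p2 := pi_ge2 R.
have sc : 0 < sin c by apply: sin_gt0_pi; lra.
rewrite -subr_le0 E mulNr oppr_le0 mulr_ge0 //; lra.
Qed.

Lemma sin_ge_linear (x : R) : 0 < x <= 1 -> cos 1 * x <= sin x.
Proof.
move=> /andP[x0 x1]; have [c hc E] := MVT_cc x0 (fun y _ => is_derive_sin y).
move: E; rewrite sin0 !subr0 => ->; apply: ler_wpM2r; first exact: ltW.
by apply: cos_le1_ge; lra.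
Qed.

Lemma sin_le_linear (x : R) : 0 < x -> sin x <= x.
Proof.
move=> x0; have [c hc E] := MVT_cc x0 (fun y _ => is_derive_sin y).
move: E; rewrite sin0 !subr0 => ->; apply: ler_piMl; first exact: ltW.
exact: cos_le1.
Qed.

Lemma sin_pi_sub (x : R) : sin (pi - x) = sin x.
Proof. by rewrite sinB sinpi cospi; ring. Qed.

(** Stated for abstract [h] and [y] so as to serve at 0 and, through [x |-> pi - x], at [pi]. On
    [(0, 1]] one has [cos 1 * x <= sin x <= x], which converts the weight [sin ^ n] into powers of
    [x] at the cost of constants. *)
Lemma regular_end_sin (m : nat) (h h' y y' E : R -> R) (K A B : R) :
  0 <= A -> 0 <= B ->
  (forall x : R, 0 < x <= 1 -> is_derive x 1 h (h' x)) ->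
  (forall x : R, 0 < x <= 1 -> is_derive x 1 y (y' x)) ->
  (forall x : R, 0 < x <= 1 -> expR (- K) <= E x <= expR K) ->
  (forall x : R, 0 < x <= 1 -> y x = sin x ^+ m.+2 * E x * h' x) ->
  (forall x : R, 0 < x <= 1 -> `|y' x| <= sin x ^+ m.+2 * E x * (A * `|h x| + 1)) ->
  (forall x : R, 0 < x <= 1 -> sin x ^+ m.+2 * h x ^+ 2 <= B * x) ->
  exists M : R, forall x : R, 0 < x <= 1 -> `|h x| <= M /\ `|h' x| <= M * sin x.
Proof.
move=> A0 B0 dh dy hE yE y'E hB.
pose n := m.+2.
pose c := cos 1 ^+ n * expR (- K).
pose C := expR K * (A + 1).
have cos1 : 0 < cos 1 :> R := cos1_gt0 R.
have c0 : 0 < c by rewrite mulr_gt0 ?expR_gt0 // exprn_gt0.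
have slow (x : R) : 0 < x <= 1 -> cos 1 ^+ n * x ^+ n <= sin x ^+ n.
  move=> hx; have [x0 x1] := andP hx.
  have cx : 0 <= cos 1 * x by rewrite mulr_ge0 // ltW.
  rewrite -exprMn lerXn2r ?sin_ge_linear // nnegrE.
  exact: le_trans (sin_ge_linear hx).
have s0 (x : R) : 0 < x <= 1 -> 0 < sin x.
  move=> hx; have [x0 x1] := andP hx.
  by apply: lt_le_trans (sin_ge_linear hx); rewrite mulr_gt0.
have sup (x : R) : 0 < x <= 1 -> sin x ^+ n <= x ^+ n.
  move=> hx; have [x0 x1] := andP hx.
  by rewrite lerXn2r ?sin_le_linear // nnegrE; apply: ltW; rewrite ?s0.
have E0 (x : R) : 0 < x <= 1 -> 0 < E x.
  by move=> /hE /andP[h1 _]; apply: lt_le_trans h1; exact: expR_gt0.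
have Yabs (x : R) : 0 < x <= 1 -> `|y x| = sin x ^+ n * E x * `|h' x|.
  move=> hx; rewrite yE // normrM ger0_norm //.
  by rewrite mulr_ge0 // ?exprn_ge0 //; apply: ltW; [exact: s0|exact: E0].
have low (x : R) : 0 < x <= 1 -> c * x ^+ n <= sin x ^+ n * E x.
  move=> hx; have [x0 x1] := andP hx; rewrite /c mulrAC.
  apply: ler_pM; [|exact: expR_ge0|exact: slow|by case/andP: (hE x hx)].
  by rewrite mulr_ge0 // exprn_ge0 // ltW.
have high (x : R) : 0 < x <= 1 -> sin x ^+ n * E x <= x ^+ n * expR K.
  move=> hx; apply: ler_pM; [by rewrite exprn_ge0 // ltW // s0|by rewrite ltW // E0|exact: sup|].
  by case/andP: (hE x hx).
have [M hM] : exists M : R, forall x, 0 < x <= 1 -> `|h x| <= M /\ `|y x| <= M * x ^+ n.+1.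
  apply: (@regular_end R m h y h' y' 1 c C (B / cos 1 ^+ n)) => //.
  - move=> x hx; rewrite Yabs // ler_wpM2r //; exact: low.
  - move=> x hx; rewrite Yabs // ler_wpM2r // (le_trans (high x hx)) // mulrC /C.
    have [x0 x1] := andP hx.
    apply: ler_wpM2r; first by rewrite exprn_ge0 // ltW.
    by rewrite ler_peMr ?expR_ge0 // lerDr.
  - move=> x hx; have [x0 x1] := andP hx; apply: le_trans (y'E x hx) _.
    rewrite /C; apply: (@le_trans _ _ (x ^+ n * expR K * (A * `|h x| + 1))).
      by rewrite ler_wpM2r ?addr_ge0 ?mulr_ge0 // high.
    rewrite (_ : expR K * (A + 1) * _ * _ = x ^+ n * expR K * ((A + 1) * (`|h x| + 1))); last by ring.
    apply: ler_wpM2l; first by rewrite mulr_ge0 ?expR_ge0 // exprn_ge0 // ltW.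
    by have := normr_ge0 (h x); nra.
  - move=> x hx; have [x0 x1] := andP hx.
    have : cos 1 ^+ n * x ^+ n * h x ^+ 2 <= B * x.
      by apply: le_trans (hB x hx); rewrite ler_wpM2r ?sqr_ge0 // slow.
    rewrite /n (exprSr x) => hh.
    rewrite ler_pdivlMr ?exprn_gt0 // -(ler_pM2r x0).
    by apply: le_trans hh; rewrite le_eqVlt; apply/orP; left; apply/eqP; ring.
exists (Num.max M (M / c / cos 1)) => x hx; have [x0 x1] := andP hx.
have [h1 h2] := hM x hx; split; first by rewrite le_max h1.
have M0 : 0 <= M by apply: le_trans h1.
have h3 : `|h' x| <= M / c * x.
  rewrite mulrAC ler_pdivlMr // -(@ler_pM2r _ (x ^+ n)) ?exprn_gt0 //.
  apply: le_trans (le_trans h2 _).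
    by rewrite Yabs // -(mulrA _ c) [leLHS]mulrC ler_wpM2r // low.
  by rewrite exprS mulrA.
apply: le_trans h3 _; apply: (@le_trans _ _ (M / c / cos 1 * sin x)).
  rewrite -[leRHS]mulrA; apply: ler_wpM2l; first by rewrite divr_ge0 // ltW.
  by rewrite ler_pdivlMl // sin_ge_linear.
apply: ler_wpM2r; first by rewrite ltW // s0.
by rewrite le_max lexx orbT.
Qed.

End sin_linear.

Section profile_bounds.
Variables (R : realType) (m : nat) (k : R) (g : R -> R).
Hypothesis hg : gci_profile m.+2 k g.
Local Notation H := (pfH g).
Local Notation H' := (pfH' g).
Local Notation Y := (pfY m k g).
Local Notation Y' := (pfY' m k g).

(** The factor [sin x] in the bound on [pfH'] is what makes the derivative of [h_kappa] bounded in
    the variable [cos x]. The end pieces come from [regular_end_sin], the middle one from continuity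
    on a compact segment. *)
Lemma profile_bounds : exists2 M : R, 0 <= M & forall x : R, 0 < x < pi ->
  `|H x| <= M /\ `|H' x| <= M * sin x.
Proof.
have p2 := pi_ge2 R.
have [B B0 hB] := profile_quot_bound0 hg.
pose A := m%:R + 1 + `|k|.
have A0 : 0 <= A by rewrite /A !addr_ge0.
have hexp (x : R) : expR (- `|k|) <= expR (k * cos x) <= expR `|k|.
  rewrite !ler_expR -ler_norml normrM ler_piMr // ler_norml.
  by rewrite cos_geN1 cos_le1.
have hY' (x : R) : 0 < x < pi -> `|Y' x| <= sin x ^+ m.+2 * expR (k * cos x) * (A * `|H x| + 1).
  move=> hx; have s0 := sin_gt0_pi hx.
  have -> : Y' x = sin x ^+ m.+2 * expR (k * cos x) * ((m%:R + 1 + k * cos x) * H x - 1).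
    by rewrite /pfY' /pfW !exprS; ring.
  have P0 : 0 <= sin x ^+ m.+2 * expR (k * cos x) by rewrite mulr_ge0 ?expR_ge0 ?exprn_ge0 // ltW.
  rewrite normrM (ger0_norm P0) ler_wpM2l // (le_trans (ler_normB _ _)) // normr1 lerD2r.
  rewrite normrM ler_wpM2r // /A (le_trans (ler_normD _ _)) // lerD //.
    by rewrite ger0_norm // addr_ge0.
  by rewrite normrM ler_piMr // ler_norml cos_geN1 cos_le1.
have [M1 hM1] : exists M : R, forall x : R, 0 < x <= 1 -> `|H x| <= M /\ `|H' x| <= M * sin x.
  have sub (x : R) : 0 < x <= 1 -> 0 < x < pi by lra.
  apply: (@regular_end_sin _ m H H' Y Y' (fun x => expR (k * cos x)) `|k| A B A0 B0).
  - by move=> x /sub; exact: (profile_quot_derive hg).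
  - by move=> x /sub; exact: (profile_quot_flux_derive hg).
  - by move=> x _; exact: hexp.
  - by move=> x /sub; exact: profile_quot_fluxE.
  - by move=> x /sub; exact: hY'.
  - by move=> x /sub /hB [].
have [M2 hM2] : exists M : R, forall x : R, 0 < x <= 1 ->
    `|H (pi - x)| <= M /\ `|- H' (pi - x)| <= M * sin x.
  have sub (x : R) : 0 < x <= 1 -> 0 < pi - x < pi by lra.
  have drefl (x : R) : is_derive x 1 (fun y => pi - y) (-1).
    by apply: is_d_eq (is_dB (is_dcst pi x 1) (is_derive_id x 1)) _; rewrite sub0r.
  have sE (x : R) : sin (pi - x) = sin x by rewrite sin_pi_sub.
  apply: (@regular_end_sin _ m (fun x => H (pi - x)) (fun x => - H' (pi - x))
    (fun x => - Y (pi - x)) (fun x => Y' (pi - x)) (fun x => expR (k * cos (pi - x))) `|k| A B A0 B0).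
  - move=> x /sub hx; apply: is_d_eq (is_d_comp (drefl x) (profile_quot_derive hg hx)) _.
    by rewrite mulrN1.
  - move=> x /sub hx; apply: is_d_eq (is_dN (is_d_comp (drefl x) (profile_quot_flux_derive hg hx))) _.
    by rewrite mulrN1 opprK.
  - by move=> x _; exact: hexp.
  - by move=> x hx; rewrite profile_quot_fluxE ?sub // sE; ring.
  - by move=> x /sub hx; have := hY' _ hx; rewrite sE.
  - move=> x /sub hx; have [_] := hB _ hx; rewrite sE.
    by rewrite opprB addrCA subrr addr0.
have cH (x : R) : 1 <= x <= pi - 1 -> {for x, continuous H}.
  by move=> hx; apply: is_d_continuous (profile_quot_derive hg _); lra.
(* The displayed quotient is [pfH' / sin]; written through the flux, its continuity follows from
   derivability. *)
have cH' (x : R) : 1 <= x <= pi - 1 -> {for x, continuous (fun x => Y x / (sin x ^+ m.+3 * expR (k * cos x)))}.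
  move=> hx; have hx' : 0 < x < pi by lra.
  have s0 := sin_gt0_pi hx'.
  have n0 : sin x ^+ m.+3 * expR (k * cos x) != 0.
    by rewrite mulf_neq0 ?expf_neq0 ?gt_eqF // expR_gt0.
  have d1 := is_dM (is_dX m.+3 (is_derive_sin x))
    (is_d_comp (is_dZ k (is_derive_cos x)) (is_derive_expR _)).
  have h := is_dM (profile_quot_flux_derive hg hx') (is_dV (f := fun y => sin y ^+ m.+3 * expR (k * cos y)) n0 d1).
  exact: (is_d_continuous h).
have [M3 M30 hM3] := segment_bounded cH.
have [M4 M40 hM4] := segment_bounded cH'.
pose M := Num.max (Num.max M1 M2) (Num.max M3 M4).
have [le1 [le2 [le3 le4]]] : M1 <= M /\ M2 <= M /\ M3 <= M /\ M4 <= M.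
  by rewrite /M !le_max !lexx !orbT.
exists M => [|x hx]; first exact: le_trans le3.
have s0 := sin_gt0_pi hx.
have [x1|x1] := leP x 1.
  have hx' : 0 < x <= 1 by lra.
  have [h1 h2] := hM1 x hx'; split; first exact: le_trans le1.
  by apply: le_trans h2 _; rewrite ler_wpM2r // ltW.
have [x2|x2] := leP (pi - 1) x.
  have hx' : 0 < pi - x <= 1 by lra.
  have := hM2 _ hx'; rewrite subKr normrN sin_pi_sub => -[h1 h2]; split; first exact: le_trans le2.
  by apply: le_trans h2 _; rewrite ler_wpM2r // ltW.
have hx' : 1 <= x <= pi - 1 by lra.
split; first exact: le_trans (hM3 x hx') le3.
have := hM4 x hx'; rewrite profile_quot_fluxE //.
have e0 := expR_gt0 (k * cos x).
rewrite (_ : sin x ^+ _ * _ * _ / _ = H' x / sin x); last first.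
  by rewrite (exprS _ m.+2); field; rewrite !gt_eqF // exprn_gt0.
rewrite normrM normfV (gtr0_norm s0) ler_pdivrMr // => /le_trans; apply.
by rewrite ler_wpM2r // ltW.
Qed.

End profile_bounds.

(** * Comparison principle, lower bound and dependence on kappa *)

Section profile_comparison.
Variables (R : realType) (m : nat).

(* Comparison principle for [L z = - W^-1 (W z')' + m / sin^2 z], through its
   flux [Q = W z']. *)
Lemma profile_comparison (k : R) (z z' Q' : R -> R) (C : R) :
  (forall x : R, 0 < x < pi -> is_derive x 1 z (z' x)) ->
  (forall x : R, 0 < x < pi -> is_derive x 1 (fun y => pfW m k y * z' y) (Q' x)) ->
  (forall x : R, 0 < x < pi -> Q' x < pfW m k x * (m%:R / sin x ^+ 2 * z x)) ->
  (forall x : R, 0 < x < pi -> `|z x| <= C * sin x) ->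
  forall x : R, 0 < x < pi -> 0 <= z x.
Proof.
move=> dz dQ hQ zC.
have W0 (x : R) : 0 < x < pi -> 0 < pfW m k x.
  by move=> hx; rewrite /pfW mulr_gt0 ?expR_gt0 // exprn_gt0 // sin_gt0_pi.
apply: (max_principle (z' := z') (W := pfW m k) (Q := fun y => pfW m k y * z' y) (Q' := Q')).
- exact: W0.
- by [].
- move=> x hx z0; apply: lt_le_trans (hQ x hx) _.
  have := W0 x hx; have s0 := sin_gt0_pi hx => w0.
  rewrite pmulr_rle0 // mulr_ge0_le0 ?divr_ge0 ?sqr_ge0 //; exact: ltW.
- move=> e e0.
  have C0 : 0 <= `|C| + 1 by rewrite addr_ge0.
  have C1 : 0 < `|C| + 1 by rewrite ltr_wpDl.
  exists (e / (`|C| + 1)) => [|x hx hor]; first by rewrite divr_gt0.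
  have [x0 xpi] := andP hx.
  have sx : sin x <= e / (`|C| + 1).
    case/orP: hor => h.
      by apply: le_trans (sin_le_linear x0) _; exact: ltW.
    rewrite -sin_pi_sub; apply: le_trans (sin_le_linear _) _; lra.
  have s0 := sin_gt0_pi hx.
  have : `|z x| <= e.
    apply: le_trans (zC x hx) _; apply: (@le_trans _ _ ((`|C| + 1) * sin x)).
      apply: ler_wpM2r; first exact: ltW.
      by apply: le_trans (ler_norm C) _; rewrite lerDl.
    by rewrite mulrC -ler_pdivlMr.
  by rewrite ler_norml => /andP[].
Qed.

Variables (k : R) (g : R -> R).
Hypothesis hg : gci_profile m.+2 k g.

Lemma profile_le_sin : exists2 C, 0 <= C & forall x : R, 0 < x < pi -> `|g x| <= C * sin x.
Proof.
have [M M0 hM] := profile_bounds hg; exists M => // x hx.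
have s0 := sin_gt0_pi hx; have [h _] := hM x hx.
move: h; rewrite /pfH normrM normfV (gtr0_norm s0) ler_pdivrMr //.
Qed.

Lemma profile_derive_bound : exists2 C, 0 <= C & forall x : R, 0 < x < pi -> `|derive1 g x| <= C.
Proof.
have [M M0 hM] := profile_bounds hg; exists (M + M); first by rewrite addr_ge0.
move=> x hx; have s0 := sin_gt0_pi hx; have [h1 h2] := hM x hx.
have s1 := sin_le1 x.
have -> : derive1 g x = pfH g x * cos x + sin x * pfH' g x.
  by rewrite /pfH /pfH'; field; rewrite gt_eqF.
apply: le_trans (ler_normD _ _) _.
rewrite (normrM (pfH g x)) (normrM (sin x)) (gtr0_norm s0) lerD //.
  apply: le_trans h1; rewrite ler_piMr // ler_norml.
  by rewrite cos_geN1 cos_le1.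
apply: le_trans (ler_wpM2l (ltW s0) h2) _.
rewrite mulrCA ler_piMr // mulr_ile1 //; exact: ltW.
Qed.

(* [L (sin) = sin (m + 1 + k cos) <= (m + 2 + k) sin = L ((m + 2 + k) g)]. *)
Lemma profile_lower_bound (x : R) : 0 < k -> 0 < x < pi -> sin x <= (m%:R + 2 + k) * g x.
Proof.
move=> k0; move: x.
have [C C0 hC] := profile_le_sin.
pose A := m%:R + 2 + k.
have m0 : 0 <= m%:R :> R by [].
have A0 : 0 < A by rewrite /A; lra.
suff h : forall x : R, 0 < x < pi -> 0 <= A * g x - sin x.
  by move=> x /h; rewrite subr_ge0.
have dW (x : R) : 0 < x < pi ->
    is_derive x 1 (pfW m k) ((m%:R * cos x / sin x - k * sin x) * pfW m k x).
  exact: pfW_derive.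
apply: (@profile_comparison k _ (fun x => A * derive1 g x - cos x)
  (fun x => A * pfq' m k g x - ((m%:R * cos x / sin x - k * sin x) * pfW m k x * cos x
     + pfW m k x * - sin x)) (A * C + 1)).
- move=> x hx; exact: is_dB (is_dZ A (profile_is_derive hg hx)) (is_derive_sin x).
- move=> x hx.
  have h := is_dB (is_dZ A (profile_is_derive_flux hg hx)) (is_dM (dW x hx) (is_derive_cos x)).
  rewrite (_ : (fun y => _) = fun y => A * pfq m k g y - pfW m k y * cos y) //.
  by apply/funext => y; rewrite /pfq; ring.
- move=> x hx; have s0 := sin_gt0_pi hx.
  have w0 : 0 < pfW m k x by rewrite /pfW mulr_gt0 ?expR_gt0 // exprn_gt0.
  rewrite /pfq' -subr_gt0.
  have -> : pfW m k x * (m%:R / sin x ^+ 2 * (A * g x - sin x)) -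
    (A * (pfW m k x * (m%:R / sin x ^+ 2 * g x - sin x)) -
     ((m%:R * cos x / sin x - k * sin x) * pfW m k x * cos x + pfW m k x * - sin x)) =
    pfW m k x * (A * sin x - m%:R / sin x * (1 - cos x ^+ 2) - sin x * (1 + k * cos x)).
    by field; rewrite gt_eqF.
  have -> : 1 - cos x ^+ 2 = sin x ^+ 2 by rewrite -(cos2Dsin2 x); ring.
  have -> : A * sin x - m%:R / sin x * sin x ^+ 2 - sin x * (1 + k * cos x) =
     sin x * (1 + k * (1 - cos x)) by rewrite /A; field; rewrite gt_eqF.
  apply: mulr_gt0 => //; apply: mulr_gt0 => //.
  have := cos_le1 x => c1; have : 0 <= k * (1 - cos x) by rewrite mulr_ge0 ?subr_ge0 // ltW.
  lra.
- move=> x hx; have s0 := sin_gt0_pi hx.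
  apply: le_trans (ler_normB _ _) _; rewrite (mulrDl (A * C)) mul1r normrM (gtr0_norm A0) (gtr0_norm s0).
  by rewrite lerD2r -mulrA ler_wpM2l ?hC // ltW.
Qed.

(* [L_k (g_k - g_k0) = - (k - k0) sin g_k0'], so that [C |k - k0| g_k] dominates
   the difference as soon as [C > sup |g_k0'|]. *)
Lemma profile_continuity (k0 : R) (g0 : R -> R) (C : R) : gci_profile m.+2 k0 g0 -> k != k0 ->
  (forall x : R, 0 < x < pi -> `|derive1 g0 x| < C) ->
  forall x : R, 0 < x < pi -> `|g x - g0 x| <= C * `|k - k0| * g x.
Proof.
move=> hg0 kk0 hC.
have [D D0 hD] := profile_le_sin.
have [D' D'0 hD'] : exists2 C, 0 <= C & forall x : R, 0 < x < pi -> `|g0 x| <= C * sin x.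
  have [M M0 hM] := profile_bounds hg0; exists M => // x hx.
  have s0 := sin_gt0_pi hx; have [h _] := hM x hx.
  by move: h; rewrite /pfH normrM normfV (gtr0_norm s0) ler_pdivrMr.
have e0 : 0 < `|k - k0| by rewrite normr_gt0 subr_eq0.
set e := `|k - k0| in e0 *.
(* [s] is a sign; its two values give the two sides of the estimate. *)
have key (s : R) : `|s| = 1 -> forall x : R, 0 < x < pi -> 0 <= C * e * g x + s * (g x - g0 x).
  move=> s1.
  (* The weights for [k] and [k0] differ by a smooth factor, so the flux of [g0] with respect to [k]
     is derivable since its flux with respect to [k0] is. *)
  have WE (y : R) : pfW m k y = expR ((k - k0) * cos y) * pfW m k0 y.
    by rewrite /pfW mulrCA -expRD; congr (_ * expR _); ring.
  pose E (y : R) := expR ((k - k0) * cos y).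
  have dE (x : R) : is_derive x 1 E (E x * ((k - k0) * - sin x)).
    exact: is_d_comp (is_dZ (k - k0) (is_derive_cos x)) (is_derive_expR _).
  apply: (@profile_comparison k _ (fun x => C * e * derive1 g x + s * (derive1 g x - derive1 g0 x))
    (fun x => C * e * pfq' m k g x + s * (pfq' m k g x -
      (E x * ((k - k0) * - sin x) * pfq m k0 g0 x + E x * pfq' m k0 g0 x)))
    (C * e * D + (D + D'))).
  - move=> x hx; have d1 := profile_is_derive hg hx; have d2 := profile_is_derive hg0 hx.
    exact: is_dD (is_dZ (C * e) d1) (is_dZ s (is_dB d1 d2)).
  - move=> x hx; have d1 := profile_is_derive_flux hg hx; have d2 := profile_is_derive_flux hg0 hx.
    have h := is_dD (is_dZ (C * e) d1) (is_dZ s (is_dB d1 (is_dM (dE x) d2))).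
    rewrite (_ : (fun y => _) = fun y => C * e * pfq m k g y + s * (pfq m k g y - E y * pfq m k0 g0 y)) //.
    by apply/funext => y; rewrite /pfq WE /E; ring.
  - move=> x hx; have s0 := sin_gt0_pi hx.
    have w0 : 0 < pfW m k x by rewrite /pfW mulr_gt0 ?expR_gt0 // exprn_gt0.
    rewrite /pfq' /pfq -subr_gt0.
    set G := derive1 g0 x.
    have -> : pfW m k x * (m%:R / sin x ^+ 2 * (C * e * g x + s * (g x - g0 x))) -
      (C * e * (pfW m k x * (m%:R / sin x ^+ 2 * g x - sin x)) +
       s * (pfW m k x * (m%:R / sin x ^+ 2 * g x - sin x) -
        (E x * ((k - k0) * - sin x) * (pfW m k0 x * G) +
         E x * (pfW m k0 x * (m%:R / sin x ^+ 2 * g0 x - sin x))))) =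
      pfW m k x * sin x * (C * e - s * (k - k0) * G).
      by rewrite (WE x) -/(E x); field; rewrite gt_eqF.
    apply: mulr_gt0; first exact: mulr_gt0.
    rewrite subr_gt0 (le_lt_trans (ler_norm _)) // !normrM s1 mul1r -/e.
    by rewrite mulrC ltr_pM2r // hC.
  - move=> x hx; have s0 := sin_gt0_pi hx.
    apply: le_trans (ler_normD _ _) _; rewrite mulrDl lerD //.
      rewrite normrM -mulrA; have C0 : 0 <= C by apply: le_trans (ltW (hC x hx)).
      by rewrite ger0_norm ?mulr_ge0 // ?ler_wpM2l ?hD // ?mulr_ge0 // ltW.
    rewrite normrM s1 mul1r mulrDl (le_trans (ler_normB _ _)) // lerD // ?hD ?hD' //.
move=> x hx; rewrite ler_norml; apply/andP; split.
  by have := key 1 (normr1 _) x hx; lra.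
have : `|(-1 : R)| = 1 by rewrite normrN1.
by move=> /key /(_ x hx); lra.
Qed.

End profile_comparison.

(** * The profile in the variable [s = cos theta] *)

Section profile_h.
Variables (R : realType) (m : nat).
Implicit Types (k s : R) (g : R -> R).

Definition prof_h1 g s : R := - (pfH' g (acos s) / sin (acos s)).

(** The second derivative of [h_of g], solved from the equation in [s]. In this form it involves
    only [h_of g] and [prof_h1 g], so it is continuous inside [(-1, 1)] as soon as these are
    derivable. *)
Definition prof_h2 k g s : R :=
  ((m%:R + 1 + k * s) * h_of g s - 1 + (m%:R + 3) * s * prof_h1 g s
   - k * (1 - s ^+ 2) * prof_h1 g s) / (1 - s ^+ 2).

Lemma acos_itv s : -1 < s < 1 -> 0 < acos s < pi.
Proof. by move=> hs; rewrite acos_gt0 ?acos_ltpi //; lra. Qed.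

Lemma sin_acos_sqr s : -1 <= s <= 1 -> sin (acos s) ^+ 2 = 1 - s ^+ 2.
Proof. by move=> hs; rewrite -{2}(acosK hs) -(cos2Dsin2 (acos s)); ring. Qed.

Lemma is_d_acos s : -1 < s < 1 -> is_derive s 1 (@acos R) (- (sin (acos s))^-1).
Proof. by move=> hs; rewrite sin_acos; [exact: is_derive1_acos|lra]. Qed.

Lemma h_ofE g s : h_of g s = pfH g (acos s).
Proof. by []. Qed.

(** Division by [sin (acos s) = 0] returns 0, although for [0 < k] the profile stays above a
    positive constant inside the interval. *)
Lemma h_of_pole g s : `|s| = 1 -> h_of g s = 0.
Proof.
move=> hs; have h1 : -1 <= s <= 1 by rewrite -ler_norml hs.
have s2 : s ^+ 2 = 1 by rewrite -[s ^+ 2]real_normK ?num_real // hs expr1n.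
have : sin (acos s) ^+ 2 = 0 by rewrite sin_acos_sqr // s2 subrr.
by move/eqP; rewrite sqrf_eq0 /h_of => /eqP ->; rewrite invr0 mulr0.
Qed.

Variables (k : R) (g : R -> R).
Hypothesis hg : gci_profile m.+2 k g.

Lemma h_of_derive s : -1 < s < 1 -> is_derive s 1 (h_of g) (prof_h1 g s).
Proof.
move=> hs; have ha := acos_itv hs.
apply: is_d_eq (is_d_comp (is_d_acos hs) (profile_quot_derive hg ha)) _.
by rewrite /prof_h1 mulrN.
Qed.

Lemma prof_h1_derive s : -1 < s < 1 -> is_derive s 1 (prof_h1 g) (prof_h2 k g s).
Proof.
move=> hs; have ha := acos_itv hs; have s0 := sin_gt0_pi ha.
have hs1 : -1 <= s <= 1 by lra.
have e0 := expR_gt0 (k * cos (acos s)).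
set x := acos s in ha s0 e0 *.
have n0 : sin x ^+ m.+3 * expR (k * cos x) != 0.
  by rewrite mulf_neq0 ?expf_neq0 ?gt_eqF.
have d1 := is_dM (is_dX m.+3 (is_derive_sin x))
    (is_d_comp (is_dZ k (is_derive_cos x)) (is_derive_expR _)).
have d2 := is_dM (profile_quot_flux_derive hg ha)
  (is_dV (f := fun y => sin y ^+ m.+3 * expR (k * cos y)) n0 d1).
have d3 := is_dN (is_d_comp (is_d_acos hs) d2).
(* Near [s] the function [prof_h1] is rewritten through the flux [pfY], whose derivative is
   known. *)
have E : \forall y \near s, prof_h1 g y =
    - (pfY m k g (acos y) / (sin (acos y) ^+ m.+3 * expR (k * cos (acos y)))).
  have : \forall y \near s, y \in `]-1, 1[ by apply: near_in_itvoo; rewrite in_itv.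
  apply: filterS => y; rewrite in_itv /= => hy.
  have ha' := acos_itv hy; have s0' := sin_gt0_pi ha'.
  have e0' := expR_gt0 (k * cos (acos y)).
  rewrite profile_quot_fluxE // /prof_h1 (exprS _ m.+2); congr (- _); field.
  by rewrite !gt_eqF // exprn_gt0.
have E' : \forall y \near s, - (pfY m k g (acos y) / (sin (acos y) ^+ m.+3 * expR (k * cos (acos y))))
    = prof_h1 g y by apply: filterS E => y ->.
apply: is_d_eq (near_eq_is_derive E' d3) _.
rewrite -/x profile_quot_fluxE // /prof_h2 /prof_h1 h_ofE -/x.
have c2 : 1 - s ^+ 2 = sin x ^+ 2 by rewrite -sin_acos_sqr.
have cs : cos x = s by rewrite /x acosK.
rewrite c2 /pfY' /pfW cs /=.
have sm0 : sin x ^+ m != 0 by rewrite expf_neq0 // gt_eqF.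
have m3 : m.+3%:R = m%:R + 3 :> R by rewrite -addn3 natrD.
rewrite m3 !exprS; rewrite cs in e0.
by field; rewrite sm0 !gt_eqF.
Qed.

Lemma prof_h_ode s : -1 < s < 1 ->
  (1 - s ^+ 2) * prof_h2 k g s - (m%:R + 3) * s * prof_h1 g s - (m%:R + 1) * h_of g s
  + k * ((1 - s ^+ 2) * prof_h1 g s - s * h_of g s) = -1.
Proof.
move=> hs; have n0 : 1 - s ^+ 2 != 0 by rewrite gt_eqF //; nra.
by rewrite /prof_h2; field.
Qed.

Lemma prof_h_bounds : exists2 M : R, 0 <= M & forall s : R,
  (-1 <= s <= 1 -> `|h_of g s| <= M) /\ (-1 < s < 1 -> `|prof_h1 g s| <= M).
Proof.
have [M M0 hM] := profile_bounds hg; exists M => // s; split.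
  move=> hs; have [hs1|hs1] := eqVneq `|s| 1; first by rewrite h_of_pole // normr0.
  have hs2 : -1 < s < 1 by rewrite -ltr_norml lt_neqAle hs1 ler_norml.
  by have [] := hM _ (acos_itv hs2).
move=> hs; have ha := acos_itv hs; have s0 := sin_gt0_pi ha.
have [_] := hM _ ha; rewrite /prof_h1 normrN (normrM (pfH' g _)) normfV (gtr0_norm s0).
by rewrite ler_pdivrMr.
Qed.

Lemma h_of_ge s : 0 < k -> -1 < s < 1 -> (m%:R + 2 + k)^-1 <= h_of g s.
Proof.
move=> k0 hs; have ha := acos_itv hs; have s0 := sin_gt0_pi ha.
have m0 : 0 <= m%:R :> R by [].
have A0 : 0 < m%:R + 2 + k by lra.
have := profile_lower_bound hg k0 ha.
by rewrite /h_of ler_pdivlMr // -ler_pdivrMl // mulrC.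
Qed.

End profile_h.

(** [profile_continuity] bounds the difference by [C * |k - k0| * h_of (g k)], with the unknown
    function on the right. As long as [C * |k - k0| <= 1/2], nonnegativity of [h_of (g k)] lets this
    term be absorbed, so that [h_of (g k) <= 2 * M] and a Lipschitz bound at [k0] results, uniform
    in [s]. *)
Lemma h_of_continuity (R : realType) (m : nat) (g : R -> R -> R) (k0 : R) :
  (forall k, 0 < k -> gci_profile m.+2 k (g k)) -> 0 < k0 ->
  exists2 C : R, 0 <= C & exists2 d : R, 0 < d & forall k s : R, `|k - k0| < d ->
    -1 <= s <= 1 -> `|h_of (g k) s - h_of (g k0) s| <= C * `|k - k0|.
Proof.
move=> hg k00; have hg0 := hg _ k00.
have [C1 C10 hC1] := profile_derive_bound hg0.
have [M M0 hM] := prof_h_bounds hg0.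
pose C := C1 + 1.
have C0 : 0 < C by rewrite /C ltr_wpDl.
exists (2 * C * M); first by rewrite !mulr_ge0 // ltW.
exists (Num.min k0 (2 * C)^-1) => [|k s].
  by rewrite lt_min k00 invr_gt0 mulr_gt0.
rewrite lt_min => /andP[kk0 kC] hs.
have [->|nk] := eqVneq k k0; first by rewrite !subrr normr0 mulr0.
have kpos : 0 < k by move: kk0; rewrite ltr_distl => /andP[h _]; lra.
have [hs1|hs1] := eqVneq `|s| 1.
  by rewrite !h_of_pole // subrr normr0 !mulr_ge0 // ltW.
have hs2 : -1 < s < 1 by rewrite -ltr_norml lt_neqAle hs1 ler_norml.
have ha := acos_itv hs2; have s0 := sin_gt0_pi ha.
have hC : forall x : R, 0 < x < pi -> `|derive1 (g k0) x| < C.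
  by move=> x /hC1 h; rewrite (le_lt_trans h) // ltrDl.
have := profile_continuity (hg _ kpos) hg0 nk hC ha.
set e := `|k - k0| in kk0 kC *.
have e0 : 0 <= e by exact: normr_ge0.
move=> h; have {}h : `|h_of (g k) s - h_of (g k0) s| <= C * e * h_of (g k) s.
  rewrite /h_of -mulrBl normrM normfV (gtr0_norm s0) mulrA.
  by apply: ler_wpM2r h; rewrite invr_ge0 ltW.
have [hM0 _] := hM s; have {hM0} := hM0 hs; rewrite ler_norml => /andP[_ hM0].
have Ce : C * e <= 2^-1.
  by move: kC; rewrite invfM -ltr_pdivrMr ?invr_gt0 // invrK mulrC => /ltW.
have hpos : 0 <= h_of (g k) s.
  have m0 : 0 <= m%:R :> R by [].
  by apply: le_trans (h_of_ge (hg _ kpos) kpos hs2); rewrite invr_ge0; lra.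
have h2 : h_of (g k) s <= 2 * M.
  move: h; rewrite ler_norml => /andP[_ h].
  have := ler_wpM2r hpos Ce; lra.
apply: le_trans h _.
have : C * e * h_of (g k) s <= C * e * (2 * M).
  by rewrite ler_wpM2l // mulr_ge0 // ltW.
by move=> /le_trans; apply; rewrite le_eqVlt; apply/orP; left; apply/eqP; ring.
Qed.
(** * Calculus on the sphere *)

Section sphere_calculus.
Variables (R : realType) (n : nat).
Implicit Types (F G : 'rV[R]_n -> R) (U V : 'rV[R]_n -> 'rV[R]_n) (u v w a : 'rV[R]_n).
Local Notation unitv := (@Defs.unitv R n).

Lemma rV_sum_ei u : u = \sum_i u 0 i *: ei R i.
Proof.
apply/rowP => j; rewrite summxE (bigD1 j) //= big1 => [|i ij].
  by rewrite !mxE !eqxx mulr1 addr0.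
by rewrite !mxE eqxx /= eq_sym (negbTE ij) mulr0.
Qed.

Lemma is_d_coord u v i : is_derive u v (fun x : 'rV[R]_n => x 0 i) (v 0 i).
Proof.
have [h1 h2] := is_derive_id u v.
apply: DeriveDef; first by move/derivable_mxP: h1 => /(_ 0 i).
by have := derive_mx h1; rewrite h2 => /rowP /(_ i); rewrite mxE.
Qed.

Lemma is_d_dotp2 u v : is_derive u v (fun x : 'rV[R]_n => dotp x x) (2 * dotp u v).
Proof.
apply: is_d_eq (is_d_sum (fun i => is_dM (is_d_coord u v i) (is_d_coord u v i))) _.
by rewrite /dotp mulr_sumr; apply: eq_bigr => i _; ring.
Qed.

Lemma is_d_enorm u v : u != 0 -> is_derive u v (@enorm R n) (dotp u v / enorm u).
Proof.
move=> u0; have h0 : 0 < dotp u u by rewrite dotp_gt0.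
apply: is_d_eq (is_d_comp (is_d_dotp2 u v) (is_derive1_sqrt h0)) _.
have e0 : 0 < Num.sqrt (dotp u u) by rewrite sqrtr_gt0.
by rewrite /enorm; field; rewrite gt_eqF.
Qed.

Lemma is_d_unitv_coord u v i : sphere u ->
  is_derive u v (fun x => unitv x 0 i) (Pperp u v 0 i).
Proof.
move=> Su; have u0 := sphere_neq0 Su; have e0 : enorm u != 0 by rewrite enorm_eq0.
have h := is_dM (is_dV e0 (is_d_enorm v u0)) (is_d_coord u v i).
rewrite (_ : (fun x => _) = fun x : 'rV[R]_n => (enorm x)^-1 * x 0 i); last first.
  by apply/funext => x; rewrite /Defs.unitv mxE.
by apply: is_d_eq h _; rewrite !mxE (Su : enorm u = 1); field.
Qed.

Lemma differentiable_dotp2 u : differentiable (fun x : 'rV[R]_n => dotp x x) u.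
Proof.
rewrite (_ : (fun _ => _) = \sum_(i < n) ((fun x : 'rV[R]_n => x 0 i) * (fun x : 'rV[R]_n => x 0 i))).
  by apply: differentiable_sum => i; apply: differentiableM; exact: differentiable_coord.
by apply/funext => x; rewrite fct_sumE.
Qed.

Lemma differentiable_enorm u : u != 0 -> differentiable (@enorm R n) u.
Proof.
move=> u0; apply: (@differentiable_comp _ _ _ _ (fun x : 'rV[R]_n => dotp x x) (@Num.sqrt R)).
  exact: differentiable_dotp2.
apply/derivable1_diffP; have h0 : 0 < dotp u u by rewrite dotp_gt0.
by have [] := is_derive1_sqrt h0.
Qed.

Lemma differentiable_rV (X : normedModType R) (f : X -> 'rV[R]_n) (x : X) :
  (forall i, differentiable (fun y => f y 0 i) x) -> differentiable f x.
Proof.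
move=> h; rewrite (_ : f = \sum_(i < n) (fun y => f y 0 i *: ei R i)).
  by apply: differentiable_sum => i; exact: differentiableZl.
by apply/funext => y; rewrite fct_sumE; exact: rV_sum_ei.
Qed.

Lemma differentiable_unitv u : u != 0 -> differentiable unitv u.
Proof.
move=> u0; apply: differentiable_rV => i.
rewrite (_ : (fun x => _) = (fun x : 'rV[R]_n => (enorm x)^-1) * (fun x : 'rV[R]_n => x 0 i)); last first.
  by apply/funext => x; rewrite /Defs.unitv mxE.
apply: differentiableM; last exact: differentiable_coord.
by apply: differentiableV; [exact: differentiable_enorm|rewrite enorm_eq0].
Qed.

Lemma diff_unitv u v : sphere u -> 'd unitv u v = Pperp u v.
Proof.
move=> Su; have h := differentiable_unitv (sphere_neq0 Su).
rewrite -deriveE //.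
have d1 : derivable unitv u v by exact: diff_derivable.
by rewrite derive_mx //; apply/rowP => i; rewrite mxE; have [_ ->] := is_d_unitv_coord v i Su.
Qed.

Lemma continuous_unitv u : u != 0 -> {for u, continuous unitv}.
Proof. by move=> /differentiable_unitv; exact: differentiable_continuous. Qed.

Lemma near_neq0 u : u != 0 -> \forall v \near u, v != 0.
Proof.
move=> u0; have : {for u, continuous (@enorm R n)} by exact: continuous_enorm.
move/cvgr_gt => /(_ 0); rewrite enorm_gt0 => /(_ u0).
by apply: filterS => v; rewrite enorm_gt0.
Qed.

(** Regularity on the sphere is always that of [F \o unitv] at points of the sphere, so that all
    these notions, like [sph_grad], depend only on the values of [F] on the sphere. *)
Definition scont F := forall w, sphere w -> F (unitv u) @[u --> w] --> F w.
Definition sdiff F := forall w, sphere w -> differentiable (F \o unitv) w.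
Definition sC1 F := sdiff F /\ forall i, scont (fun w => sph_grad F w 0 i).
Definition sC2 F := sdiff F /\ forall i, sC1 (fun w => sph_grad F w 0 i).

Lemma unitvK u : unitv (unitv u) = unitv u.
Proof.
have [->|u0] := eqVneq u 0; first by rewrite /Defs.unitv !scaler0.
by rewrite (unitvE (sphere_unitv u0)).
Qed.

Lemma unitv_ext F G : (forall w, sphere w -> F w = G w) -> forall u, u != 0 ->
  \forall v \near u, F (unitv v) = G (unitv v).
Proof. by move=> FG u /near_neq0; apply: filterS => v v0; exact/FG/sphere_unitv. Qed.

Lemma scont_ext F G : (forall w, sphere w -> F w = G w) -> scont F -> scont G.
Proof.
move=> FG cF w Sw; have := cF w Sw; rewrite (FG _ Sw).
apply: cvg_trans; apply: (@near_eq_cvg _ _ (nbhs w) _).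
by apply: unitv_ext (sphere_neq0 Sw) => v Sv; rewrite FG.
Qed.

Lemma sph_grad_ext F G : (forall w, sphere w -> F w = G w) ->
  forall w, sphere w -> sph_grad F w = sph_grad G w.
Proof.
move=> FG w Sw; apply/rowP => i; rewrite !mxE; apply: near_eq_derive.
exact: unitv_ext (sphere_neq0 Sw).
Qed.

(** Goes through the first-order expansion at [x], which sees only the germ of the function, and the
    uniqueness of the differential. *)
Lemma near_eq_differentiable (X Y : normedModType R) (f g : X -> Y) (x : X) :
  (\forall y \near x, f y = g y) -> differentiable f x -> differentiable g x.
Proof.
move=> fg df; have fgx : f x = g x := nbhs_singleton fg.
have [cd E] := (diff_locallyP _ _).1 df.
have E' : g \o shift x = cst (g x) + 'd f x +o_ (0 : X) id.
  apply/eqaddoP => e e0; have /eqaddoP /(_ e e0) := E.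
  have : \forall h \near (0 : X), f (h + x) = g (h + x).
    have c : {for (0 : X), continuous (fun h : X => h + x)}.
      by apply: cvgD; [exact: cvg_id|exact: cvg_cst].
    have fg' : nbhs ((fun h : X => h + x) 0) (fun y => f y = g y) by rewrite add0r.
    exact: (c _ fg').
  by apply: filterS2 => h; rewrite !fctE /= fgx => ->.
by apply/diff_locallyP; rewrite (diff_unique cd E').
Qed.

Lemma sdiff_ext F G : (forall w, sphere w -> F w = G w) -> sdiff F -> sdiff G.
Proof.
move=> FG dF w Sw; apply: near_eq_differentiable (dF w Sw).
exact: unitv_ext (sphere_neq0 Sw).
Qed.

(** By idempotence of [unitv], continuity of [F \o unitv] spreads from the sphere to all nonzero
    vectors, which gives measurability; the bound comes from compactness of the sphere. *)
Lemma scont_bmeas F : scont F -> bmeas F.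
Proof.
move=> cF.
have cont u : u != 0 -> {for u, continuous (F \o unitv)}.
  move=> u0; have -> : F \o unitv = (F \o unitv) \o unitv by apply/funext => v /=; rewrite unitvK.
  apply: continuous_comp; first exact: continuous_unitv.
  by rewrite /prop_for /continuous_at /= unitvK; apply: cF; exact: sphere_unitv.
apply: (@bmeas_ext _ _ (F \o unitv)) => [w Sw /=|]; first by rewrite unitvE.
split; first exact: measurable_continuous_at.
have cw : {within @sphere R n, continuous (F \o unitv)}.
  apply: continuous_in_subspaceT => u; rewrite inE => Su; apply: cont; exact: sphere_neq0.
have [M [_ hM]] : bounded_set ((F \o unitv) @` @sphere R n).
  by apply: compact_bounded; apply: continuous_compact => //; exact: compact_sphere.
exists (M + 1) => w Sw; apply: hM; first by rewrite ltrDl.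
by exists w.
Qed.

Lemma sdiff_scont F : sdiff F -> scont F.
Proof.
move=> dF w Sw; have := differentiable_continuous (dF w Sw).
by rewrite /prop_for /continuous_at /= (unitvE Sw).
Qed.

Lemma sC1_scont F : sC1 F -> scont F.
Proof. by case=> /sdiff_scont. Qed.

Lemma sC1_ext F G : (forall w, sphere w -> F w = G w) -> sC1 F -> sC1 G.
Proof.
move=> FG [dF cF]; split; first exact: sdiff_ext dF.
by move=> i; apply: scont_ext (cF i) => w Sw; rewrite (sph_grad_ext FG).
Qed.

Lemma scont_cst c : scont (fun=> c).
Proof. by move=> w _; exact: (@cvg_cst _ _ _ (nbhs w) _). Qed.

Lemma scontD F G : scont F -> scont G -> scont (fun w => F w + G w).
Proof. by move=> hF hG w Sw; apply: (@cvgD _ _ _ (nbhs w) _); [exact: (hF w Sw)|exact: (hG w Sw)]. Qed.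

Lemma scontM F G : scont F -> scont G -> scont (fun w => F w * G w).
Proof. by move=> hF hG w Sw; apply: (@cvgM _ _ (nbhs w) _); [exact: (hF w Sw)|exact: (hG w Sw)]. Qed.

Lemma scontN F : scont F -> scont (fun w => - F w).
Proof. by move=> hF w Sw; apply: (@cvgN _ _ _ (nbhs w) _); exact: (hF w Sw). Qed.

Lemma scont_sum (J : finType) (F : J -> 'rV[R]_n -> R) :
  (forall j, scont (F j)) -> scont (fun w => \sum_j F j w).
Proof. by move=> hF w Sw; apply: (cvg_sumr (F := nbhs w)) => j; exact: (hF j w Sw). Qed.

Lemma scont_coord i : scont (fun w => w 0 i).
Proof.
move=> w Sw; rewrite -[in X in _ --> X](unitvE Sw).
apply: (@continuous_comp _ _ _ unitv (fun x : 'rV[R]_n => x 0 i)).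
  exact: continuous_unitv (sphere_neq0 Sw).
exact: coord_continuous.
Qed.

Lemma sdiff_cst c : sdiff (fun=> c).
Proof. by move=> w _; exact: differentiable_cst. Qed.

Lemma sdiffD F G : sdiff F -> sdiff G -> sdiff (fun w => F w + G w).
Proof. by move=> hF hG w Sw; apply: differentiableD; [exact: hF|exact: hG]. Qed.

Lemma sdiffM F G : sdiff F -> sdiff G -> sdiff (fun w => F w * G w).
Proof. by move=> hF hG w Sw; apply: differentiableM; [exact: hF|exact: hG]. Qed.

Lemma sdiffN F : sdiff F -> sdiff (fun w => - F w).
Proof. by move=> hF w Sw; apply: differentiableN; exact: hF. Qed.

Lemma sdiff_coord i : sdiff (fun w => w 0 i).
Proof.
move=> w Sw; apply: (@differentiable_comp _ _ _ _ unitv (fun x : 'rV[R]_n => x 0 i)).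
  exact: differentiable_unitv (sphere_neq0 Sw).
exact: differentiable_coord.
Qed.

Lemma sdiff_comp F (phi : R -> R) : sdiff F ->
  (forall w, sphere w -> derivable phi (F w) 1) -> sdiff (fun w => phi (F w)).
Proof.
move=> dF dphi w Sw; apply: (@differentiable_comp _ _ _ _ (F \o unitv) phi); first exact: dF.
by apply/derivable1_diffP; rewrite /= (unitvE Sw); exact: dphi.
Qed.

Lemma sph_gradE F w i : sph_grad F w 0 i = 'D_(ei R i) (F \o unitv) w.
Proof. by rewrite mxE. Qed.

Lemma is_d_sdiff F w v : sdiff F -> sphere w ->
  is_derive w v (F \o unitv) (dotp v (sph_grad F w)).
Proof.
move=> dF Sw; have d := dF w Sw; apply: DeriveDef; first exact: diff_derivable.
rewrite deriveE // [in LHS](rV_sum_ei v) linear_sum /dotp; apply: eq_bigr => i _.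
by rewrite linearZ sph_gradE deriveE.
Qed.

Lemma sph_grad_val F w g : sdiff F -> sphere w ->
  (forall v, is_derive w v (F \o unitv) (dotp v g)) -> sph_grad F w = g.
Proof.
move=> dF Sw h; apply/rowP => i; rewrite sph_gradE; have [_ ->] := h (ei R i).
by rewrite dotpC dotp_ei.
Qed.

(** [F \o unitv] is constant along rays: composing it once more with [unitv] changes nothing, and
    the differential of [unitv] at [w] kills [w]. *)
Lemma sph_grad_tangent F w : sdiff F -> sphere w -> dotp w (sph_grad F w) = 0.
Proof.
move=> dF Sw; have d := dF w Sw; have [_ <-] := is_d_sdiff w dF Sw.
have E : F \o unitv = (F \o unitv) \o unitv by apply/funext => v /=; rewrite unitvK.
have du := differentiable_unitv (sphere_neq0 Sw).
rewrite deriveE // E diff_comp //=; last by rewrite (unitvE Sw).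
rewrite diff_unitv // /Pperp (sphereE w).1 // scale1r subrr linear0 //.
Qed.

Lemma sph_grad_cst c w : sphere w -> sph_grad (fun=> c) w = 0.
Proof.
move=> Sw; apply: sph_grad_val => // [|v]; first exact: sdiff_cst.
by rewrite dotp0r; exact: is_dcst.
Qed.

Lemma sph_gradD F G w : sdiff F -> sdiff G -> sphere w ->
  sph_grad (fun w => F w + G w) w = sph_grad F w + sph_grad G w.
Proof.
move=> dF dG Sw; apply: sph_grad_val => // [|v]; first exact: sdiffD.
by rewrite dotpDr; apply: is_dD; exact: is_d_sdiff.
Qed.

Lemma sph_gradN F w : sdiff F -> sphere w ->
  sph_grad (fun w => - F w) w = - sph_grad F w.
Proof.
move=> dF Sw; apply: sph_grad_val => // [|v]; first exact: sdiffN.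
by rewrite dotpNr; apply: is_dN; exact: is_d_sdiff.
Qed.

Lemma sph_gradM F G w : sdiff F -> sdiff G -> sphere w ->
  sph_grad (fun w => F w * G w) w = G w *: sph_grad F w + F w *: sph_grad G w.
Proof.
move=> dF dG Sw; apply: sph_grad_val => // [|v]; first exact: sdiffM.
have := is_dM (is_d_sdiff v dF Sw) (is_d_sdiff v dG Sw); rewrite /= (unitvE Sw) => h.
by apply: is_d_eq h _; rewrite dotpDr !dotpZr; ring.
Qed.

Lemma sph_grad_comp F (phi : R -> R) (d : R) w : sdiff F -> sdiff (fun w => phi (F w)) ->
  sphere w -> is_derive (F w) 1 phi d ->
  sph_grad (fun w => phi (F w)) w = d *: sph_grad F w.
Proof.
move=> dF dphi Sw hd; apply: sph_grad_val => // v.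
rewrite dotpZr; apply: (@is_d_comp _ _ (F \o unitv) phi); first exact: is_d_sdiff.
by rewrite /= (unitvE Sw).
Qed.

Lemma sph_grad_dotp a w : sphere w -> sph_grad (fun w => dotp w a) w = Pperp w a.
Proof.
move=> Sw; apply/rowP => i; rewrite sph_gradE.
have h : is_derive w (ei R i) (fun u => \sum_j unitv u 0 j * a 0 j)
    (\sum_j (Pperp w (ei R i) 0 j * a 0 j + unitv w 0 j * 0)).
  by apply: is_d_sum => j; exact: (is_dM (is_d_unitv_coord (ei R i) j Sw) (is_dcst _ _ _)).
have [_ E] := h; rewrite (_ : (fun w => dotp w a) \o unitv = fun u => \sum_j unitv u 0 j * a 0 j) // E.
transitivity (dotp (Pperp w (ei R i)) a).
  by apply: eq_bigr => j _; rewrite mulr0 addr0.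
rewrite /Pperp dotpBl dotpZl dotpC !dotp_ei !mxE mulrC; congr (_ - _ * _); exact: dotpC.
Qed.

Lemma sph_grad_coord i w : sphere w -> sph_grad (fun w => w 0 i) w = Pperp w (ei R i).
Proof.
by move=> Sw; rewrite -sph_grad_dotp //; apply: sph_grad_ext => // v _; rewrite dotp_ei.
Qed.

Lemma sdiff_dotp a : sdiff (fun w => dotp w a).
Proof.
apply: (@sdiff_ext (fun w => \sum_j w 0 j * a 0 j)) => // w Sw.
rewrite (_ : _ \o _ = \sum_(j < n) ((fun u => unitv u 0 j) * cst (a 0 j))); last first.
  by apply/funext => u; rewrite fct_sumE.
apply: differentiable_sum => j; apply: differentiableM => //; first exact: sdiff_coord.
Qed.

Lemma sph_divE V w : (forall i, sdiff (fun w => V w 0 i)) -> sphere w ->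
  sph_div V w = \sum_i sph_grad (fun w => V w 0 i) w 0 i.
Proof. by move=> dV Sw; apply: eq_bigr => i _; rewrite sph_gradE. Qed.

Lemma sph_div_ext U V : (forall w, sphere w -> U w = V w) ->
  forall w, sphere w -> sph_div U w = sph_div V w.
Proof.
move=> UV w Sw; apply: eq_bigr => i _; apply: near_eq_derive.
by apply: (@unitv_ext (fun w => U w 0 i) (fun w => V w 0 i)) (sphere_neq0 Sw) => v /UV ->.
Qed.

Lemma sph_divZ F V w : sdiff F -> (forall i, sdiff (fun w => V w 0 i)) -> sphere w ->
  sph_div (fun w => F w *: V w) w = F w * sph_div V w + dotp (sph_grad F w) (V w).
Proof.
move=> dF dV Sw.
have E i : (fun w => (F w *: V w) 0 i) = (fun w => F w * V w 0 i).
  by apply/funext => u; rewrite mxE.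
rewrite !sph_divE // => [|i]; last by rewrite E; exact: sdiffM.
rewrite mulr_sumr -big_split /=; apply: eq_bigr => i _.
by rewrite E sph_gradM // !mxE addrC [X in _ + X]mulrC.
Qed.

Lemma sph_divD U V w : (forall i, sdiff (fun w => U w 0 i)) ->
  (forall i, sdiff (fun w => V w 0 i)) -> sphere w ->
  sph_div (fun w => U w + V w) w = sph_div U w + sph_div V w.
Proof.
move=> dU dV Sw.
have E i : (fun w => (U w + V w) 0 i) = (fun w => U w 0 i + V w 0 i).
  by apply/funext => u; rewrite mxE.
rewrite !sph_divE // => [|i]; last by rewrite E; exact: sdiffD.
by rewrite -big_split /=; apply: eq_bigr => i _; rewrite E sph_gradD // mxE.
Qed.

Lemma sph_divN V w : (forall i, sdiff (fun w => V w 0 i)) -> sphere w ->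
  sph_div (fun w => - V w) w = - sph_div V w.
Proof.
move=> dV Sw.
have E i : (fun w => (- V w) 0 i) = (fun w => - V w 0 i).
  by apply/funext => u; rewrite mxE.
rewrite !sph_divE // => [|i]; last by rewrite E; exact: sdiffN.
by rewrite -sumrN; apply: eq_bigr => i _; rewrite E sph_gradN // mxE.
Qed.

Lemma sdiff_Pperp a i : sdiff (fun w => Pperp w a 0 i).
Proof.
rewrite (_ : (fun w => _) = fun w => a 0 i + - (dotp w a * w 0 i)); last first.
  by apply/funext => w; rewrite !mxE.
apply: sdiffD; first exact: sdiff_cst.
by apply: sdiffN; apply: sdiffM; [exact: sdiff_dotp|exact: sdiff_coord].
Qed.

(** [Pperp w a] is the spherical gradient of [w.a], a spherical harmonic of degree one; the factor
    is its Laplace-Beltrami eigenvalue. *)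
Lemma sph_div_Pperp a w : sphere w ->
  sph_div (fun w => Pperp w a) w = - (n%:R - 1) * dotp w a.
Proof.
move=> Sw.
have d i : sdiff (fun w => (dotp w a *: w) 0 i).
  rewrite (_ : (fun w => _) = fun w => dotp w a * w 0 i).
    by apply: sdiffM; [exact: sdiff_dotp|exact: sdiff_coord].
  by apply/funext => u; rewrite mxE.
have dc i : sdiff (fun _ : 'rV[R]_n => a 0 i) by exact: sdiff_cst.
have dn i : sdiff (fun w => (- (dotp w a *: w)) 0 i).
  rewrite (_ : (fun w => _) = fun w => - (dotp w a *: w) 0 i); first exact: sdiffN.
  by apply/funext => u; rewrite mxE.
rewrite (@sph_divD (fun=> a) (fun w => - (dotp w a *: w))) // sph_divN // sph_divZ //; last 2 first.
- exact: sdiff_dotp.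
- exact: sdiff_coord.
have S1 := (sphereE w).1 Sw.
have -> : sph_div (fun=> a) w = 0.
  by rewrite sph_divE // big1 // => i _; rewrite sph_grad_cst // mxE.
have -> : sph_div id w = n%:R - 1.
  rewrite sph_divE; [|exact: sdiff_coord|by []].
  transitivity (\sum_(i < n) (1 - w 0 i * w 0 i)).
    by apply: eq_bigr => i _; rewrite sph_grad_coord // !mxE !eqxx dotp_ei.
  by rewrite sumrB sumr_const card_ord -S1.
rewrite sph_grad_dotp // /Pperp dotpBl dotpZl S1 (dotpC a w); ring.
Qed.

End sphere_calculus.

(** * Rotations of coordinate planes and the divergence theorem *)

Section rotations.
Variables (R : realType) (n : nat).
Implicit Types (u v w : 'rV[R]_n) (a b : 'I_n).

Lemma mul_row_delta w a b : w *m delta_mx a b = w 0 a *: ei R b.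
Proof.
apply/rowP => j; rewrite !mxE (bigD1 a) //= big1 => [|i ia].
  by rewrite !mxE !eqxx /= addr0.
by rewrite !mxE (negbTE ia) mulr0.
Qed.

Definition rotm a b (h : R) : 'M[R]_n :=
  1%:M + (cos h - 1) *: (delta_mx a a + delta_mx b b) + sin h *: (delta_mx a b - delta_mx b a).

Lemma rotm_orthogonal a b h : a != b -> rotm a b h *m (rotm a b h)^T = 1%:M.
Proof.
move=> ab; have ba : b != a by rewrite eq_sym.
(* [P] projects on the plane [(a, b)] and [S] is the quarter turn in it. The relations [PP = P],
   [PS = SP = S], [SS = -P] reduce the product to [cos^2 + sin^2 = 1]. *)
pose P : 'M[R]_n := delta_mx a a + delta_mx b b.
pose S : 'M[R]_n := delta_mx a b - delta_mx b a.
have dd := @mul_delta_mx_cond R n n n.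
have PP : P *m P = P.
  by rewrite /P !mulmxDl !mulmxDr !dd !eqxx (negbTE ab) (negbTE ba) !mulr0n addr0 add0r.
have PS : P *m S = S.
  by rewrite /P /S mulmxDl !mulmxBr !dd !eqxx (negbTE ab) (negbTE ba) !mulr0n subr0 sub0r.
have SP : S *m P = S.
  by rewrite /P /S mulmxBl !mulmxDr !dd !eqxx (negbTE ab) (negbTE ba) !mulr0n addr0 add0r.
have SS : S *m S = - P.
  by rewrite /P /S mulmxBl !mulmxBr !dd !eqxx (negbTE ab) (negbTE ba) !mulr0n subr0 sub0r opprD.
have T : (rotm a b h)^T = 1%:M + (cos h - 1) *: P - sin h *: S.
  apply/matrixP => i j; rewrite /P /S !mxE (eq_sym j i) ![(j == _) && _]andbC; ring.
rewrite T /rotm -/P -/S.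
have cs : cos h ^+ 2 + sin h ^+ 2 = 1 := cos2Dsin2 h.
move: (cos h) (sin h) cs => c s cs; clear T.
move: P S PP PS SP SS => P S PP PS SP SS.
rewrite !(mulmxDl, mulmxDr, mulmxBr, mulmxN, mul1mx, mulmx1).
rewrite -!scalemxAl -!scalemxAr PP PS SP SS.
apply/matrixP => i j; rewrite !mxE.
set p := P i j; set q := S i j; set d := (i == j)%:R.
rewrite [LHS](_ : _ = d + (c ^+ 2 + s ^+ 2 - 1) * p); first by rewrite cs subrr mul0r addr0.
ring.
Qed.

Lemma mul_rotm w a b h : w *m rotm a b h =
  w + (cos h - 1) *: (w 0 a *: ei R a + w 0 b *: ei R b)
    + sin h *: (w 0 a *: ei R b - w 0 b *: ei R a).
Proof.
by rewrite /rotm !mulmxDr -!scalemxAr mulmx1 mulmxDr mulmxBr !mul_row_delta.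
Qed.

(** Infinitesimal generator: the velocity at [h = 0] of [w *m rotm a b h]. *)
Definition rotgen a b w : 'rV[R]_n := w 0 a *: ei R b - w 0 b *: ei R a.

Lemma is_d_rotm w a b (h : R) i : a != b ->
  is_derive h 1 (fun x => (w *m rotm a b x) 0 i) (rotgen a b (w *m rotm a b h) 0 i).
Proof.
move=> ab; have ba : b != a by rewrite eq_sym.
rewrite (_ : (fun x => _) = fun x => w 0 i + (cos x - 1) * (w 0 a *: ei R a + w 0 b *: ei R b) 0 i
    + sin x * (w 0 a *: ei R b - w 0 b *: ei R a) 0 i); last first.
  by apply/funext => x; rewrite mul_rotm !mxE.
pose A := (w 0 a *: ei R a + w 0 b *: ei R b) 0 i.
pose B := (w 0 a *: ei R b - w 0 b *: ei R a) 0 i.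
have d1 := is_dM (is_dB (is_derive_cos h) (is_dcst 1 h 1)) (is_dcst A h 1).
have d2 := is_dM (is_derive_sin h) (is_dcst B h 1).
apply: is_d_eq (is_dD (is_dD (is_dcst (w 0 i) h 1) d1) d2) _.
rewrite /A /B /rotgen mul_rotm !mxE !eqxx (negbTE ab) (negbTE ba) /=.
by ring.
Qed.

Lemma differentiable_rotm w a b (h : R) : a != b -> differentiable (fun x : R => w *m rotm a b x) h.
Proof.
move=> ab; apply: differentiable_rV => i.
by apply/derivable1_diffP; have [] := is_d_rotm w h i ab.
Qed.

Lemma is_d_sphere_rotm (F : 'rV[R]_n -> R) w a b (h : R) : sdiff F -> sphere w -> a != b ->
  is_derive h 1 (fun x => F (w *m rotm a b x))
    (dotp (rotgen a b (w *m rotm a b h)) (sph_grad F (w *m rotm a b h))).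
Proof.
move=> dF Sw ab; set c := fun x : R => w *m rotm a b x.
have Sc x : sphere (c x) by apply/sphere_orthogonal => //; exact: rotm_orthogonal.
have E : (fun x => F (c x)) = (F \o @unitv R n) \o c.
  by apply/funext => x /=; rewrite unitvE.
have dc := differentiable_rotm w h ab.
have dFc : differentiable (F \o @unitv R n) (c h) by apply: dF.
rewrite E; apply: DeriveDef.
  by apply: diff_derivable; exact: differentiable_comp.
rewrite deriveE; last exact: differentiable_comp.
rewrite diff_comp //= -deriveE //; have [_ <-] := is_d_sdiff (rotgen a b (c h)) dF (Sc h).
congr (derive _ _ _).
have d1 : derivable c h 1 by exact: diff_derivable.
rewrite -deriveE // derive_mx //; apply/rowP => i; rewrite mxE.
by have [_ ->] := is_d_rotm w h i ab.
Qed.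

End rotations.

Section sphere_divergence.
Variables (R : realType) (n : nat) (sigma : probability (borel_rV R n) R).
Hypothesis hsigma : uniform_sphere sigma.
Implicit Types (F G : 'rV[R]_n -> R) (U V : 'rV[R]_n -> 'rV[R]_n) (u v w : 'rV[R]_n).
Local Notation E := (smean sigma).

Lemma bmeas_grad F i : sC1 F -> bmeas (fun w => sph_grad F w 0 i).
Proof. by case=> _ cF; apply: scont_bmeas. Qed.

Lemma sdiff_bmeas F : sdiff F -> bmeas F.
Proof. by move=> dF; apply: scont_bmeas; exact: sdiff_scont. Qed.

(** The mean of [F (w *m rotm a b h)] does not depend on [h], by invariance of [sigma]; its
    derivative at [h = 0], taken under the mean, is the left-hand side. For [a = b] the generator is
    0. *)
Lemma smean_rotgen F a b : sC1 F -> E (fun w => dotp (rotgen a b w) (sph_grad F w)) = 0.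
Proof.
move=> hF; have [dF cF] := hF.
have brot i : bmeas (fun w => rotgen a b w 0 i).
  apply: (@bmeas_ext _ _ (fun w => w 0 a * (ei R b) 0 i - w 0 b * (ei R a) 0 i)).
    by move=> w _; rewrite !mxE.
  by apply: bmeasB; apply: bmeasM; [exact: bmeas_coord|exact: bmeas_cst
    |exact: bmeas_coord|exact: bmeas_cst].
have [ab|ab] := eqVneq a b.
  rewrite -[RHS](smean_cst hsigma 0); apply: eq_smean => w _.
  by rewrite /rotgen ab subrr dotp0l.
have bX : bmeas (fun w => dotp (rotgen a b w) (sph_grad F w)).
  by apply: bmeas_dotp => // i; exact: bmeas_grad.
have [_ [M hM]] := bX.
have O h : rotm a b h *m (rotm a b h)^T = 1%:M :> 'M[R]_n by exact: rotm_orthogonal.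
have w0E w : w *m rotm a b 0 = w.
  by rewrite mul_rotm cos0 sin0 subrr !scale0r !addr0.
have Srot h w : sphere w -> sphere (w *m rotm a b h) by move=> Sw; apply/sphere_orthogonal.
have := @is_derive_smean R n sigma hsigma (fun h w => F (w *m rotm a b h))
  (fun w => dotp (rotgen a b w) (sph_grad F w)) 0 1 M ltr01.
move=> /(_ _ _ _)/wrap[].
- move=> h _; apply: bmeas_rot => //; exact: sdiff_bmeas.
- move=> h w _ Sw; have [d1 d2] := is_d_sphere_rotm h dF Sw ab.
  by split=> //; rewrite d2; apply: hM; exact: Srot.
- by move=> w Sw; have [_ ->] := is_d_sphere_rotm 0 dF Sw ab; rewrite w0E.
rewrite (_ : (fun h => smean _ _) = fun=> E F); last first.
  by apply/funext => h; apply: smean_rot => //; exact: sdiff_bmeas.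
by move=> h; apply: is_d_val h (is_dcst _ _ _).
Qed.

(* For a tangent field [V], [\sum_(a, b) X_ab (w_a V_b) = div V], where
   [X_ab = w_a d_b - w_b d_a] generates the rotations of the plane [(a, b)]. *)
Lemma smean_sph_div V : (forall i, sC1 (fun w => V w 0 i)) ->
  (forall w, sphere w -> dotp w (V w) = 0) -> E (sph_div V) = 0.
Proof.
move=> hV tV; have dV i : sdiff (fun w => V w 0 i) by case: (hV i).
pose F a b w := w 0 a * V w 0 b.
have scoord a : sC1 (fun w : 'rV[R]_n => w 0 a).
  split; first exact: sdiff_coord.
  move=> i; apply: (@scont_ext _ _ (fun w => (ei R a) 0 i - w 0 a * w 0 i)).
    by move=> w Sw; rewrite sph_grad_coord // !mxE dotp_ei.
  apply: scontD; first exact: scont_cst.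
  by apply: scontN; apply: scontM; exact: scont_coord.
have gF a b w : sphere w -> sph_grad (F a b) w =
    V w 0 b *: Pperp w (ei R a) + w 0 a *: sph_grad (fun w => V w 0 b) w.
  by move=> Sw; rewrite /F sph_gradM // ?sph_grad_coord //; exact: sdiff_coord.
have hF a b : sC1 (F a b).
  split; first by apply: sdiffM => //; exact: sdiff_coord.
  move=> i; apply: (@scont_ext _ _ (fun w => V w 0 b * sph_grad (fun w => w 0 a) w 0 i
     + w 0 a * sph_grad (fun w => V w 0 b) w 0 i)).
    move=> w Sw; rewrite gF // (sph_grad_coord a Sw).
    by move: (Pperp w _) (sph_grad _ w) => p q; rewrite !mxE.
  apply: scontD; apply: scontM.
  - exact: sdiff_scont.
  - by case: (scoord a).
  - exact: scont_coord.
  - by case: (hV b).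
have bX a b : bmeas (fun w => dotp (rotgen a b w) (sph_grad (F a b) w)).
  apply: bmeas_dotp => i; last exact: bmeas_grad.
  apply: (@bmeas_ext _ _ (fun w => w 0 a * (ei R b) 0 i - w 0 b * (ei R a) 0 i)).
    by move=> w _; rewrite !mxE.
  by apply: bmeasB; apply: bmeasM; [exact: bmeas_coord|exact: bmeas_cst
    |exact: bmeas_coord|exact: bmeas_cst].
rewrite (@eq_smean _ _ _ _ (fun w => \sum_a \sum_b dotp (rotgen a b w) (sph_grad (F a b) w))).
  rewrite smean_sum //; last by move=> a; apply: bmeas_sum => b.
  by rewrite big1 // => a _; rewrite smean_sum // big1 // => b _; exact: smean_rotgen.
move=> w Sw; rewrite sph_divE //.
pose g b := sph_grad (fun w => V w 0 b) w.
have S1 : \sum_a w 0 a * w 0 a = 1 by exact: (sphereE w).1.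
have tw : \sum_b w 0 b * V w 0 b = 0 by exact: tV.
have tg b : \sum_a w 0 a * g b 0 a = 0 by exact: sph_grad_tangent.
have X a b : dotp (rotgen a b w) (sph_grad (F a b) w) =
    (w 0 a * (a == b)%:R * V w 0 b + (w 0 a * w 0 a) * g b 0 b) -
    (w 0 b * V w 0 b + w 0 b * (w 0 a * g b 0 a)).
  rewrite /rotgen dotpBl !dotpZl ![dotp (ei R _) _]dotpC !dotp_ei gF // -/(g b).
  move: (g b) => gb; rewrite /Pperp !mxE !eqxx /= !dotp_ei (eq_sym b a); ring.
(* By [|w| = 1] and tangency of the gradients, the sum over [a] leaves the divergence term and
   multiples of [w_b V_b]; the latter sum to 0 over [b] because [V] is tangent. *)
have Y b : \sum_a dotp (rotgen a b w) (sph_grad (F a b) w) =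
    w 0 b * V w 0 b + g b 0 b - n%:R * (w 0 b * V w 0 b).
  rewrite (eq_bigr _ (fun a _ => X a b)) sumrB big_split /= big_split /=.
  have -> : \sum_(a < n) w 0 a * w 0 a * g b 0 b = g b 0 b by rewrite -mulr_suml S1 mul1r.
  have -> : \sum_(a < n) w 0 b * (w 0 a * g b 0 a) = 0 by rewrite -mulr_sumr tg mulr0.
  rewrite addr0 sumr_const card_ord -[_ *+ n]mulr_natl; congr (_ + _ - _).
  rewrite (bigD1 b) //= eqxx mulr1 big1 ?addr0 // => a ab.
  by rewrite (negbTE ab) mulr0 mul0r.
rewrite exchange_big /= (eq_bigr _ (fun b _ => Y b)) sumrB big_split /= -mulr_sumr tw.
by rewrite mulr0 subr0 add0r.
Qed.

End sphere_divergence.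

(** * Generalized collision invariants *)

Section gci_identity.
Variables (R : realType) (n : nat) (sigma : probability (borel_rV R n) R).
Hypothesis hsigma : uniform_sphere sigma.
Implicit Types (F G p psi : 'rV[R]_n -> R) (u v w a : 'rV[R]_n).
Local Notation E := (smean sigma).

Lemma sC1M F G : sC1 F -> sC1 G -> sC1 (fun w => F w * G w).
Proof.
move=> [dF cF] [dG cG]; split; first exact: sdiffM.
move=> i; apply: (@scont_ext _ _ (fun w => G w * sph_grad F w 0 i + F w * sph_grad G w 0 i)).
  by move=> w Sw; rewrite sph_gradM //; move: (sph_grad F w) (sph_grad G w) => g1 g2; rewrite !mxE.
by apply: scontD; apply: scontM => //; exact: sdiff_scont.
Qed.

Lemma sC1D F G : sC1 F -> sC1 G -> sC1 (fun w => F w + G w).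
Proof.
move=> [dF cF] [dG cG]; split; first exact: sdiffD.
move=> i; apply: (@scont_ext _ _ (fun w => sph_grad F w 0 i + sph_grad G w 0 i)).
  by move=> w Sw; rewrite sph_gradD //; move: (sph_grad F w) (sph_grad G w) => g1 g2; rewrite !mxE.
exact: scontD.
Qed.

Lemma sC1_cst c : sC1 (fun _ : 'rV[R]_n => c).
Proof.
split; first exact: sdiff_cst.
by move=> i; apply: (@scont_ext _ _ (fun=> 0)); [move=> w Sw; rewrite sph_grad_cst // mxE|exact: scont_cst].
Qed.

Lemma scont_Pperp a i : scont (fun w => Pperp w a 0 i).
Proof. by apply: sdiff_scont; exact: sdiff_Pperp. Qed.

Lemma sC1_dotp a : sC1 (fun w => dotp w a).
Proof.
split; first exact: sdiff_dotp.
move=> i; apply: (@scont_ext _ _ (fun w => Pperp w a 0 i)); last exact: scont_Pperp.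
by move=> w Sw; rewrite sph_grad_dotp.
Qed.

Lemma sC1_coord i : sC1 (fun w : 'rV[R]_n => w 0 i).
Proof. by apply: sC1_ext (sC1_dotp (ei R i)) => w Sw; rewrite dotp_ei. Qed.

Lemma sC1_Pperp a i : sC1 (fun w => Pperp w a 0 i).
Proof.
apply: (@sC1_ext _ _ (fun w => a 0 i + (-1) * (dotp w a * w 0 i))).
  by move=> w _; rewrite !mxE mulN1r.
apply: sC1D; first exact: sC1_cst.
apply: sC1M; first exact: sC1_cst.
by apply: sC1M; [exact: sC1_dotp|exact: sC1_coord].
Qed.

Lemma sC2_sC1 F : sC2 F -> sC1 F.
Proof. by move=> [dF h]; split=> // i; apply: sC1_scont; exact: h. Qed.

Lemma Pperp_tangent w a : sphere w -> dotp w (Pperp w a) = 0.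
Proof. by move=> /sphereE Sw; rewrite dotpBr dotpZr Sw mulr1 subrr. Qed.

Lemma bmeas_sph_div (V : 'rV[R]_n -> 'rV[R]_n) :
  (forall i, sC1 (fun w => V w 0 i)) -> bmeas (sph_div V).
Proof.
move=> hV; apply: (@bmeas_ext _ _ (fun w => \sum_i sph_grad (fun w => V w 0 i) w 0 i)).
  by move=> w Sw; rewrite sph_divE // => i; case: (hV i).
by apply: bmeas_sum => i; apply: bmeas_grad (hV i).
Qed.

Lemma bmeas_lap p : sC2 p -> bmeas (sph_laplacian p).
Proof. by case=> _ gp; apply: bmeas_sph_div gp. Qed.

Lemma sC1_scale_Pperp p a i : sC1 p -> sC1 (fun w => (p w *: Pperp w a) 0 i).
Proof.
move=> hp; rewrite (_ : (fun w => _) = fun w => p w * Pperp w a 0 i).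
  exact: (sC1M hp (sC1_Pperp a i)).
by apply/funext => u; rewrite mxE.
Qed.

Lemma bmeas_drift p a : sC1 p -> bmeas (sph_div (fun u => p u *: Pperp u a)).
Proof. by move=> hp; apply: bmeas_sph_div => i; apply: sC1_scale_Pperp. Qed.

Lemma smean_mul_lap psi p : sC1 psi -> sC2 p ->
  E (fun w => psi w * sph_laplacian p w) = - E (fun w => dotp (sph_grad psi w) (sph_grad p w)).
Proof.
move=> hpsi hp; have [dp gp] := hp; have [dpsi cpsi] := hpsi.
have dgp i : sdiff (fun w => sph_grad p w 0 i) by case: (gp i).
have VE i : (fun w => (psi w *: sph_grad p w) 0 i) = (fun w => psi w * sph_grad p w 0 i).
  by apply/funext => w; move: (sph_grad p w) => q; rewrite mxE.
have b1 : bmeas (fun w => dotp (sph_grad psi w) (sph_grad p w)).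
  by apply: bmeas_dotp => i; [exact: (bmeas_grad i hpsi)|exact: (bmeas_grad i (sC2_sC1 hp))].
have b2 : bmeas (fun w => psi w * sph_laplacian p w).
  by apply: bmeasM; [exact: sdiff_bmeas|exact: bmeas_lap].
apply/eqP; rewrite -subr_eq0 opprK -smeanD //; apply/eqP.
rewrite -[RHS](@smean_sph_div _ _ _ hsigma (fun w => psi w *: sph_grad p w)).
- by apply: eq_smean => w Sw; rewrite sph_divZ.
- by move=> i; rewrite VE; exact: sC1M.
- by move=> w Sw; rewrite dotpZr sph_grad_tangent // mulr0.
Qed.

Lemma smean_mul_drift psi p a : sC1 psi -> sC1 p ->
  E (fun w => psi w * sph_div (fun u => p u *: Pperp u a) w) =
  - E (fun w => p w * dotp (sph_grad psi w) a).
Proof.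
move=> hpsi hp; have [dp cp] := hp; have [dpsi cpsi] := hpsi.
have dP i : sdiff (fun w => Pperp w a 0 i) by exact: sdiff_Pperp.
have VE i : (fun w => (p w *: Pperp w a) 0 i) = (fun w => p w * Pperp w a 0 i).
  by apply/funext => w; rewrite mxE.
have dV i : sC1 (fun w => (p w *: Pperp w a) 0 i).
  exact: sC1_scale_Pperp.
have VE2 i : (fun w => (psi w *: (p w *: Pperp w a)) 0 i) = (fun w => psi w * (p w *: Pperp w a) 0 i).
  by apply/funext => w; rewrite mxE.
have b1 : bmeas (fun w => p w * dotp (sph_grad psi w) a).
  apply: bmeasM; first exact: sdiff_bmeas.
  by apply: bmeas_dotp => i; [exact: bmeas_grad|exact: bmeas_cst].
have b2 : bmeas (fun w => psi w * sph_div (fun u => p u *: Pperp u a) w).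
  by apply: bmeasM; [exact: sdiff_bmeas|exact: bmeas_drift].
apply/eqP; rewrite -subr_eq0 opprK -smeanD //; apply/eqP.
rewrite -[RHS](@smean_sph_div _ _ _ hsigma (fun w => psi w *: (p w *: Pperp w a))).
- apply: eq_smean => w Sw; rewrite (@sph_divZ _ _ psi (fun w => p w *: Pperp w a)) //.
    congr (_ + _); rewrite dotpZr; congr (_ * _).
    by rewrite /Pperp dotpBr dotpZr (dotpC _ w) sph_grad_tangent // mulr0 subr0.
  by move=> i; case: (dV i).
- by move=> i; rewrite VE2; exact: (sC1M hpsi (dV i)).
- by move=> w Sw; rewrite !dotpZr Pperp_tangent // !mulr0.
Qed.

Lemma sC1_zonal (Om : 'rV[R]_n) (phi phi1 : R -> R) : sphere Om ->
  (forall s : R, -1 <= s <= 1 -> is_derive s 1 phi (phi1 s)) ->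
  (forall s : R, -1 <= s <= 1 -> {for s, continuous phi1}) ->
  sC1 (fun w => phi (dotp w Om)) /\
  forall w, sphere w -> sph_grad (fun w => phi (dotp w Om)) w = phi1 (dotp w Om) *: Pperp w Om.
Proof.
move=> SOm dphi cphi.
have d : sdiff (fun w => phi (dotp w Om)).
  apply: (@sdiff_comp _ _ (fun w => dotp w Om)); first exact: sdiff_dotp.
  by move=> w Sw; have [] := dphi _ (dotp_itv Sw SOm).
have g w : sphere w -> sph_grad (fun w => phi (dotp w Om)) w = phi1 (dotp w Om) *: Pperp w Om.
  move=> Sw; rewrite -sph_grad_dotp //.
  apply: (@sph_grad_comp _ _ (fun w => dotp w Om)) => //; first exact: sdiff_dotp.
  by apply: dphi; exact: dotp_itv.
split=> //; split=> // i.
apply: (@scont_ext _ _ (fun w => phi1 (dotp w Om) * Pperp w Om 0 i)).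
  by move=> w Sw; rewrite (g w Sw); move: (Pperp w Om) => q; rewrite mxE.
apply: scontM; last exact: scont_Pperp.
move=> w Sw; have c := cphi _ (dotp_itv Sw SOm).
apply: (@cvg_comp _ _ _ (fun u => dotp (unitv u) Om) phi1 (nbhs w) (nbhs (dotp w Om))) => //.
exact: (sdiff_scont (sdiff_dotp Om) Sw).
Qed.

(** For [psi w = phi (w.Om) * (w.a)] with [a] orthogonal to [Om], the adjoint operator
    [lap psi + k Om.grad psi] equals [w.a] times this expression at [s = w.Om]. *)
Definition gci_op (k : R) (phi phi1 phi2 : R -> R) (s : R) : R :=
  (1 - s ^+ 2) * phi2 s - (n%:R + 1) * s * phi1 s - (n%:R - 1) * phi s
  + k * ((1 - s ^+ 2) * phi1 s - s * phi s).

(** Green's formula, twice for the Laplacian and once for the drift, moves all derivatives from [p]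
    to the test function. This uses [phi] of class C^2 up to the poles, closed interval included. *)
Lemma gci_smooth (Om a : 'rV[R]_n) (phi phi1 phi2 : R -> R) p (k t : R) :
  sphere Om -> dotp Om a = 0 -> sC2 p ->
  (forall s : R, -1 <= s <= 1 -> is_derive s 1 phi (phi1 s)) ->
  (forall s : R, -1 <= s <= 1 -> is_derive s 1 phi1 (phi2 s)) ->
  (forall s : R, -1 <= s <= 1 -> {for s, continuous phi2}) ->
  E (fun w => phi (dotp w Om) * dotp w a *
       (- (k * t) * sph_div (fun u => p u *: Pperp u Om) w + t * sph_laplacian p w)) =
  t * E (fun w => p w * (dotp w a * gci_op k phi phi1 phi2 (dotp w Om))).
Proof.
move=> SOm Oma hp dphi dphi1 cphi2.
have cphi1 s : -1 <= s <= 1 -> {for s, continuous phi1}.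
  by move=> /dphi1; exact: is_d_continuous.
have [c0 g0] := sC1_zonal SOm dphi cphi1.
have [c1 g1] := sC1_zonal SOm dphi1 cphi2.
have [dp gp] := hp; have hp1 := sC2_sC1 hp.
pose psi w := phi (dotp w Om) * dotp w a.
have hpsi : sC1 psi by exact: (sC1M c0 (sC1_dotp a)).
have gpsi w : sphere w -> sph_grad psi w =
    (phi1 (dotp w Om) * dotp w a) *: Pperp w Om + phi (dotp w Om) *: Pperp w a.
  move=> Sw; rewrite /psi (@sph_gradM _ _ (fun w => phi (dotp w Om)) (fun w => dotp w a)) //.
  - by rewrite g0 // sph_grad_dotp // scalerA mulrC.
  - by case: c0.
  - exact: sdiff_dotp.
have hpsi2 : sC2 psi.
  split; first by case: hpsi.
  move=> i; apply: (@sC1_ext _ _ (fun w => phi1 (dotp w Om) * dotp w a * Pperp w Om 0 i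
    + phi (dotp w Om) * Pperp w a 0 i)).
    by move=> w Sw; rewrite gpsi //; move: (Pperp w Om) (Pperp w a) => u v; rewrite !mxE.
  exact: (sC1D (sC1M (sC1M c1 (sC1_dotp a)) (sC1_Pperp Om i)) (sC1M c0 (sC1_Pperp a i))).
have PP w b : sphere w -> dotp (Pperp w Om) (Pperp w b) = dotp Om b - dotp w Om * dotp w b.
  move=> /sphereE Sw; rewrite /Pperp !dotpBl !dotpBr !dotpZl !dotpZr Sw (dotpC Om w); ring.
have SO1 := (sphereE Om).1 SOm.
have PO w b : sphere w -> dotp (Pperp w b) Om = dotp Om b - dotp w Om * dotp w b.
  by move=> Sw; rewrite /Pperp dotpBl dotpZl (dotpC b); ring.
have gO w : sphere w -> dotp (sph_grad psi w) Om =
    dotp w a * ((1 - dotp w Om ^+ 2) * phi1 (dotp w Om) - dotp w Om * phi (dotp w Om)).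
  move=> Sw; rewrite gpsi // dotpDl !dotpZl !PO // SO1 Oma; ring.
have lap w : sphere w -> sph_laplacian psi w =
    dotp w a * ((1 - dotp w Om ^+ 2) * phi2 (dotp w Om) - (n%:R + 1) * dotp w Om * phi1 (dotp w Om)
      - (n%:R - 1) * phi (dotp w Om)).
  move=> Sw.
  pose V1 w := (phi1 (dotp w Om) * dotp w a) *: Pperp w Om.
  pose V2 w := phi (dotp w Om) *: Pperp w a.
  have f1 : sC1 (fun w => phi1 (dotp w Om) * dotp w a) by exact: (sC1M c1 (sC1_dotp a)).
  have dV1 i : sdiff (fun w => V1 w 0 i).
    rewrite (_ : (fun w => _) = fun w => phi1 (dotp w Om) * dotp w a * Pperp w Om 0 i).
      by apply: sdiffM; [case: f1|exact: sdiff_Pperp].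
    by apply/funext => u; rewrite !mxE.
  have dV2 i : sdiff (fun w => V2 w 0 i).
    rewrite (_ : (fun w => _) = fun w => phi (dotp w Om) * Pperp w a 0 i).
      by apply: sdiffM; [case: c0|exact: sdiff_Pperp].
    by apply/funext => u; rewrite !mxE.
  rewrite /sph_laplacian (@sph_div_ext _ _ _ (fun w => V1 w + V2 w)) //.
  rewrite sph_divD // /V1 /V2 sph_divZ //; last 2 first.
  - by case: f1.
  - by move=> i; exact: sdiff_Pperp.
  rewrite (@sph_divZ _ _ (fun w => phi (dotp w Om))) //; last 2 first.
  - by case: c0.
  - by move=> i; exact: sdiff_Pperp.
  rewrite (@sph_gradM _ _ (fun w => phi1 (dotp w Om)) (fun w => dotp w a)) //; last 2 first.
  - by case: c1.
  - exact: sdiff_dotp.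
  rewrite g1 // g0 // !sph_grad_dotp // !sph_div_Pperp // dotpDl !dotpZl.
  rewrite (dotpC (Pperp w a)) !PP // SO1 Oma; ring.
have e1 := smean_mul_lap hpsi hp.
have e2 := smean_mul_drift Om hpsi hp1.
have e3 := smean_mul_lap hp1 hpsi2.
have sdgp i : sdiff (fun w => sph_grad p w 0 i) by case: (gp i).
have bpsi : bmeas psi by apply: sdiff_bmeas; case: hpsi.
have bp : bmeas p by exact: sdiff_bmeas.
have blap := bmeas_lap hp; have bdrift := bmeas_drift Om hp1; have blappsi := bmeas_lap hpsi2.
have bgO : bmeas (fun w => dotp (sph_grad psi w) Om).
  by apply: bmeas_dotp => i; [exact: bmeas_grad|exact: bmeas_cst].
transitivity (- (k * t) * E (fun w => psi w * sph_div (fun u => p u *: Pperp u Om) w)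
    + t * E (fun w => psi w * sph_laplacian p w)).
  rewrite -!smeanZ -?smeanD //; try (by do ?[exact: bmeasM | apply: bmeasZ]).
  by apply: eq_smean => w Sw; rewrite /psi; ring.
rewrite e1 e2 (_ : E (fun w => dotp (sph_grad psi w) (sph_grad p w)) =
  - E (fun w => p w * sph_laplacian psi w)); last first.
  by rewrite e3 opprK; apply: eq_smean => w _; rewrite dotpC.
rewrite opprK mulrNN -[k * t]mulrC -mulrA -mulrDr; congr (_ * _).
rewrite -smeanZ -?smeanD //; try (by do ?[exact: bmeasM | apply: bmeasZ]).
by apply: eq_smean => w Sw; rewrite gO // lap // /gci_op; ring.
Qed.

End gci_identity.

(** * The collision invariant for the actual profile, by dilation *)

Section gci_limit.
Variables (R : realType) (m : nat) (sigma : probability (borel_rV R m.+2) R).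
Hypothesis hsigma : uniform_sphere sigma.
Implicit Types (p : 'rV[R]_m.+2 -> R) (u v w a Om : 'rV[R]_m.+2).
Local Notation E := (smean sigma).

(** The shift by 2 keeps the factor strictly between 0 and 1 from [j = 0] on. *)
Definition dil (j : nat) : R := 1 - (j.+2%:R)^-1.

Lemma dil_itv j : 0 < dil j < 1.
Proof.
have h : 0 < (j.+2%:R : R)^-1 by rewrite invr_gt0.
have h2 : (j.+2%:R : R)^-1 < 1 by rewrite invf_lt1 // ltr1n.
by rewrite /dil; move: h h2; move: (_^-1) => x hx hx2; lra.
Qed.

Lemma dil_cvg : dil @ \oo --> (1 : R).
Proof.
rewrite -[X in _ --> X](subr0 1); apply: cvgB; first exact: cvg_cst.
have := @cvg_harmonic R; rewrite -(cvg_shiftS (@harmonic R)); exact.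
Qed.

Lemma dil_mul_itv j (s : R) : -1 <= s <= 1 -> -1 < dil j * s < 1.
Proof.
have := dil_itv j; move: (dil j) => l hl hs; rewrite -ltr_norml normrM.
have : `|s| <= 1 by rewrite ler_norml.
by have := normr_ge0 s; rewrite (gtr0_norm (_ : 0 < l)); [nra|lra].
Qed.

Lemma dil_comp_cvg (F : R -> R) (s : R) : {for s, continuous F} ->
  F (dil j * s) @[j --> \oo] --> F s.
Proof.
move=> cF; apply: (@cvg_comp _ _ _ (fun j => dil j * s) F (\oo) (nbhs s)) => //.
by rewrite -[X in _ `=>` nbhs X]mul1r; apply: cvgM; [exact: dil_cvg|exact: cvg_cst].
Qed.

Variables (k : R) (g : R -> R).
Hypothesis hg : gci_profile m.+2 k g.
Local Notation h := (h_of g).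
Local Notation h1 := (prof_h1 g).
Local Notation h2 := (prof_h2 m k g).

(** [gci_op] as a polynomial in the values of [phi] and its derivatives, so that limits can be taken
    argument by argument. *)
Definition gci_poly (n : nat) (s p0 p1 p2 : R) : R :=
  (1 - s ^+ 2) * p2 - (n%:R + 1) * s * p1 - (n%:R - 1) * p0
  + k * ((1 - s ^+ 2) * p1 - s * p0).

Lemma gci_poly_cvg (T : Type) (F : set_system T) (FF : Filter F) n (s p0 p1 p2 : T -> R) s' q0 q1 q2 :
  s @ F --> s' -> p0 @ F --> q0 -> p1 @ F --> q1 -> p2 @ F --> q2 ->
  (fun x => gci_poly n (s x) (p0 x) (p1 x) (p2 x)) @ F --> gci_poly n s' q0 q1 q2.
Proof.
move=> cs c0 c1 c2.
have cc c : (fun=> c) @ F --> (c : R) by exact: cvg_cst.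
have cs2 : (fun x => 1 - s x ^+ 2) @ F --> 1 - s' ^+ 2.
  by apply: cvgB => //; rewrite expr2; under eq_fun do rewrite expr2; exact: cvgM.
apply: cvgD.
  apply: cvgB; last exact: cvgM.
  by apply: cvgB; [exact: cvgM|apply: cvgM => //; exact: cvgM].
apply: cvgM => //; apply: cvgB; exact: cvgM.
Qed.

(** The second derivative is not controlled by itself near the poles: the equation at [l * s] bounds
    only [(1 - (l s)^2) * h2]. Since [(1 - s^2) * l^2 <= 1 - (l s)^2], this suffices for the dilated
    function. The constant is 1 plus twice the bounds of the lower-order terms, which occur once
    directly and once through the equation. *)
Lemma gci_op_bound (s l h0 h1 h2 M : R) : -1 <= s <= 1 -> 0 < l < 1 -> 0 <= M ->
  `|h0| <= M -> `|h1| <= M ->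
  (1 - (l * s) ^+ 2) * h2 - (m%:R + 3) * (l * s) * h1 - (m%:R + 1) * h0
    + k * ((1 - (l * s) ^+ 2) * h1 - l * s * h0) = -1 ->
  `|(1 - s ^+ 2) * (l ^+ 2 * h2) - (m.+2%:R + 1) * s * (l * h1) - (m.+2%:R - 1) * h0
    + k * ((1 - s ^+ 2) * (l * h1) - s * h0)| <=
  1 + 2 * (m%:R + 3) * M + 2 * (m%:R + 1) * M + 4 * `|k| * M.
Proof.
move=> hs hl M0 hh0 hh1 ode.
have sM (x y : R) : -1 <= x <= 1 -> `|y| <= M -> `|x * y| <= M.
  by rewrite -ler_norml => hx hy; rewrite normrM -[M]mul1r; exact: ler_pM.
have u1 : -1 <= l * s <= 1 by nra.
have s2 : 0 <= 1 - s ^+ 2 <= 1 by nra.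
have u2 : 0 <= 1 - (l * s) ^+ 2 <= 1 by nra.
have m0 : 0 <= m%:R :> R by [].
have a1 := sM _ _ u1 hh1; have a2 := sM _ _ u1 hh0.
have a3 : `|(1 - (l * s) ^+ 2) * h1| <= M by apply: sM => //; lra.
have lh1 : `|l * h1| <= M by apply: sM => //; lra.
have a4 := sM _ _ hs lh1; have a5 := sM _ _ hs hh0.
have a6 : `|(1 - s ^+ 2) * (l * h1)| <= M by apply: sM => //; lra.
have tri (a b c d : R) : `|a - b - c + d| <= `|a| + `|b| + `|c| + `|d|.
  apply: le_trans (ler_normD _ _) _; rewrite lerD2r.
  apply: le_trans (ler_normB _ _) _; rewrite lerD2r.
  exact: ler_normB.
have pos (c x : R) : 0 <= c -> `|x| <= M -> `|c * x| <= c * M.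
  by move=> c0 hx; rewrite normrM (ger0_norm c0); exact: ler_wpM2l.
have kk (x y : R) : `|x| <= M -> `|y| <= M -> `|k * (x - y)| <= 2 * `|k| * M.
  move=> hx hy; rewrite normrM (_ : 2 * `|k| * M = `|k| * (M + M)); last by ring.
  apply: ler_wpM2l => //; apply: le_trans (ler_normB _ _) _; exact: lerD.
have m3 : 0 <= m%:R + 3 :> R by lra.
have m1 : 0 <= m%:R + 1 :> R by lra.
have X : `|(1 - s ^+ 2) * (l ^+ 2 * h2)| <= 1 + (m%:R + 3) * M + (m%:R + 1) * M + 2 * `|k| * M.
  apply: (@le_trans _ _ `|(1 - (l * s) ^+ 2) * h2|).
    rewrite mulrA normrM [leRHS]normrM; apply: ler_wpM2r => //.
    have l2 : 0 <= l ^+ 2 <= 1 by nra.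
    move: u2; rewrite exprMn => /andP[u20 _]; rewrite ger0_norm.
      rewrite ger0_norm // (_ : (1 - s ^+ 2) * l ^+ 2 = l ^+ 2 - l ^+ 2 * s ^+ 2); last by ring.
      by rewrite lerD2r; case/andP: l2.
    by apply: mulr_ge0; [case/andP: s2|case/andP: l2].
  have -> : (1 - (l * s) ^+ 2) * h2 = -1 - - ((m%:R + 3) * (l * s * h1)) - - ((m%:R + 1) * h0)
      + - (k * ((1 - (l * s) ^+ 2) * h1 - l * s * h0)).
    by rewrite -ode; ring.
  apply: le_trans (tri _ _ _ _) _; rewrite !normrN normr1.
  by apply: lerD; [apply: lerD; [apply: lerD => //; exact: pos|exact: pos]|exact: kk].
apply: le_trans (tri _ _ _ _) _.
have Y : `|(m.+2%:R + 1) * s * (l * h1)| <= (m%:R + 3) * M.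
  by rewrite -mulrA (_ : m.+2%:R + 1 = m%:R + 3 :> R); [exact: pos|rewrite -addn2 natrD; ring].
have Z : `|(m.+2%:R - 1) * h0| <= (m%:R + 1) * M.
  by rewrite (_ : m.+2%:R - 1 = m%:R + 1 :> R); [exact: pos|rewrite -addn2 natrD; ring].
have W := kk _ _ a6 a5.
move: X Y Z W; lra.
Qed.

Lemma prof_h2_continuous (s : R) : -1 < s < 1 -> {for s, continuous h2}.
Proof.
move=> hs; have n0 : 1 - s ^+ 2 != 0 by rewrite gt_eqF //; nra.
have dh := h_of_derive hg hs; have dh1 := prof_h1_derive hg hs.
have ds : is_derive s 1 (fun s : R => s) 1 by exact: is_derive_id.
have dq := is_dB (is_dcst 1 s 1) (is_dX 2 ds).
have d1 := is_dM (is_dD (is_dcst (m%:R + 1) s 1) (is_dZ k ds)) dh.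
have d2 := is_dM (is_dZ (m%:R + 3) ds) dh1.
have d3 := is_dM (is_dZ k dq) dh1.
have dd := is_dM (is_dB (is_dD (is_dB d1 (is_dcst 1 s 1)) d2) d3) (is_dV (f := fun y : R => 1 - y ^+ 2) n0 dq).
exact: (is_d_continuous dd).
Qed.

Lemma h_dil_zonal Om a w : sphere Om -> dotp Om a = 0 -> sphere w ->
  h (dil j * dotp w Om) * dotp w a @[j --> \oo] --> h (dotp w Om) * dotp w a.
Proof.
move=> SOm Oa Sw; have hs := dotp_itv Sw SOm.
have [e|e] := eqVneq `|dotp w Om| 1.
  have -> : dotp w a = 0 by rewrite (dotp_pole Sw SOm e) dotpZl Oa mulr0.
  by rewrite mulr0; under eq_fun do rewrite mulr0; exact: cvg_cst.
apply: cvgM; last exact: cvg_cst.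
apply: dil_comp_cvg; apply: is_d_continuous; apply: (h_of_derive hg).
by rewrite -ltr_norml lt_neqAle e ler_norml.
Qed.

Lemma sC1_h_dil j Om : sphere Om -> sC1 (fun w => h (dil j * dotp w Om)).
Proof.
move=> SOm.
have [||//] := @sC1_zonal R m.+2 Om (fun s => h (dil j * s)) (fun s => dil j * h1 (dil j * s)) SOm.
- move=> s hs; have := h_of_derive hg (dil_mul_itv j hs) => d.
  apply: is_d_eq (is_d_comp (is_dZ (dil j) (is_derive_id s 1)) d) _.
  by rewrite mulr1 mulrC.
- move=> s hs; have := prof_h1_derive hg (dil_mul_itv j hs) => d.
  exact: is_d_continuous (is_dZ (dil j) (is_d_comp (is_dZ (dil j) (is_derive_id s 1)) d)).
Qed.

(* The factor [1 - s ^+ (2 * j)] restores in the limit the junk value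
   [h_of g 1 = h_of g (- 1) = 0] (division by [sin 0] and [sin pi]). *)
Lemma bmeas_h Om : sphere Om -> bmeas (fun w => h (dotp w Om)).
Proof.
move=> SOm; have [M M0 hM] := prof_h_bounds hg.
apply: (@bmeas_cvg _ _ (fun j w => h (dil j * dotp w Om) * (1 - (dotp w Om ^+ 2) ^+ j)) _ (M * 1)).
- move=> j; apply: bmeasM; first by apply: sdiff_bmeas; case: (sC1_h_dil j SOm).
  apply: bmeasB; first exact: bmeas_cst.
  elim: j => [|j IH]; first exact: bmeas_cst.
  apply: bmeas_ext (bmeasM (bmeasM (bmeas_dotpl Om) (bmeas_dotpl Om)) IH) => w _.
  by rewrite -expr2 [_ ^+ j.+1]exprS.
- move=> j w Sw; have hs0 := dotp_itv Sw SOm; have := dil_mul_itv j hs0 => hs.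
  rewrite normrM; apply: ler_pM => //.
    by have [+ _] := hM (dil j * dotp w Om); apply; lra.
  have s2 : 0 <= dotp w Om ^+ 2 <= 1 by nra.
  case/andP: s2 => s20 s21; have a0 := exprn_ge0 j s20; have a1 := exprn_ile1 j s20 s21.
  by rewrite ger0_norm; lra.
move=> w Sw; have hs := dotp_itv Sw SOm.
have [e|e] := eqVneq `|dotp w Om| 1.
  rewrite h_of_pole // -[dotp w Om ^+ 2]real_normK ?num_real // e expr1n.
  by under eq_fun do rewrite expr1n subrr mulr0; exact: cvg_cst.
have hs1 : -1 < dotp w Om < 1 by rewrite -ltr_norml lt_neqAle e ler_norml.
rewrite -[X in _ --> X]mulr1; apply: cvgM.
  by apply: dil_comp_cvg; exact: is_d_continuous (h_of_derive hg hs1).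
rewrite -[X in _ --> X](subr0 1); apply: cvgB; first exact: cvg_cst.
apply: cvg_expr; rewrite ger0_norm ?sqr_ge0 //; nra.
Qed.

Lemma bmeas_h_zonal Om a : sphere Om -> bmeas (fun w => h (dotp w Om) * dotp w a).
Proof. by move=> SOm; apply: bmeasM; [exact: bmeas_h|exact: bmeas_dotpl]. Qed.

(** Limit of [gci_smooth] along the dilations, by bounded convergence on both sides. Off the poles
    [gci_op] tends to -1, the right-hand side of the profile equation; at the poles [w.a = 0]. What
    remains is a multiple of the moment of [p] against [w.a], which is 0 by hypothesis. *)
Lemma smean_gci Om a p (t : R) : sphere Om -> dotp Om a = 0 -> sC2 p ->
  E (fun w => p w * dotp w a) = 0 ->
  E (fun w => h (dotp w Om) * dotp w a *
    (- (k * t) * sph_div (fun u => p u *: Pperp u Om) w + t * sph_laplacian p w)) = 0.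
Proof.
move=> SOm Oa hp pa0; have [M M0 hM] := prof_h_bounds hg.
have hp1 := sC2_sC1 hp; have bp : bmeas p by apply: sdiff_bmeas; case: hp1.
pose T w := - (k * t) * sph_div (fun u => p u *: Pperp u Om) w + t * sph_laplacian p w.
have bT : bmeas T.
  by apply: bmeasD; apply: bmeasZ; [exact: bmeas_drift|exact: bmeas_lap].
have [_ [N hN]] := bmeas_dotpl a; have [_ [L hL]] := bT; have [_ [K hK]] := bp.
pose phi j s := h (dil j * s); pose phi1 j s := dil j * h1 (dil j * s).
pose phi2 j s := dil j ^+ 2 * h2 (dil j * s).
have d0 j (s : R) : -1 <= s <= 1 -> is_derive s 1 (phi j) (phi1 j s).
  move=> hs; have := h_of_derive hg (dil_mul_itv j hs) => d.
  apply: is_d_eq (is_d_comp (is_dZ (dil j) (is_derive_id s 1)) d) _.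
  by rewrite mulr1 mulrC.
have d1 j (s : R) : -1 <= s <= 1 -> is_derive s 1 (phi1 j) (phi2 j s).
  move=> hs; have := prof_h1_derive hg (dil_mul_itv j hs) => d.
  apply: is_d_eq (is_dZ (dil j) (is_d_comp (is_dZ (dil j) (is_derive_id s 1)) d)) _.
  by rewrite mulr1 /phi2 expr2 -mulrA [h2 _ * _]mulrC.
have c2 j (s : R) : -1 <= s <= 1 -> {for s, continuous (phi2 j)}.
  move=> hs; have c := prof_h2_continuous (dil_mul_itv j hs).
  apply: (@cvgM _ _ (nbhs s) _ (fun=> dil j ^+ 2)); first exact: cvg_cst.
  apply: (@cvg_comp _ _ _ (fun u : R => dil j * u) h2 (nbhs s) (nbhs (dil j * s))) => //.
  by apply: cvgM; [exact: cvg_cst|exact: cvg_id].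
have step j := gci_smooth hsigma k t SOm Oa hp (d0 j) (d1 j) (c2 j).
pose G j w := gci_op m.+2 k (phi j) (phi1 j) (phi2 j) (dotp w Om).
have cL : (fun j => E (fun w => phi j (dotp w Om) * dotp w a * T w)) @ \oo -->
    E (fun w => h (dotp w Om) * dotp w a * T w).
  apply: (@smean_cvg _ _ _ hsigma (fun j w => phi j (dotp w Om) * dotp w a * T w) _ (M * N * L)).
  - move=> j; apply: bmeasM => //; apply: bmeasM; last exact: bmeas_dotpl.
    by apply: sdiff_bmeas; case: (sC1_h_dil j SOm).
  - move=> j w Sw; have := dil_mul_itv j (dotp_itv Sw SOm) => hs.
    rewrite 2!normrM; apply: ler_pM => //; last exact: hL.
    apply: ler_pM => //; last exact: hN.
    by have [+ _] := hM (dil j * dotp w Om); apply; lra.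
  - by move=> w Sw; apply: cvgM; [exact: h_dil_zonal|exact: cvg_cst].
have bG j : bmeas (fun w => dotp w a * G j w).
  apply: bmeasM; first exact: bmeas_dotpl.
  apply: scont_bmeas => w Sw; have hs := dotp_itv Sw SOm.
  have cs : (fun u => dotp (unitv u) Om) @ nbhs w --> dotp w Om.
    exact: (sdiff_scont (sdiff_dotp Om) Sw).
  have cc (F : R -> R) : {for dotp w Om, continuous F} -> (fun u => F (dotp (unitv u) Om)) @ nbhs w --> F (dotp w Om).
    by move=> cF; apply: (@cvg_comp _ _ _ (fun u => dotp (unitv u) Om) F (nbhs w) (nbhs (dotp w Om))).
  apply: (@gci_poly_cvg _ (nbhs w) _ m.+2 (fun u => dotp (unitv u) Om)
    (fun u => phi j (dotp (unitv u) Om)) (fun u => phi1 j (dotp (unitv u) Om))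
    (fun u => phi2 j (dotp (unitv u) Om))); [exact: cs|apply: cc..].
  - exact: is_d_continuous (d0 j _ hs).
  - exact: is_d_continuous (d1 j _ hs).
  - exact: c2.
pose B := 1 + 2 * (m%:R + 3) * M + 2 * (m%:R + 1) * M + 4 * `|k| * M.
have cR : (fun j => E (fun w => p w * (dotp w a * G j w))) @ \oo -->
    E (fun w => p w * (dotp w a * -1)).
  apply: (@smean_cvg _ _ _ hsigma (fun j w => p w * (dotp w a * G j w)) _ (K * (N * B))).
  - by move=> j; apply: bmeasM.
  - move=> j w Sw; rewrite !normrM; apply: ler_pM => //; first exact: hK.
    apply: ler_pM => //; first exact: hN.
    have hs0 := dotp_itv Sw SOm; have hs := dil_mul_itv j hs0.
    rewrite /G /gci_op /phi /phi1 /phi2 /B.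
    have [b0 b1] := hM (dil j * dotp w Om); have {}b1 := b1 hs.
    have {}b0 : `|h (dil j * dotp w Om)| <= M by apply: b0; lra.
    have ode := prof_h_ode m k g hs; have dj := dil_itv j.
    by apply: gci_op_bound => //; lra.
  - move=> w Sw; apply: cvgM; first exact: cvg_cst.
    have hs := dotp_itv Sw SOm.
    have [e|e] := eqVneq `|dotp w Om| 1.
      have -> : dotp w a = 0 by rewrite (dotp_pole Sw SOm e) dotpZl Oa mulr0.
      by rewrite mul0r; under eq_fun do rewrite mul0r; exact: cvg_cst.
    apply: cvgM; first exact: cvg_cst.
    have hs1 : -1 < dotp w Om < 1 by rewrite -ltr_norml lt_neqAle e ler_norml.
    have -> : -1 = gci_poly m.+2 (dotp w Om) (h (dotp w Om)) (1 * h1 (dotp w Om)) (1 ^+ 2 * h2 (dotp w Om)).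
      move: (dotp w Om) hs1 => s hs1.
      by rewrite -(prof_h_ode m k g hs1) /gci_poly -(addn2 m) natrD; ring.
    apply: (@gci_poly_cvg nat \oo _ m.+2 (fun=> dotp w Om) (fun j => phi j (dotp w Om))
      (fun j => phi1 j (dotp w Om)) (fun j => phi2 j (dotp w Om))); first exact: cvg_cst.
    - by apply: dil_comp_cvg; exact: is_d_continuous (h_of_derive hg hs1).
    - apply: cvgM; first exact: dil_cvg.
      by apply: dil_comp_cvg; exact: is_d_continuous (prof_h1_derive hg hs1).
    - apply: cvgM; last by apply: dil_comp_cvg; exact: prof_h2_continuous.
      rewrite expr2; under eq_fun do rewrite expr2.
      by apply: cvgM; exact: dil_cvg.
have E0 : E (fun w => p w * (dotp w a * -1)) = 0.
  rewrite (@eq_smean _ _ _ _ (fun w => - (p w * dotp w a))).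
    by rewrite smeanN // ?pa0 ?oppr0 //; apply: bmeasM => //; exact: bmeas_dotpl.
  by move=> w _; ring.
have cT : (fun j => E (fun w => phi j (dotp w Om) * dotp w a * T w)) @ \oo --> t * 0.
  rewrite (funext step) -E0.
  by apply: cvgM cR; exact: cvg_cst.
have := cvg_lim (@norm_hausdorff _ _) cL; rewrite (cvg_lim (@norm_hausdorff _ _) cT) => <-.
exact: mulr0.
Qed.

End gci_limit.

(** * Zonal integrals *)

Section zonal.
Variables (R : realType) (n : nat) (sigma : probability (borel_rV R n) R).
Hypothesis hsigma : uniform_sphere sigma.
Implicit Types (F G : 'rV[R]_n -> R) (u v w : 'rV[R]_n).
Local Notation E := (smean sigma).

Definition refl_mx v : 'M[R]_n := 1%:M - (2 / dotp v v) *: (v^T *m v).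

Lemma mul_refl v w : w *m refl_mx v = w - (2 / dotp v v * dotp w v) *: v.
Proof.
rewrite mulmxBr mulmx1 -scalemxAr mulmxA; congr (_ - _); rewrite -scalerA; congr (_ *: _).
apply/rowP => i; rewrite !mxE big_ord_recl big_ord0 addr0 !mxE; congr (_ * _).
by apply: eq_bigr => j _; rewrite mxE.
Qed.

Lemma dotp_refl v u w : dotp (u *m refl_mx v) w = dotp u (w *m refl_mx v).
Proof. by rewrite !mul_refl dotpBl dotpBr dotpZl dotpZr (dotpC v w); ring. Qed.

Lemma mul_refl_sqr v w : v != 0 -> w *m refl_mx v *m refl_mx v = w.
Proof.
move=> v0; have vv : dotp v v != 0 by rewrite gt_eqF // dotp_gt0.
rewrite !mul_refl dotpBl dotpZl.
rewrite -addrA -opprD -scalerDl [X in w - X *: v](_ : _ = 0) ?scale0r ?subr0 //.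
by field.
Qed.

Lemma refl_orthogonal v : v != 0 -> refl_mx v *m (refl_mx v)^T = 1%:M.
Proof.
move=> v0; have -> : (refl_mx v)^T = refl_mx v.
  by rewrite /refl_mx linearB linearZ /= trmx1 trmx_mul trmxK.
by apply/row_matrixP => i; rewrite !rowE mulmxA mul_refl_sqr // mulmx1.
Qed.

Lemma refl_perp v w : dotp w v = 0 -> w *m refl_mx v = w.
Proof. by move=> h; rewrite mul_refl h mulr0 scale0r subr0. Qed.

Lemma refl_self v : v != 0 -> v *m refl_mx v = - v.
Proof.
move=> v0; have vv : dotp v v != 0 by rewrite gt_eqF // dotp_gt0.
by rewrite mul_refl divfK // -[X in X - _]scale1r -scalerBl (_ : 1 - 2 = -1) ?scaleN1r //; ring.
Qed.

Lemma refl_swap u v : dotp u u = dotp v v -> u != v -> u *m refl_mx (u - v) = v.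
Proof.
move=> uv nuv; have vv : dotp (u - v) (u - v) != 0 by rewrite gt_eqF // dotp_gt0 subr_eq0.
have e : dotp (u - v) (u - v) = 2 * dotp u (u - v).
  by rewrite dotpBl !dotpBr uv (dotpC v u); ring.
rewrite mul_refl mulrAC -e divff // scale1r; apply/rowP => i; rewrite !mxE; ring.
Qed.

Lemma smean_odd (O : 'M[R]_n) F : O *m O^T = 1%:M -> bmeas F ->
  (forall w, sphere w -> F (w *m O) = - F w) -> E F = 0.
Proof.
move=> hO bF h; have e : E F = - E F.
  rewrite -[LHS](smean_rot hsigma hO bF) -smeanN //; exact: eq_smean.
by move: e; move: (E F) => x; lra.
Qed.

Variables (Om : 'rV[R]_n).
Hypothesis SOm : sphere Om.
Implicit Types (a b c : 'rV[R]_n) (g : R -> R).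

(** The reflection along [a] fixes [Om] and changes the sign of [w.a]. *)
Lemma smean_zonal_dotp g a : bmeas (fun w => g (dotp w Om)) -> dotp Om a = 0 -> E (fun w => g (dotp w Om) * dotp w a) = 0.
Proof.
move=> bg Oa; have [->|a0] := eqVneq a 0.
  by rewrite -[RHS](smean_cst hsigma 0); apply: eq_smean => w _; rewrite dotp0r mulr0.
apply: (smean_odd (refl_orthogonal a0)); first by apply: bmeasM => //; exact: bmeas_dotpl.
move=> w _; rewrite !dotp_refl refl_self // refl_perp // dotpNr; ring.
Qed.

(** After normalisation, the reflection along the difference of the two unit vectors exchanges them
    and fixes [Om]. The crosswise form of the identity makes sense for zero vectors too. *)
Lemma zonal2_sqr_swap g a b : bmeas (fun w => g (dotp w Om)) ->
  dotp Om a = 0 -> dotp Om b = 0 ->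
  dotp b b * E (fun w => g (dotp w Om) * dotp w a ^+ 2) =
  dotp a a * E (fun w => g (dotp w Om) * dotp w b ^+ 2).
Proof.
move=> bg; have bq c : bmeas (fun w => g (dotp w Om) * dotp w c ^+ 2).
  by apply: bmeasM => //; apply: bmeasM; exact: bmeas_dotpl.
have z : E (fun w => g (dotp w Om) * dotp w 0 ^+ 2) = 0.
  by rewrite -[RHS](smean_cst hsigma 0); apply: eq_smean => w _; rewrite dotp0r expr0n mulr0.
move=> Oa Ob; have [->|a0] := eqVneq a 0; first by rewrite z dotp0l mul0r mulr0.
have [->|b0] := eqVneq b 0; first by rewrite z dotp0l mul0r mulr0.
have U c : c != 0 -> E (fun w => g (dotp w Om) * dotp w c ^+ 2) =
    dotp c c * E (fun w => g (dotp w Om) * dotp w (unitv c) ^+ 2).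
  move=> c0; rewrite -smeanZ //; apply: eq_smean => w _.
  by rewrite -enorm_sqr /unitv dotpZr; have := c0; rewrite -enorm_gt0; move: (enorm c) => e e0; field; lra.
rewrite (U a a0) (U b b0) mulrCA; congr (_ * (_ * _)).
have [->//|ab] := eqVneq (unitv b) (unitv a).
have v0 : unitv b - unitv a != 0 by rewrite subr_eq0.
have Sa := (sphereE _).1 (sphere_unitv a0); have Sb := (sphereE _).1 (sphere_unitv b0).
rewrite -[RHS](smean_rot hsigma (refl_orthogonal v0) (bq _)); apply: eq_smean => w _.
have Oab : dotp Om (unitv b - unitv a) = 0.
  by rewrite dotpBr /unitv !dotpZr Oa Ob !mulr0 subr0.
by rewrite !dotp_refl refl_swap ?Sa ?Sb // refl_perp.
Qed.

(** For [c = a], compare with the projected basis vectors [Pperp Om (ei R i)]: their squared norms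
    add up to [n - 1], and the squared components of [w] along them to [1 - (w.Om)^2]. Polarization
    handles [c] orthogonal to [Om], and the component of [c] along [Om] contributes an odd term of
    mean 0. *)
Lemma smean_zonal_dotp2 g a c (bg : bmeas (fun w => g (dotp w Om))) (Oa : dotp Om a = 0) :
  (n%:R - 1) * E (fun w => g (dotp w Om) * (dotp w a * dotp w c)) =
  dotp a c * E (fun w => g (dotp w Om) * (1 - dotp w Om ^+ 2)).
Proof.
have S1 := (sphereE Om).1 SOm.
have bq a' c' : bmeas (fun w => g (dotp w Om) * (dotp w a' * dotp w c')).
  by apply: bmeasM => //; apply: bmeasM; exact: bmeas_dotpl.
have bq2 c' : bmeas (fun w => g (dotp w Om) * dotp w c' ^+ 2) by exact: bq.
have bs : bmeas (fun w => g (dotp w Om) * (1 - dotp w Om ^+ 2)).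
  apply: bmeasM => //; apply: bmeasB; first exact: bmeas_cst.
  by apply: bmeasM; exact: bmeas_dotpl.
have PO b : dotp Om (Pperp Om b) = 0 by exact: Pperp_tangent.
have sqr b : dotp Om b = 0 -> (n%:R - 1) * E (fun w => g (dotp w Om) * dotp w b ^+ 2) =
    dotp b b * E (fun w => g (dotp w Om) * (1 - dotp w Om ^+ 2)).
  move=> Ob.
  have h i := zonal2_sqr_swap bg Ob (PO (ei R i)).
  have P1 i : dotp (Pperp Om (ei R i)) (Pperp Om (ei R i)) = 1 - Om 0 i * Om 0 i.
    rewrite /Pperp !dotpBl !dotpBr !dotpZl !dotpZr S1 (dotpC (ei R i) Om) !dotp_ei.
    have -> : ei R i 0 i = 1 by rewrite /ei mxE !eqxx.
    ring.
  have P2 w i : dotp w (Pperp Om (ei R i)) ^+ 2 =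
      w 0 i * w 0 i - 2 * dotp w Om * (w 0 i * Om 0 i) + dotp w Om ^+ 2 * (Om 0 i * Om 0 i).
    by rewrite /Pperp dotpBr dotpZr !dotp_ei; ring.
  have -> : n%:R - 1 = \sum_i dotp (Pperp Om (ei R i)) (Pperp Om (ei R i)).
    rewrite (eq_bigr _ (fun i _ => P1 i)) sumrB sumr_const card_ord; congr (_ - _).
    by rewrite -S1.
  rewrite mulr_suml (eq_bigr _ (fun i _ => h i)) -mulr_sumr; congr (_ * _).
  rewrite -smean_sum //; apply: eq_smean => w /sphereE Sw; rewrite -mulr_sumr; congr (_ * _).
  rewrite (eq_bigr _ (fun i _ => P2 w i)) big_split /= sumrB -!mulr_sumr -!/(dotp _ _) Sw S1.
  by ring.
have perp d : dotp Om d = 0 -> (n%:R - 1) * E (fun w => g (dotp w Om) * (dotp w a * dotp w d)) =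
    dotp a d * E (fun w => g (dotp w Om) * (1 - dotp w Om ^+ 2)).
  move=> Od; have := sqr (a + d); have := sqr a Oa; have := sqr d Od.
  rewrite dotpDr Oa Od addr0 => hd ha /(_ erefl).
  have -> : E (fun w => g (dotp w Om) * dotp w (a + d) ^+ 2) =
    E (fun w => g (dotp w Om) * dotp w a ^+ 2) + E (fun w => g (dotp w Om) * dotp w d ^+ 2)
      + 2 * E (fun w => g (dotp w Om) * (dotp w a * dotp w d)).
    rewrite -smeanZ // -!smeanD //; last 2 first.
    - by apply: bmeasD.
    - by apply: bmeasZ.
    by apply: eq_smean => w _; rewrite dotpDr; ring.
  rewrite dotpDl !dotpDr (dotpC d a) !mulrDr ha hd !mulrDl => e.
  apply: (mulfI (_ : 2 != 0 :> R)); first by rewrite pnatr_eq0.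
  move: e; move: (E (fun w => g (dotp w Om) * (dotp w a * dotp w d)))
    (E (fun w => g (dotp w Om) * (1 - dotp w Om ^+ 2))) => X Y e; lra.
have cE : c = Pperp Om c + dotp Om c *: Om by rewrite /Pperp subrK.
have Oc : dotp a c = dotp a (Pperp Om c).
  by rewrite /Pperp dotpBr dotpZr (dotpC a Om) Oa mulr0 subr0.
rewrite Oc -perp //; congr (_ * _).
have bgs : bmeas (fun w => g (dotp w Om) * dotp w Om) by apply: bmeasM => //; exact: bmeas_dotpl.
have z1 := smean_zonal_dotp (g := fun s => g s * s) bgs Oa.
rewrite -[RHS]addr0 -[X in _ + X](mulr0 (dotp Om c)) -z1 -smeanZ //; last first.
  by apply: bmeasM => //; exact: bmeas_dotpl.
rewrite -smeanD //; last by apply: bmeasZ; apply: bmeasM => //; exact: bmeas_dotpl.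
by apply: eq_smean => w _; rewrite [in LHS]cE dotpDr dotpZr; ring.
Qed.

(** Split [b] and [c] along [Om] and its complement. The product of three orthogonal components is
    odd under [- refl_mx Om], which fixes [Om] and reverses its complement; one orthogonal factor
    alone also has mean 0; two of them are the previous lemma. *)
Lemma smean_zonal_dotp3 g a b c (bg : bmeas (fun w => g (dotp w Om))) (Oa : dotp Om a = 0) :
  (n%:R - 1) * E (fun w => g (dotp w Om) * (dotp w a * dotp w b * dotp w c)) =
  (dotp a b * dotp Om c + dotp a c * dotp Om b) *
    E (fun w => g (dotp w Om) * dotp w Om * (1 - dotp w Om ^+ 2)).
Proof.
have S1 := (sphereE Om).1 SOm.
have PO d : dotp Om (Pperp Om d) = 0 by exact: Pperp_tangent.
have Oc d : dotp a d = dotp a (Pperp Om d).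
  by rewrite /Pperp dotpBr dotpZr (dotpC a Om) Oa mulr0 subr0.
have cE d w : dotp w d = dotp w (Pperp Om d) + dotp Om d * dotp w Om.
  by rewrite -dotpZr -dotpDr /Pperp subrK.
have bs := bmeas_dotpl Om.
have bgs : bmeas (fun w => g (dotp w Om) * dotp w Om) by apply: bmeasM.
have bgss : bmeas (fun w => g (dotp w Om) * dotp w Om * dotp w Om) by apply: bmeasM.
have z1 := smean_zonal_dotp (g := fun s => g s * s * s) bgss Oa.
have z2 d := smean_zonal_dotp2 (g := fun s => g s * s) (Pperp Om d) bgs Oa.
have O0 : Om != 0 by exact: sphere_neq0.
have odd : E (fun w => g (dotp w Om) * (dotp w a * dotp w (Pperp Om b) * dotp w (Pperp Om c))) = 0.
  have hO : (- refl_mx Om) *m (- refl_mx Om)^T = 1%:M.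
    by rewrite linearN mulNmx mulmxN opprK refl_orthogonal.
  apply: (smean_odd hO).
    by do ?[apply: bmeasM => //; try exact: bmeas_dotpl].
  move=> w _; rewrite !mulmxN !dotpNl !dotp_refl refl_self //.
  rewrite !refl_perp; [|by rewrite dotpC..].
  by rewrite dotpNr opprK; ring.
have b2 d : bmeas (fun w => g (dotp w Om) * dotp w Om * (dotp w a * dotp w (Pperp Om d))).
  by apply: bmeasM => //; apply: bmeasM; exact: bmeas_dotpl.
have -> : E (fun w => g (dotp w Om) * (dotp w a * dotp w b * dotp w c)) =
    E (fun w => g (dotp w Om) * (dotp w a * dotp w (Pperp Om b) * dotp w (Pperp Om c)))
    + (dotp Om b * dotp Om c) * E (fun w => g (dotp w Om) * dotp w Om * dotp w Om * dotp w a)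
    + dotp Om c * E (fun w => g (dotp w Om) * dotp w Om * (dotp w a * dotp w (Pperp Om b)))
    + dotp Om b * E (fun w => g (dotp w Om) * dotp w Om * (dotp w a * dotp w (Pperp Om c))).
  have b3 : bmeas (fun w => g (dotp w Om) * (dotp w a * dotp w (Pperp Om b) * dotp w (Pperp Om c))).
    by do ?[apply: bmeasM => //; try exact: bmeas_dotpl].
  have b4 : bmeas (fun w => g (dotp w Om) * dotp w Om * dotp w Om * dotp w a).
    by apply: bmeasM => //; exact: bmeas_dotpl.
  rewrite -!smeanZ // -!smeanD //; try by do ?[apply: bmeasD|apply: bmeasZ].
  by apply: eq_smean => w _; rewrite (cE b w) (cE c w); ring.
rewrite odd z1; have := z2 c; have := z2 b; rewrite -!Oc.
move: (E (fun w => g (dotp w Om) * dotp w Om * (dotp w a * dotp w (Pperp Om b))))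
  (E (fun w => g (dotp w Om) * dotp w Om * (dotp w a * dotp w (Pperp Om c))))
  (E (fun w => g (dotp w Om) * dotp w Om * (1 - dotp w Om ^+ 2))) => X Y Z eX eY.
transitivity (dotp Om c * ((n%:R - 1) * X) + dotp Om b * ((n%:R - 1) * Y)); first by ring.
by rewrite eX eY; ring.
Qed.

End zonal.

(** * Reduction of zonal means to integrals over the polar angle *)

Section int0pi_continuous.
Variable R : realType.
Implicit Types (F G : R -> R).
Local Notation leb := (@lebesgue_measure R).

Lemma int0pi_integrable F : continuous F -> leb.-integrable `[0, pi] (EFin \o F).
Proof.
move=> cF; apply: continuous_compact_integrable; first exact: segment_compact.
exact: continuous_subspaceT.
Qed.

Lemma int0piZ c F : continuous F -> int0pi (fun x => c * F x) = c * int0pi F.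
Proof. by move=> cF; apply: RintegralZl => //; exact: int0pi_integrable. Qed.

Lemma int0piD F G : continuous F -> continuous G ->
  int0pi (fun x => F x + G x) = int0pi F + int0pi G.
Proof. by move=> cF cG; apply: RintegralD => //; exact: int0pi_integrable. Qed.

Lemma int0pi_FTC F f : (forall x : R, is_derive x 1 F (f x)) -> continuous f ->
  int0pi f = F pi - F 0.
Proof.
move=> dF cf; have cF x : {for x, continuous F} by exact: is_d_continuous (dF x).
rewrite /int0pi /Rintegral (@continuous_FTC2 _ f F 0 pi) //; first exact: pi_gt0.
- exact: continuous_subspaceT.
- split.
  + by move=> x _; case: (dF x).
  + by apply: cvg_at_right_filter; exact: cF.
  + by apply: cvg_at_left_filter; exact: cF.
- by move=> x _; rewrite derive1E; case: (dF x).
Qed.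

Lemma int0pi_cvg (F_ : nat -> R -> R) F (M : R) :
  (forall j, continuous (F_ j)) -> continuous F ->
  (forall j x, `|F_ j x| <= M) -> (forall x, F_ ^~ x @ \oo --> F x) ->
  (fun j => int0pi (F_ j)) @ \oo --> int0pi F.
Proof.
move=> cFj cF hM h.
have mI : measurable (`[0, pi] : set R) by exact: measurable_itv.
have [|||||_ _] := @dominated_convergence _ _ _ leb _ mI
  (fun m => EFin \o F_ m) (EFin \o F) (fun=> M%:E).
- by move=> m; apply/measurable_EFinP; apply: measurable_funTS; exact: continuous_measurable_fun.
- by apply/measurable_EFinP; apply: measurable_funTS; exact: continuous_measurable_fun.
- by apply: aeW => x _; apply: cvg_comp (h x) _; exact: cvg_id.
- exact: (@int0pi_integrable (fun=> M) (fun x => cvg_cst _)).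
- by apply: aeW => x m _; rewrite lee_fin hM.
move=> hc; apply: fine_cvg; move: hc.
rewrite (_ : (\int[leb]_(x in _) _)%E = (int0pi F)%:E) //.
by rewrite /int0pi /Rintegral fineK //; apply: integrable_fin_num => //; exact: int0pi_integrable.
Qed.

End int0pi_continuous.

(** * Bernstein polynomials on [[-1, 1]] *)

Section bernstein.
Variable R : realType.
Implicit Types (F : nat -> R) (x : R).

(* [bern N F] is the mean of [F] under the binomial law of parameters [N] and
   [(1 + 'X) / 2]. *)
Fixpoint bern (N : nat) F : {poly R} :=
  if N is N'.+1 then
    (2^-1 *: (1 + 'X)) * bern N' (F \o succn) + (2^-1 *: (1 - 'X)) * bern N' F
  else (F 0%N)%:P.

Lemma bernS N F x : (bern N.+1 F).[x] =
  (1 + x) / 2 * (bern N (F \o succn)).[x] + (1 - x) / 2 * (bern N F).[x].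
Proof. by rewrite /= !hornerE ![2^-1 * _]mulrC. Qed.

Lemma bern_le N F G x : -1 <= x <= 1 -> (forall i, (i <= N)%N -> F i <= G i) ->
  (bern N F).[x] <= (bern N G).[x].
Proof.
move=> hx; elim: N F G => [|N IH] F G FG; first by rewrite !hornerE; exact: FG.
rewrite !bernS; apply: lerD; apply: ler_wpM2l; try lra.
  by apply: IH => i hi; exact: FG.
by apply: IH => i hi; apply: FG; exact: leqW.
Qed.

Lemma bern_lin N F G (a b : R) x :
  (bern N (fun i => a * F i + b * G i)).[x] = a * (bern N F).[x] + b * (bern N G).[x].
Proof.
elim: N F G => [|N IH] F G; first by rewrite !hornerE.
by rewrite !bernS (IH (F \o succn) (G \o succn)) IH; ring.
Qed.

Lemma bern_cst N (c : R) x : (bern N (fun=> c)).[x] = c.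
Proof. by elim: N => [|N IH]; rewrite ?bernS ?IH ?hornerE //; field. Qed.

(** Variance of the binomial law, [N p (1 - p)] with [p = (1 + x) / 2], plus the squared bias. The
    centre [c] is arbitrary because the induction shifts it by one. *)
Lemma bern_sqr N (c : R) x : (bern N (fun i => (i%:R - c) ^+ 2)).[x] =
  N%:R * (1 - x ^+ 2) / 4 + (N%:R * (1 + x) / 2 - c) ^+ 2.
Proof.
elim: N c => [|N IH] c; first by rewrite !hornerE; field.
rewrite bernS IH.
rewrite (_ : (fun i : nat => (i%:R - c) ^+ 2) \o succn = fun i => (i%:R - (c - 1)) ^+ 2).
  by rewrite IH -natr1; field.
by apply/funext => i /=; rewrite -natr1; ring.
Qed.

Definition bern_approx (f : R -> R) (N : nat) : {poly R} :=
  bern N (fun i => f (2 * i%:R / N%:R - 1)).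

Lemma node_itv i N : (i <= N)%N -> -1 <= (2 * i%:R / N%:R - 1 : R) <= 1.
Proof.
move=> iN; have i0 : 0 <= i%:R :> R by [].
have [->|N0] := posnP N; first by rewrite invr0 mulr0; lra.
have Np : 0 < N%:R :> R by rewrite ltr0n.
have h0 : 0 <= i%:R / N%:R :> R by rewrite divr_ge0.
have h1 : i%:R / N%:R <= 1 :> R by rewrite ler_pdivrMr // mul1r ler_nat.
by rewrite -mulrA; lra.
Qed.

Lemma bern_approx_le (f : R -> R) (M : R) N x : (forall y, -1 <= y <= 1 -> `|f y| <= M) ->
  -1 <= x <= 1 -> `|(bern_approx f N).[x]| <= M.
Proof.
move=> hM hx; rewrite ler_norml -{1}(bern_cst N (- M) x) -{2}(bern_cst N M x).
by apply/andP; split; apply: bern_le => // i hi; have := hM _ (node_itv hi); rewrite ler_norml => /andP[].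
Qed.

(** Chebyshev's argument: [|f y - f x| <= e / 2 + K * (y - x)^2] on the whole interval, the
    quadratic term covering the values [y] at distance at least [d]. Positivity of [bern] transports
    this inequality, and the variance is of order [1 / N]. Pointwise convergence is enough for the
    dominated convergence that follows. *)
Lemma bern_approx_cvg (f : R -> R) (M : R) x : (forall y, -1 <= y <= 1 -> `|f y| <= M) ->
  {for x, continuous f} -> -1 <= x <= 1 -> (bern_approx f N).[x] @[N --> \oo] --> f x.
Proof.
move=> hM cf hx; apply/cvgrPdist_le => e e0.
have M0 : 0 <= M by apply: le_trans (hM x hx).
have /cvgrPdist_le /(_ (e / 2)) := cf; move=> /(_ _)/wrap[]; first by rewrite divr_gt0.
move=> [d /= d0 hd].
pose K := 2 * M / d ^+ 2.
have K0 : 0 <= K by rewrite /K divr_ge0 // ?sqr_ge0 // mulr_ge0.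
near=> N.
have N0 : 0 < N%:R :> R by rewrite ltr0n; near: N; exact: nbhs_infty_gt.
have NK : 2 * K <= e * N%:R.
  by rewrite -ler_pdivrMl // mulrC; near: N; exact: nbhs_infty_ger.
pose G i : R := f (2 * i%:R / N%:R - 1).
pose S i : R := (i%:R - N%:R * (1 + x) / 2) ^+ 2.
pose U i : R := (f x + e / 2) * 1 + (K * 4 / N%:R ^+ 2) * S i.
pose L i : R := (f x - e / 2) * 1 + (- (K * 4 / N%:R ^+ 2)) * S i.
have SE i : K * 4 / N%:R ^+ 2 * S i = K * (2 * i%:R / N%:R - 1 - x) ^+ 2.
  by rewrite /S; field; lra.
have key i : (i <= N)%N -> L i <= G i /\ G i <= U i.
  move=> iN; rewrite /L /U mulNr SE !mulr1 /G.
  have := hM _ (node_itv iN); have := hM _ hx; move: (node_itv iN).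
  move: (2 * i%:R / N%:R - 1) => y hy fx fy.
  have [yx|yx] := ltP `|x - y| d.
    have := hd y yx; have : 0 <= K * (y - x) ^+ 2 by rewrite mulr_ge0 ?sqr_ge0.
    by rewrite ler_norml; lra.
  have d2 : d ^+ 2 <= (y - x) ^+ 2.
    by rewrite -[leRHS]real_normK ?num_real // distrC ler_sqr ?nnegrE // ltW.
  have : 2 * M <= K * (y - x) ^+ 2.
    rewrite /K mulrAC ler_pdivlMr ?exprn_gt0 //; apply: ler_wpM2l => //; lra.
  by move: fx fy; rewrite !ler_norml; lra.
have hU : (bern N G).[x] <= (bern N U).[x] by apply: bern_le => // i /key[].
have hL : (bern N L).[x] <= (bern N G).[x] by apply: bern_le => // i /key[].
have sm : K * 4 / N%:R ^+ 2 * (N%:R * (1 - x ^+ 2) / 4) <= e / 2.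
  rewrite (_ : _ * _ = K * (1 - x ^+ 2) / N%:R); last by field; lra.
  rewrite ler_pdivrMr //; have : K * (1 - x ^+ 2) <= K * 1 by apply: ler_wpM2l => //; nra.
  by lra.
move: hU hL; rewrite /U /L !(bern_lin N (fun=> 1)) !bern_cst /S bern_sqr subrr expr0n addr0.
rewrite mulNr !mulr1 -/(bern_approx f N).
by rewrite ler_norml; move: sm; move: (K * 4 / _ * _) => z; lra.
Unshelve. all: by end_near.
Qed.

End bernstein.

(** * Zonal means as integrals over the polar angle *)

Section zonal_int.
Variables (R : realType) (m : nat) (sigma : probability (borel_rV R m.+2) R).
Hypothesis hsigma : uniform_sphere sigma.
Variable e : 'rV[R]_m.+2.
Hypothesis Se : sphere e.
Local Notation E := (smean sigma).
Implicit Types phi : R -> R.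

(** Divergence theorem for the tangent field [phi (w.e) * Pperp w e]. *)
Lemma zonal_ibp phi phi1 :
  (forall s : R, -1 <= s <= 1 -> is_derive s 1 phi (phi1 s)) ->
  (forall s : R, -1 <= s <= 1 -> {for s, continuous phi1}) ->
  E (fun w => phi1 (dotp w e) * (1 - dotp w e ^+ 2)) =
  (m.+2%:R - 1) * E (fun w => dotp w e * phi (dotp w e)).
Proof.
move=> d c; have [hphi gphi] := sC1_zonal Se d c.
have S1 := (sphereE e).1 Se.
have dphi : sdiff (fun w => phi (dotp w e)) by case: hphi.
have b1 : bmeas (fun w => dotp w e * phi (dotp w e)).
  by apply: bmeasM; [exact: bmeas_dotpl|exact: sdiff_bmeas].
have b2 : bmeas (fun w => phi1 (dotp w e) * (1 - dotp w e ^+ 2)).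
  apply: bmeasM.
    apply: scont_bmeas => w Sw.
    apply: (@cvg_comp _ _ _ (fun u => dotp (unitv u) e) phi1 (nbhs w) (nbhs (dotp w e))).
      exact: (sdiff_scont (sdiff_dotp e) Sw).
    by apply: c; exact: dotp_itv.
  by apply: bmeasB; [exact: bmeas_cst|apply: bmeasM; exact: bmeas_dotpl].
have := @smean_sph_div _ _ _ hsigma (fun w => phi (dotp w e) *: Pperp w e).
move=> /(_ _ _)/wrap[].
- by move=> i; apply: sC1_scale_Pperp.
- by move=> w Sw; rewrite dotpZr Pperp_tangent // mulr0.
rewrite (@eq_smean _ _ _ _ (fun w => phi1 (dotp w e) * (1 - dotp w e ^+ 2)
  - (m.+2%:R - 1) * (dotp w e * phi (dotp w e)))).
  by rewrite smeanB ?smeanZ //; [move/eqP; rewrite subr_eq0 => /eqP|exact: bmeasZ].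
move=> w Sw; rewrite sph_divZ //; last by move=> i; exact: sdiff_Pperp.
rewrite sph_div_Pperp // gphi // dotpZl /Pperp !dotpBl !dotpBr !dotpZl !dotpZr.
by rewrite (dotpC e w) S1 ((sphereE w).1 Sw); ring.
Qed.

Definition sin_mean phi : R := int0pi (fun th : R => phi (cos th) * sin th ^+ m).

Lemma continuous_cosX_sinX i j : continuous (fun x : R => cos x ^+ i * sin x ^+ j).
Proof.
by move=> x; apply: is_d_continuous (is_dM (is_dX i (is_derive_cos x)) (is_dX j (is_derive_sin x))).
Qed.

Lemma continuous_phi_cos phi j : (forall s : R, -1 <= s <= 1 -> {for s, continuous phi}) ->
  continuous (fun x : R => phi (cos x) * sin x ^+ j).
Proof.
move=> c x; apply: (@cvgM _ _ (nbhs x) _ (fun x => phi (cos x)) (fun x => sin x ^+ j)).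
  apply: (@cvg_comp _ _ _ (@cos R) phi (nbhs x) (nbhs (cos x))); first exact: continuous_cos.
  by apply: c; rewrite cos_geN1 cos_le1.
exact: is_d_continuous (is_dX j (is_derive_sin x)).
Qed.

Lemma continuous_itv_X k (s : R) : -1 <= s <= 1 -> {for s, continuous (fun s : R => s ^+ k)}.
Proof. by move=> _; exact: exprn_continuous. Qed.

(** Integral over [[0, pi]] of the derivative of [cos ^ k * sin ^ (m + 1)], whose boundary values
    vanish. For [k = 0] the truncated exponent [k.-1] has coefficient 0. *)
Lemma sin_mean_mom k : (m.+1%:R + k%:R) * sin_mean (fun s => s ^+ k.+1) =
  k%:R * sin_mean (fun s => s ^+ k.-1).
Proof.
have d (x : R) := is_dM (is_dX k (is_derive_cos x)) (is_dX m.+1 (is_derive_sin x)).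
pose f (x : R) : R := (m.+1%:R + k%:R) * (cos x ^+ k.+1 * sin x ^+ m)
  + (- k%:R) * (cos x ^+ k.-1 * sin x ^+ m).
have c1 := @continuous_cosX_sinX k.+1 m; have c2 := @continuous_cosX_sinX k.-1 m.
have cf : continuous f.
  by move=> x; apply: cvgD; (apply: cvgM; [exact: cvg_cst|]); [exact: c1|exact: c2].
have fE x : k%:R * cos x ^+ k.-1 * - sin x * sin x ^+ m.+1
    + cos x ^+ k * (m.+1%:R * sin x ^+ m.+1.-1 * cos x) = f x.
  rewrite /f [m.+1.-1]/=; have := cos2Dsin2 x; move: (cos x) (sin x) => c s cs.
  rewrite (_ : k%:R * _ * - s * _ = - (k%:R * c ^+ k.-1 * s ^+ m * s ^+ 2)); last by rewrite !exprS; ring.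
  rewrite (_ : s ^+ 2 = 1 - c ^+ 2); last by rewrite -cs; ring.
  by case: k {d f c1 c2 cf} => [|k]; [rewrite !mul0r exprS; ring|rewrite /= !exprS; ring].
have df (x : R) : is_derive x 1 (fun y : R => cos y ^+ k * sin y ^+ m.+1) (f x) by rewrite -fE; exact: d.
have := int0pi_FTC df cf; rewrite sinpi sin0 expr0n /= !mulr0 subrr.
rewrite /f int0piD ?int0piZ //; last 2 first.
- by move=> x; apply: cvgM; [exact: cvg_cst|exact: c1].
- by move=> x; apply: cvgM; [exact: cvg_cst|exact: c2].
by rewrite mulNr => /eqP; rewrite subr_eq0 => /eqP.
Qed.

Lemma bmeas_expr k : bmeas (fun w => dotp w e ^+ k).
Proof.
elim: k => [|k IH]; first exact: bmeas_cst.
by apply: bmeas_ext (bmeasM (bmeas_dotpl e) IH) => w _; rewrite exprS.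
Qed.

Lemma zonal_mom k : (m.+1%:R + k%:R) * E (fun w => dotp w e ^+ k.+1) =
  k%:R * E (fun w => dotp w e ^+ k.-1).
Proof.
have := @zonal_ibp (fun s => s ^+ k) (fun s => k%:R * s ^+ k.-1) _ _.
move=> /(_ _ _)/wrap[].
- by move=> s _; apply: is_d_eq (is_dX k (is_derive_id s 1)) _; rewrite mulr1.
- by move=> s hs; apply: cvgM; [exact: cvg_cst|exact: continuous_itv_X].
rewrite (@eq_smean _ _ _ _ (fun w => k%:R * dotp w e ^+ k.-1 - k%:R * dotp w e ^+ k.+1)); last first.
  by move=> w _; case: k => [|k]; [rewrite !mul0r subrr|rewrite /= !exprS; ring].
rewrite smeanB ?smeanZ //; try (by apply: bmeasZ; exact: bmeas_expr); try exact: bmeas_expr.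
rewrite (@eq_smean _ _ _ (fun w => dotp w e * _) (fun w => dotp w e ^+ k.+1)); last first.
  by move=> w _; rewrite exprS.
rewrite -[m.+2%:R]natr1 addrK mulrDl => <-; ring.
Qed.

(** Both families of moments obey the same recursion of step two. They agree for [k = 0], and for
    [k = 1] the recursion makes both vanish; two consecutive indices are carried along. *)
Lemma smean_zonal_mom_int k : E (fun w => dotp w e ^+ k) * sin_mean (fun=> 1) = sin_mean (fun s => s ^+ k).
Proof.
suff : E (fun w => dotp w e ^+ k) * sin_mean (fun=> 1) = sin_mean (fun s => s ^+ k) /\
  E (fun w => dotp w e ^+ k.+1) * sin_mean (fun=> 1) = sin_mean (fun s => s ^+ k.+1) by case.
have pos j : m.+1%:R + j%:R != 0 :> R by rewrite -natrD pnatr_eq0.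
elim: k => [|k [IH1 IH2]].
  split; first by rewrite (smean_cst hsigma 1) mul1r.
  apply: (mulfI (pos 0%N)); rewrite mulrA zonal_mom sin_mean_mom; ring.
split=> //; apply: (mulfI (pos k.+1)).
by rewrite mulrA zonal_mom sin_mean_mom /= -IH1 mulrA.
Qed.

Lemma bmeas_horner (p : {poly R}) : bmeas (fun w => p.[dotp w e]).
Proof.
elim/poly_ind: p => [|p c IH].
  by apply: (@bmeas_ext _ _ (fun=> 0)); [move=> w _; rewrite horner0|exact: bmeas_cst].
apply: (@bmeas_ext _ _ (fun w => p.[dotp w e] * dotp w e + c)); first by move=> w _; rewrite !hornerE.
by apply: bmeasD; [apply: bmeasM => //; exact: bmeas_dotpl|exact: bmeas_cst].
Qed.

Lemma smean_zonal_poly_int (p : {poly R}) :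
  E (fun w => p.[dotp w e]) * sin_mean (fun=> 1) = sin_mean (fun s => p.[s]).
Proof.
(* The extra power of [s] makes the induction on [p = q * 'X + c] go through: the factor ['X] moves
   into it. *)
suff : forall k,
    E (fun w => p.[dotp w e] * dotp w e ^+ k) * sin_mean (fun=> 1) = sin_mean (fun s => p.[s] * s ^+ k).
  move=> /(_ 0%N); rewrite /sin_mean; under [in RHS]eq_fun do rewrite mulr1.
  by under eq_smean do rewrite mulr1.
elim/poly_ind: p => [|p c IH] k.
  rewrite (@eq_smean _ _ _ _ (fun=> 0)); last by move=> w _; rewrite horner0 mul0r.
  rewrite smean_cst // mul0r /sin_mean.
  rewrite [X in int0pi X](_ : _ = fun=> 0 * 1); last by apply/funext => x; rewrite horner0 !mul0r.
  by rewrite int0piZ ?mul0r // => x; exact: cvg_cst.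
have hE (s : R) : (p * 'X + c%:P).[s] * s ^+ k = p.[s] * s ^+ k.+1 + c * s ^+ k.
  by rewrite !hornerE exprS; ring.
rewrite (@eq_smean _ _ _ _ (fun w => p.[dotp w e] * dotp w e ^+ k.+1 + c * dotp w e ^+ k)); last first.
  by move=> w _; exact: hE.
have bk := bmeas_expr; rewrite smeanD //; last 2 first.
- by apply: bmeasM => //; exact: bmeas_horner.
- exact: bmeasZ.
rewrite smeanZ // mulrDl IH -mulrA smean_zonal_mom_int /sin_mean -int0piZ; last exact: continuous_cosX_sinX.
rewrite -int0piD.
- by congr int0pi; apply/funext => x; rewrite hE; ring.
- apply: (@continuous_phi_cos (fun s => p.[s] * s ^+ k.+1)) => s hs.
  by apply: cvgM; [exact: continuous_horner|exact: continuous_itv_X].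
- by move=> x; apply: cvgM; [exact: cvg_cst|exact: continuous_cosX_sinX].
Qed.

Lemma smean_zonal_int phi : (forall s : R, -1 <= s <= 1 -> {for s, continuous phi}) ->
  E (fun w => phi (dotp w e)) * sin_mean (fun=> 1) = sin_mean phi.
Proof.
move=> c; have [M _ hM] := segment_bounded c.
have ch (p : {poly R}) (s : R) : -1 <= s <= 1 -> {for s, continuous (horner p)}.
  by move=> _; exact: continuous_horner.
have l1 : (fun N => E (fun w => (bern_approx phi N).[dotp w e])) @ \oo --> E (fun w => phi (dotp w e)).
  apply: (@smean_cvg _ _ _ hsigma (fun N w => (bern_approx phi N).[dotp w e]) _ M).
  - by move=> N; exact: bmeas_horner.
  - by move=> N w Sw; apply: bern_approx_le => //; exact: dotp_itv.
  - by move=> w Sw; have hs := dotp_itv Sw Se; exact: (bern_approx_cvg hM (c _ hs) hs).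
have l2 : (fun N => sin_mean (fun s => (bern_approx phi N).[s])) @ \oo --> sin_mean phi.
  apply: (@int0pi_cvg _ _ _ (M * 1)).
  - by move=> N; apply: continuous_phi_cos; exact: ch.
  - exact: continuous_phi_cos.
  - move=> N x; rewrite normrM; apply: ler_pM => //.
      by apply: bern_approx_le => //; rewrite cos_geN1 cos_le1.
    by rewrite normrX exprn_ile1 // ler_norml sin_geN1 sin_le1.
  - move=> x; apply: cvgM; last exact: cvg_cst.
    have hs : -1 <= cos x <= 1 by rewrite cos_geN1 cos_le1.
    exact: (bern_approx_cvg hM (c _ hs) hs).
have l3 : (fun N => sin_mean (fun s => (bern_approx phi N).[s])) @ \oo -->
    E (fun w => phi (dotp w e)) * sin_mean (fun=> 1).
  under eq_fun do rewrite -smean_zonal_poly_int.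
  by apply: cvgM => //; exact: cvg_cst.
have := cvg_lim (@norm_hausdorff _ _) l2; rewrite (cvg_lim (@norm_hausdorff _ _) l3).
exact.
Qed.

End zonal_int.

(** Wallis recursion, with the initial values [pi] and 2. *)
Lemma wallis_gt0 (R : realType) m : 0 < sin_mean m (fun=> 1 : R).
Proof.
pose W j := int0pi (fun x : R => sin x ^+ j).
have c j : continuous (fun x : R => sin x ^+ j).
  by move=> x; apply: is_d_continuous (is_dX j (is_derive_sin x)).
have WS j : j.+2%:R * W j.+2 = j.+1%:R * W j.
  have d (x : R) := is_dM (is_derive_cos x) (is_dX j.+1 (is_derive_sin x)).
  pose f (x : R) : R := j.+1%:R * sin x ^+ j + (- j.+2%:R) * sin x ^+ j.+2.
  have fE x : - sin x * sin x ^+ j.+1 + cos x * (j.+1%:R * sin x ^+ j.+1.-1 * cos x) = f x.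
    rewrite /f [j.+1.-1]/=; have := cos2Dsin2 x; move: (cos x) (sin x) => c' s cs.
    rewrite (_ : c' * _ = j.+1%:R * s ^+ j * c' ^+ 2); last by ring.
    rewrite (_ : c' ^+ 2 = 1 - s ^+ 2); last by rewrite -cs; ring.
    by rewrite -[j.+2%:R]natr1 !exprS; ring.
  have cf : continuous f.
    by move=> x; apply: cvgD; (apply: cvgM; [exact: cvg_cst|exact: c]).
  have df (x : R) : is_derive x 1 (fun y : R => cos y * sin y ^+ j.+1) (f x) by rewrite -fE; exact: d.
  have := int0pi_FTC df cf; rewrite sinpi sin0 expr0n /= !mulr0 subrr.
  rewrite /f int0piD ?int0piZ //; try (by move=> x; apply: cvgM; [exact: cvg_cst|exact: c]).
  by rewrite mulNr => /eqP; rewrite subr_eq0 => /eqP ->.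
have W0 : W 0%N = pi.
  rewrite /W (@int0pi_FTC _ (fun x => x) (fun x => sin x ^+ 0)) ?subr0 //.
have W1 : W 1%N = 2.
  have d (x : R) : is_derive x 1 (fun x : R => - cos x) (sin x ^+ 1).
    by apply: is_d_eq (is_dN (is_derive_cos x)) _; rewrite opprK expr1.
  by rewrite /W (int0pi_FTC d (c 1%N)) cospi cos0; ring.
suff : 0 < W m /\ 0 < W m.+1.
  by move=> [+ _]; rewrite /sin_mean /W; under [in X in _ -> X]eq_fun do rewrite mul1r.
elim: m => [|j [h1 h2]]; first by rewrite W0 W1 pi_gt0.
split=> //; have : 0 < j.+2%:R * W j.+2 by rewrite WS mulr_gt0.
by rewrite pmulr_rgt0.
Qed.

(** * The coefficients [c] and [ctilde] as zonal means *)

Section coefficients.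
Variables (R : realType) (m : nat) (sigma : probability (borel_rV R m.+2) R).
Hypothesis hsigma : uniform_sphere sigma.
Variable e : 'rV[R]_m.+2.
Hypothesis Se : sphere e.
Local Notation E := (smean sigma).
Local Notation W := (sin_mean m (fun=> 1 : R)).

Lemma continuous_expM (k s : R) : {for s, continuous (fun s : R => expR (k * s))}.
Proof. exact: is_d_continuous (is_d_comp (is_dZ k (is_derive_id s 1)) (is_derive_expR _)). Qed.

Lemma bmeas_expM (k : R) : bmeas (fun w => expR (k * dotp w e)).
Proof.
apply: sdiff_bmeas; apply: (@sdiff_comp _ _ (fun w => dotp w e) (fun s => expR (k * s))).
  exact: sdiff_dotp.
by move=> w Sw; have [] := is_d_comp (is_dZ k (is_derive_id (dotp w e) 1)) (is_derive_expR _).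
Qed.

Lemma expM_ge (k s : R) : -1 <= s <= 1 -> expR (- `|k|) <= expR (k * s).
Proof.
rewrite -ler_norml => hs; rewrite ler_expR; apply: lerNnormlW; rewrite normrM.
by rewrite ler_piMr.
Qed.

Lemma smean_exp_gt0 (k : R) : 0 < E (fun w => expR (k * dotp w e)).
Proof.
apply: lt_le_trans (expR_gt0 (- `|k|)) _.
rewrite -[leLHS](smean_cst hsigma); apply: le_smean => //; [exact: bmeas_cst|exact: bmeas_expM|].
by move=> w Sw; apply: expM_ge; exact: dotp_itv.
Qed.

Lemma c_ofE (k : R) : c_of m.+2 k * E (fun w => expR (k * dotp w e)) =
  E (fun w => dotp w e * expR (k * dotp w e)).
Proof.
have h1 : E (fun w => expR (k * dotp w e)) * W = sin_mean m (fun s => expR (k * s)).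
  by apply: (smean_zonal_int hsigma Se (phi := fun s => expR (k * s))) => s _; exact: continuous_expM.
have h2 : E (fun w => dotp w e * expR (k * dotp w e)) * W = sin_mean m (fun s => s * expR (k * s)).
  apply: (smean_zonal_int hsigma Se (phi := fun s => s * expR (k * s))) => s _.
  by apply: (@cvgM _ _ (nbhs s) _ id); [exact: cvg_id|exact: continuous_expM].
have W0 := wallis_gt0 R m; have E0 := smean_exp_gt0 k.
have -> : c_of m.+2 k = sin_mean m (fun s => s * expR (k * s)) / sin_mean m (fun s => expR (k * s)).
  by rewrite /c_of !subSS subn0.
rewrite -h2 -h1.
move: E0 W0; move: (E _) (E _) (sin_mean _ _) => x y z y0 z0; field.
by rewrite !gt_eqF.
Qed.

(** [F] may jump at the poles, as [h_of g] does. Being bounded inside, its product with [1 - s^2],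
    set to 0 at the poles, is continuous on the closed interval, and [smean_zonal_int] applies. The
    weight supplies the two extra powers of [sin]. *)
Lemma smean_zonal_weighted (F : R -> R) (M : R) :
  (forall s : R, -1 < s < 1 -> {for s, continuous F}) ->
  (forall s : R, -1 < s < 1 -> `|F s| <= M) ->
  E (fun w => F (dotp w e) * (1 - dotp w e ^+ 2)) * W = int0pi (fun th : R => F (cos th) * sin th ^+ m.+2).
Proof.
move=> cF hM.
pose phi (s : R) := if -1 < s < 1 then F s * (1 - s ^+ 2) else 0.
have phiE (s : R) : -1 <= s <= 1 -> phi s = F s * (1 - s ^+ 2).
  rewrite /phi; case: ifP => // h hs; have -> : s ^+ 2 = 1; last by rewrite subrr mulr0.
  have : `|s| = 1 by apply/eqP; rewrite eq_le ler_norml hs /= leNgt ltr_norml h.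
  by rewrite -[s ^+ 2]real_normK ?num_real // => ->; rewrite expr1n.
have M0 : 0 <= M by apply: le_trans (hM 0 _); rewrite ?normr_ge0 //; lra.
have phi_le (s : R) : `|phi s| <= M * `|1 - s ^+ 2|.
  rewrite /phi; case: ifP => h; last by rewrite normr0 mulr_ge0.
  by rewrite normrM; apply: ler_wpM2r => //; exact: hM.
have c2 (s : R) : {for s, continuous (fun s : R => 1 - s ^+ 2)}.
  by apply: cvgB; [exact: cvg_cst|exact: exprn_continuous].
have cphi (s : R) : -1 <= s <= 1 -> {for s, continuous phi}.
  move=> hs; have [h|h] := boolP (-1 < s < 1).
    have near_eq : \forall y \near s, F y * (1 - y ^+ 2) = phi y.
      have hI : s \in `]-1, 1[ by rewrite in_itv.
      apply: filterS (near_in_itvoo hI) => y.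
      by rewrite in_itv /= /phi => ->.
    rewrite /prop_for /continuous_at (phiE s hs); apply: cvg_trans (cvgM (cF s h) (c2 s)).
    exact: near_eq_cvg near_eq.
  have p0 : phi s = 0 by rewrite /phi (negbTE h).
  have s0 : 1 - s ^+ 2 = 0.
    have : `|s| = 1 by apply/eqP; rewrite eq_le ler_norml hs /= leNgt ltr_norml.
    by rewrite -[s ^+ 2]real_normK ?num_real // => ->; rewrite expr1n subrr.
  have : (fun y => `|phi y|) @ nbhs s --> (0 : R).
    apply: (squeeze_cvgr (f := fun=> 0) (h := fun y => M * `|1 - y ^+ 2|)).
    - by apply: nearW => y; rewrite normr_ge0 phi_le.
    - exact: cvg_cst.
    - rewrite -[X in _ --> X](mulr0 M) -(normr0 R) -s0.
      by apply: cvgM; [exact: cvg_cst|apply: cvg_norm; exact: c2].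
  by move/norm_cvg0P; rewrite /prop_for /continuous_at p0.
have := smean_zonal_int hsigma Se cphi.
rewrite (@eq_smean _ _ _ _ (fun w => F (dotp w e) * (1 - dotp w e ^+ 2))); last first.
  by move=> w Sw; rewrite phiE //; exact: dotp_itv.
move=> ->; congr int0pi; apply/funext => th.
rewrite phiE ?cos_geN1 ?cos_le1 // -mulrA; congr (_ * _).
by rewrite -[1](cos2Dsin2 th) addrC addKr -exprD add2n.
Qed.

Lemma smean_sin2 : (m%:R + 2) * E (fun w => 1 - dotp w e ^+ 2) = m%:R + 1.
Proof.
have h := zonal_mom hsigma Se 1; rewrite /= in h.
have e1 : E (fun w => dotp w e ^+ 0) = 1 by rewrite (smean_cst hsigma 1).
have b2 : bmeas (fun w => dotp w e ^+ 2) by exact: bmeas_expr.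
rewrite smeanB //; last exact: bmeas_cst.
rewrite smean_cst // mulrBr mulr1; move: h; rewrite e1 -[m.+1%:R]natr1.
by move: (E _) => x; lra.
Qed.

Variables (k : R) (g : R -> R).
Hypothesis k0 : 0 < k.
Hypothesis hg : gci_profile m.+2 k g.
Local Notation h := (h_of g).

Let bw : bmeas (fun w => 1 - dotp w e ^+ 2).
Proof. by apply: bmeasB; [exact: bmeas_cst|exact: bmeas_expr]. Qed.

Lemma bmeas_hexp : bmeas (fun w => h (dotp w e) * expR (k * dotp w e)).
Proof. by apply: bmeasM; [exact: (bmeas_h hg Se)|exact: bmeas_expM]. Qed.

Lemma smean_hexp_gt0 : 0 < E (fun w => h (dotp w e) * expR (k * dotp w e) * (1 - dotp w e ^+ 2)).
Proof.
have m0 : 0 <= m%:R :> R by [].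
have k1 : 0 < k by [].
pose c0 := (m%:R + 2 + k)^-1 * expR (- `|k|).
have c00 : 0 < c0 by apply: mulr_gt0; [rewrite invr_gt0; lra|exact: expR_gt0].
have s0 : 0 < E (fun w => 1 - dotp w e ^+ 2).
  by have := smean_sin2; move: (E _) => x hx; rewrite -(pmulr_rgt0 _ (_ : 0 < m%:R + 2)); lra.
apply: (@lt_le_trans _ _ (c0 * E (fun w => 1 - dotp w e ^+ 2))); first exact: mulr_gt0.
rewrite -smeanZ //; apply: le_smean => //.
- exact: bmeasZ.
- by apply: bmeasM => //; exact: bmeas_hexp.
move=> w Sw; have hs := dotp_itv Sw Se; move: (dotp w e) hs => s hs.
have [h1|h1] := boolP (-1 < s < 1).
  apply: ler_wpM2r; first by nra.
  rewrite /c0; apply: ler_pM; rewrite ?expR_ge0 //; last exact: expM_ge.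
    by rewrite invr_ge0; lra.
  exact: (h_of_ge hg).
have : `|s| = 1 by apply/eqP; rewrite eq_le ler_norml hs /= leNgt ltr_norml.
by rewrite -[s ^+ 2]real_normK ?num_real // => ->; rewrite expr1n subrr !mulr0.
Qed.

Lemma ctilde_ofE : ctilde_of m.+2 k g *
   E (fun w => h (dotp w e) * expR (k * dotp w e) * (1 - dotp w e ^+ 2)) =
  E (fun w => h (dotp w e) * expR (k * dotp w e) * dotp w e * (1 - dotp w e ^+ 2)).
Proof.
have [M M0 hM] := prof_h_bounds hg.
have cF (s : R) : -1 < s < 1 -> {for s, continuous (fun s => h s * expR (k * s))}.
  move=> hs; apply: (@cvgM _ _ (nbhs s)); last exact: continuous_expM.
  exact: is_d_continuous (h_of_derive hg hs).
have bF (s : R) : -1 < s < 1 -> `|h s * expR (k * s)| <= M * expR k.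
  move=> hs; rewrite normrM; apply: ler_pM => //; first by apply: (hM s).1; lra.
  by rewrite ger0_norm ?expR_ge0 // ler_expR -{2}[k]mulr1; apply: ler_wpM2l; [exact: ltW|lra].
have h1 := smean_zonal_weighted cF bF.
have h2 := @smean_zonal_weighted (fun s => h s * expR (k * s) * s) (M * expR k * 1).
have {}h2 : E (fun w => h (dotp w e) * expR (k * dotp w e) * dotp w e * (1 - dotp w e ^+ 2)) * W =
    int0pi (fun th : R => h (cos th) * expR (k * cos th) * cos th * sin th ^+ m.+2).
  apply: h2 => s hs; first by apply: (@cvgM _ _ (nbhs s) _ (fun s => h s * expR (k * s)) id); [exact: cF|exact: cvg_id].
  by rewrite normrM; apply: ler_pM => //; [exact: bF|rewrite ler_norml; lra].
have W0 := wallis_gt0 R m; have E0 := smean_hexp_gt0.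
have -> : ctilde_of m.+2 k g =
    int0pi (fun th : R => h (cos th) * expR (k * cos th) * cos th * sin th ^+ m.+2) /
    int0pi (fun th : R => h (cos th) * expR (k * cos th) * sin th ^+ m.+2).
  by rewrite /ctilde_of; congr (int0pi _ / _); apply/funext => th; ring.
rewrite -h1 -h2; move: E0 W0; move: (E _) (E _) (sin_mean _ _) => x y z y0 z0; field.
by rewrite !gt_eqF.
Qed.

End coefficients.

(** * The compatibility equation *)

Section c_of_derivative.
Variables (R : realType) (m : nat) (sigma : probability (borel_rV R m.+2) R).
Hypothesis hsigma : uniform_sphere sigma.
Local Notation E := (smean sigma).
Local Notation e := (ei R (ord0 : 'I_m.+2)).
Local Notation c := (c_of m.+2).
Implicit Types k : R.

Lemma sphere_ei n (i : 'I_n) : sphere (ei R i).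
Proof. by apply/sphereE; rewrite dotp_ei /ei mxE !eqxx. Qed.
Let Se := sphere_ei (ord0 : 'I_m.+2).

Lemma is_derive_exp_mean p k :
  is_derive k 1 (fun k => E (fun w => dotp w e ^+ p * expR (k * dotp w e)))
    (E (fun w => dotp w e ^+ p.+1 * expR (k * dotp w e))).
Proof.
have d (w : 'rV[R]_m.+2) (h : R) : is_derive h 1 (fun k => dotp w e ^+ p * expR (k * dotp w e))
    (dotp w e ^+ p.+1 * expR (h * dotp w e)).
  have h1 := is_d_comp (is_dM (is_derive_id h 1) (is_dcst (dotp w e) h 1)) (is_derive_expR _).
  apply: is_d_eq (is_dM (is_dcst (dotp w e ^+ p) h 1) h1) _.
  by rewrite /= exprS; ring.
apply: (@is_derive_smean _ _ _ hsigma (fun k w => dotp w e ^+ p * expR (k * dotp w e)) _ _ 1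
  (expR (`|k| + 1)) ltr01).
- by move=> h _; apply: bmeasM; [exact: bmeas_expr|exact: bmeas_expM].
- move=> h w hk Sw; have [d1 d2] := d w h; split=> //; rewrite d2 normrM.
  have ns := dotp_norm_le1 Sw Se.
  rewrite -[leRHS]mul1r; apply: ler_pM => //; first by rewrite normrX exprn_ile1.
  rewrite ger0_norm ?expR_ge0 // ler_expR; apply: le_trans (ler_norm _) _; rewrite normrM.
  have : `|h| <= `|k| + 1.
    by move: (ler_normD (h - k) k); rewrite subrK; lra.
  have := normr_ge0 h; have := normr_ge0 (dotp w e); nra.
- by move=> w _; have [] := d w k.
Qed.

Lemma exp_mean_ibp k : k * E (fun w => expR (k * dotp w e) * (1 - dotp w e ^+ 2)) =
  (m%:R + 1) * E (fun w => dotp w e * expR (k * dotp w e)).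
Proof.
have := zonal_ibp hsigma Se (phi := fun s => expR (k * s)) (phi1 := fun s => k * expR (k * s)).
move=> /(_ _ _)/wrap[].
- move=> s _; apply: is_d_eq (is_d_comp (is_dZ k (is_derive_id s 1)) (is_derive_expR _)) _.
  by rewrite mulr1 mulrC.
- by move=> s _; apply: cvgM; [exact: cvg_cst|exact: continuous_expM].
rewrite -[m.+2%:R]natr1 addrK natr1 => <-; rewrite -smeanZ //.
  by apply: eq_smean => w _; rewrite mulrA.
apply: bmeasM; first exact: bmeas_expM.
by apply: bmeasB; [exact: bmeas_cst|exact: bmeas_expr].
Qed.

Lemma c_of_gt0 k : 0 < k -> 0 < c k.
Proof.
move=> k0; have E0 := smean_exp_gt0 hsigma Se k.
rewrite -(pmulr_lgt0 _ E0) (c_ofE hsigma Se).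
have m0 : 0 <= m%:R :> R by [].
rewrite -(pmulr_rgt0 _ (_ : 0 < m%:R + 1)) -?exp_mean_ibp; last by lra.
apply: mulr_gt0 => //.
have b2 : bmeas (fun w => 1 - dotp w e ^+ 2).
  by apply: bmeasB; [exact: bmeas_cst|exact: bmeas_expr].
apply: (@lt_le_trans _ _ (expR (- `|k|) * E (fun w => 1 - dotp w e ^+ 2))).
  apply: mulr_gt0; first exact: expR_gt0.
  by have := smean_sin2 hsigma Se; move: (E _) => x hx; rewrite -(pmulr_rgt0 _ (_ : 0 < m%:R + 2)); lra.
rewrite -smeanZ //; apply: le_smean => //; first exact: bmeasZ.
  by apply: bmeasM => //; exact: bmeas_expM.
move=> w Sw; have hs := dotp_itv Sw Se; apply: ler_wpM2r; first by nra.
exact: expM_ge.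
Qed.

(** [c = N / Z] where [Z] and [N] are the exponential moments of order 0 and 1. Then [Z' = N], and
    [N'] is the moment of order 2, which [exp_mean_ibp] expresses through [Z] and [N]: this closes
    the equation for [c]. *)
Lemma c_of_derive k : 0 < k -> is_derive k 1 c (1 - (m%:R + 1) * c k / k - c k ^+ 2).
Proof.
move=> k0; have E0 := smean_exp_gt0 hsigma Se k.
pose Z k := E (fun w => dotp w e ^+ 0 * expR (k * dotp w e)).
pose N k := E (fun w => dotp w e ^+ 1 * expR (k * dotp w e)).
have ZE k' : Z k' = E (fun w => expR (k' * dotp w e)).
  by apply: eq_smean => w _; rewrite mul1r.
have Z0 k' : 0 < Z k' by rewrite ZE; exact: smean_exp_gt0.
have cE : c = fun k => N k / Z k.
  apply/funext => k'; have := c_ofE hsigma Se k'; rewrite -ZE => h.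
  rewrite /N; under eq_smean do rewrite expr1.
  by rewrite -h mulfK // gt_eqF.
have dZ : is_derive k 1 Z (N k) := is_derive_exp_mean 0 k.
have dN := is_derive_exp_mean 1 k; rewrite -/N in dN.
set N2 := E _ in dN.
have N2E : N2 = Z k - (m%:R + 1) * N k / k.
  have -> : (m%:R + 1) * N k = k * (Z k - N2).
    rewrite /N; under eq_smean do rewrite expr1.
    rewrite -exp_mean_ibp; congr (_ * _); rewrite /Z /N2 -smeanB //.
    - by apply: eq_smean => w _; rewrite expr0; ring.
    - by apply: bmeasM; [exact: bmeas_expr|exact: bmeas_expM].
    - by apply: bmeasM; [exact: bmeas_expr|exact: bmeas_expM].
  by field; rewrite gt_eqF.
have Zn : Z k != 0 by rewrite gt_eqF.
rewrite cE; apply: is_d_eq (is_dM dN (is_dV Zn dZ)) _.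
by rewrite N2E; move: (Z k) (N k) Zn => z y Zn; field; rewrite Zn gt_eqF.
Qed.

End c_of_derivative.

Section compatibility.
Variables (R : realType) (m : nat) (sigma : probability (borel_rV R m.+2) R).
Hypothesis hsigma : uniform_sphere sigma.
Variables (k j kap : R -> R) (I : set R).
Hypotheses (hj : forall r, 0 <= r -> j (k r) = r)
  (hj_diff : forall r, 0 < r -> derivable j (k r) 1)
  (hI : open I) (hkap_diff : forall r, I r -> derivable kap r 1)
  (hkap_pos : forall r, I r -> 0 < kap r)
  (hkap_dom : forall r, I r -> exists2 s, 0 <= s & k s = kap r)
  (hkap : forall r, I r -> j (kap r) / c_of m.+2 (kap r) = r).

Lemma compat_ge0 r : I r -> 0 <= r.
Proof.
move=> Ir; have [s s0 ks] := hkap_dom Ir; rewrite -(hkap Ir) -ks hj //.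
by rewrite divr_ge0 // ltW // (c_of_gt0 hsigma) // ks hkap_pos.
Qed.

(** Points of [I] are nonnegative and [I] is open, so it cannot contain 0. *)
Lemma compat_gt0 r : I r -> 0 < r.
Proof.
move=> Ir; rewrite lt_neqAle compat_ge0 // andbT; apply/eqP => r0.
have /nbhs_ballP[d /= d0 hd] := open_nbhs_nbhs (conj hI Ir).
have : I (- (d / 2)).
  by apply: hd; rewrite /ball /= -r0 sub0r opprK gtr0_norm; lra.
by move/compat_ge0; lra.
Qed.

Lemma compat_j_gt0 r : I r -> 0 < j (kap r).
Proof.
move=> Ir; have c0 := c_of_gt0 hsigma (hkap_pos Ir).
by have := compat_gt0 Ir; rewrite -{1}(hkap Ir) pmulr_lgt0 ?invr_gt0.
Qed.

Lemma compat_kj r : I r -> k (j (kap r)) = kap r.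
Proof. by move=> Ir; have [s s0 ks] := hkap_dom Ir; rewrite -ks hj. Qed.

Lemma compat_algebra (M j' k' c J K : R) : 0 < c -> 0 < J -> 0 < K ->
  (j' / c + J * (- (1 - (M + 1) * c / K - c ^+ 2) / c ^+ 2)) * k' = 1 ->
  k' * (M + 1 - K / c + K * c + K / J * j') = K / (J / c).
Proof.
move=> c0 J0 K0 e; rewrite -[RHS]mulr1 -[in RHS]e; field.
by rewrite !gt_eqF.
Qed.

(** Differentiate [j (kap y) / c (kap y) = y], valid on a neighbourhood of [r], and eliminate [c']
    by [c_of_derive]. As [K / r > 0], the second factor on the left is not 0; it becomes the
    denominator of the second form of [Theta]. *)
Lemma compat_derive r (c := c_of m.+2 (kap r)) (J := j (kap r)) (K := kap r) : I r ->
  derive1 kap r * (m%:R + 1 - K / c + K * c + K / J * derive1 j K) = K / r.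
Proof.
move=> Ir; have K0 : 0 < K := hkap_pos Ir; have c0 : 0 < c := c_of_gt0 hsigma K0.
have J0 : 0 < J := compat_j_gt0 Ir.
have rE : J / c = r := hkap Ir.
have dj : is_derive K 1 j (derive1 j K).
  apply: DeriveDef; last by rewrite derive1E.
  by rewrite /K -compat_kj //; exact: hj_diff.
have dc := c_of_derive hsigma K0.
have dk : is_derive r 1 kap (derive1 kap r).
  by apply: DeriveDef; [exact: hkap_diff|rewrite derive1E].
have c0' : c_of m.+2 K != 0 by rewrite gt_eqF.
have d1 := is_d_comp dk (is_dM dj (is_dV c0' dc)).
have near_eq : \forall y \near r, j (kap y) / c_of m.+2 (kap y) = y.
  by apply: filterS (open_nbhs_nbhs (conj hI Ir)) => y; exact: hkap.
have := is_d_val (near_eq_is_derive near_eq d1) (is_derive_id r 1).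
rewrite -/c -/J; move: (derive1 j K) (derive1 kap r) => j' k' e.
by rewrite -rE; exact: compat_algebra.
Qed.

Lemma ThetaE r (ct : R) (c := c_of m.+2 (kap r)) (J := j (kap r)) (K := kap r) : I r ->
  K^-1 + (ct - c) * (r / K) * derive1 kap r =
  (m.+2%:R - K / c + K * ct - 1 + K / J * derive1 j K) /
  (K * (m.+2%:R - K / c + K * c - 1 + K / J * derive1 j K)).
Proof.
move=> Ir; have h := compat_derive Ir; have K0 := hkap_pos Ir.
have r0 := compat_gt0 Ir; rewrite -/c -/J -/K in h.
have -> : m.+2%:R - K / c + K * ct - 1 + K / J * derive1 j K =
  (m%:R + 1 - K / c + K * c + K / J * derive1 j K) + K * (ct - c).
  by rewrite -addn2 natrD; ring.
have -> : m.+2%:R - K / c + K * c - 1 + K / J * derive1 j K =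
  (m%:R + 1 - K / c + K * c + K / J * derive1 j K).
  by rewrite -addn2 natrD; ring.
move: h; move: (_ + _ + _) (derive1 kap r) => D k' h.
have D0 : D != 0.
  apply: contraTneq isT => D0; move: h; rewrite D0 mulr0 => /esym/eqP.
  by rewrite gt_eqF // divr_gt0.
have -> : k' = K / r / D by rewrite -h mulfK.
by field; rewrite D0 !gt_eqF.
Qed.

End compatibility.

(** * Calculus in phase space *)

Section phase_calculus.
Variables (R : realType) (n : nat) (D : set ('rV[R]_n * R)).
Hypothesis oD : open D.
Local Notation V := 'rV[R]_n.
Local Notation PS := (phase_space R n).
Implicit Types (H : PS -> R^o) (x v w : V) (t : R).

Definition pt x w t : PS := (x, w, t).
Definition phase_dom : set PS := [set z | D (z.1.1, z.2) /\ z.1.2 != 0].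
Local Notation smooth := (smooth_on phase_dom).

Lemma smooth_differentiable H x w t : smooth H -> D (x, t) -> w != 0 ->
  differentiable H (pt x w t).
Proof. by move=> hH hD w0; apply: (hH [::]). Qed.

Lemma smooth_derive H (v : PS) : smooth H -> smooth ('D_v H).
Proof. by move=> hH vs z hz; have := hH (rcons vs v) z hz; rewrite /iter_derive foldr_rcons. Qed.

Lemma ptE (h : R) a b (c : R) x w t :
  h *: pt a b c + pt x w t = pt (h *: a + x) (h *: b + w) (h * c + t).
Proof. by []. Qed.

Lemma is_d_affine (U : normedModType R) H (phi : U -> PS) (a v : U) (dv : PS) :
  (forall h : R, phi (h *: v + a) = h *: dv + phi a) -> differentiable H (phi a) ->
  is_derive a v (fun y => H (phi y) : R) ('D_dv H (phi a)).
Proof.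
move=> hphi dH; apply/is_derive_lineP.
rewrite (_ : (fun h : R => _) = fun h : R => H (h *: dv + phi a)); last first.
  by apply/funext => h; rewrite hphi.
have d : is_derive (phi a) dv H ('D_dv H (phi a)).
  by apply: DeriveDef; [exact: diff_derivable|].
by move/is_derive_lineP: d.
Qed.

Lemma is_d_phase_x H x v w t : differentiable H (pt x w t) ->
  is_derive x v (fun y => H (pt y w t) : R) ('D_(pt v 0 0) H (pt x w t)).
Proof.
apply: (@is_d_affine _ H (fun y => pt y w t)) => h.
by rewrite ptE !(scaler0, mulr0, add0r).
Qed.

Lemma is_d_phase_w H x v w t : differentiable H (pt x w t) ->
  is_derive w v (fun y => H (pt x y t) : R) ('D_(pt 0 v 0) H (pt x w t)).
Proof.
apply: (@is_d_affine _ H (fun y => pt x y t)) => h.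
by rewrite ptE !(scaler0, mulr0, add0r).
Qed.

Lemma is_d_phase_t H x w t : differentiable H (pt x w t) ->
  is_derive t 1 (fun s => H (pt x w s) : R) ('D_(pt 0 0 1) H (pt x w t)).
Proof.
apply: (@is_d_affine R^o H (fun y => pt x w y)) => h.
by rewrite ptE !(scaler0, mulr0, add0r).
Qed.

Lemma cvg_pt (T : Type) (F : set_system T) (FF : Filter F) (X W : T -> V) (S : T -> R) x w t :
  X @ F --> x -> W @ F --> w -> S @ F --> t -> (fun a => pt (X a) (W a) (S a)) @ F --> pt x w t.
Proof. by move=> hX hW hS; exact: (cvg_pair (cvg_pair hX hW) hS). Qed.

Lemma scont_phase H x t : smooth H -> D (x, t) -> scont (fun w => H (pt x w t)).
Proof.
move=> hH hD w Sw.
have c : {for pt x w t, continuous H}.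
  by apply: differentiable_continuous; apply: smooth_differentiable => //; exact: sphere_neq0.
apply: (@cvg_comp _ _ _ (fun u => pt x (unitv u) t) H (nbhs w) (nbhs (pt x w t))) => //.
apply: cvg_pt; [exact: cvg_cst| |exact: cvg_cst].
by have := continuous_unitv (sphere_neq0 Sw); rewrite /prop_for /continuous_at unitvE.
Qed.

Lemma cvg_line (T : Type) (F : set_system T) (FF : Filter F) (a : T -> R) x v :
  a @ F --> (0 : R) -> (fun z => a z *: v + x) @ F --> x.
Proof.
move=> h; rewrite -[X in _ --> X]add0r -(scale0r v).
by apply: cvgD; [apply: cvgZ => //; exact: cvg_cst|exact: cvg_cst].
Qed.

Lemma cvg_lineR (T : Type) (F : set_system T) (FF : Filter F) (a : T -> R) (s t : R) :
  a @ F --> (0 : R) -> (fun z => a z * s + t) @ F --> t.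
Proof.
move=> h; rewrite -[X in _ --> X]add0r -(mul0r s).
by apply: cvgD; [apply: cvgM => //; exact: cvg_cst|exact: cvg_cst].
Qed.

Lemma near_line_in_dom x t v (s : R) : D (x, t) ->
  \forall h \near (0 : R), D (h *: v + x, h * s + t).
Proof.
move=> hD.
have c1 : (fun h : R => h *: v + x) @ nbhs (0 : R) --> x by apply: cvg_line; exact: cvg_id.
have c2 : (fun h : R => h * s + t) @ nbhs (0 : R) --> t by apply: cvg_lineR; exact: cvg_id.
have c : (fun h : R => (h *: v + x, h * s + t)) @ nbhs (0 : R) --> (x, t) := cvg_pair c1 c2.
by apply: c; apply: open_nbhs_nbhs.
Qed.

(** A bound for all [w] at once and for all base points close to [(x, t)] on a line, by compactness
    of the sphere. It provides the dominating constant for differentiation under the mean. *)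
Lemma phase_bounded H x t v (s : R) : smooth H -> D (x, t) ->
  exists M : R, \forall h \near (0 : R), forall w, sphere w ->
    `|H (pt (h *: v + x) w (h * s + t)) : R| <= M.
Proof.
move=> hH hD.
have [_ [M hM]] := scont_bmeas (scont_phase hH hD).
exists (M + 1).
have /compact_near_coveringP nc := @compact_sphere R n.
apply: (nc R (nbhs (0 : R)) (fun h w => `|H (pt (h *: v + x) w (h * s + t)) : R| <= M + 1) _).
move=> w Sw.
have c : {for pt x w t, continuous H}.
  by apply: differentiable_continuous; apply: smooth_differentiable => //; exact: sphere_neq0.
have cp : (fun wh : V * R => pt (wh.2 *: v + x) wh.1 (wh.2 * s + t)) @ (w, 0 : R) --> pt x w t.
  by apply: cvg_pt; [apply: cvg_line|exact: cvg_fst|apply: cvg_lineR]; exact: cvg_snd.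
have cH : (fun wh : V * R => H (pt (wh.2 *: v + x) wh.1 (wh.2 * s + t)) : R) @ (w, 0 : R) --> (H (pt x w t) : R).
  exact: (@cvg_comp _ _ _ (fun wh : V * R => pt (wh.2 *: v + x) wh.1 (wh.2 * s + t)) H _ _ _ cp c).
have lt1 : `|H (pt x w t) : R| < M + 1 by apply: le_lt_trans (hM w Sw) _; rewrite ltrDl.
have nr : \forall z \near (w, 0 : R), `|H (pt (z.2 *: v + x) z.1 (z.2 * s + t)) : R| <= M + 1.
  have cN : (fun z : V * R => `|H (pt (z.2 *: v + x) z.1 (z.2 * s + t)) : R|) @ (w, 0 : R)
      --> (`|H (pt x w t) : R| : R) by apply: cvg_norm; exact: cH.
  by move/cvgr_le: cN => /(_ _ lt1).
case: nr => -[A B] [nA nB] AB; by exists (A, B); [split|exact: AB].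
Qed.

Section exchange.
Variables (sigma : probability (borel_rV R n) R).
Hypothesis hsigma : uniform_sphere sigma.
Local Notation E := (smean sigma).

(** A single statement along a line in [(x, t)], from which the space and the time derivative both
    follow. *)
Lemma is_d_smean_line H x t v (s : R) (q : V -> R) : smooth H -> D (x, t) -> bmeas q ->
  is_derive (0 : R) 1 (fun h : R => E (fun w => H (pt (h *: v + x) w (h * s + t)) * q w))
    (E (fun w => 'D_(pt v 0 s) H (pt x w t) * q w)).
Proof.
move=> hH hD bq; have hDH := smooth_derive (pt v 0 s) hH.
have [M hM] := phase_bounded v s hDH hD; have [_ [N hN]] := bq.
have near0 : \forall h \near (0 : R),
    (forall w, sphere w -> `|'D_(pt v 0 s) H (pt (h *: v + x) w (h * s + t)) : R| <= M) /\
    D (h *: v + x, h * s + t).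
  by apply: filterI => //; exact: near_line_in_dom.
have /nbhs_ballP[d /= d0 hd'] := near0.
have hd h : `|h - 0| < d -> (forall w, sphere w ->
    `|'D_(pt v 0 s) H (pt (h *: v + x) w (h * s + t)) : R| <= M) /\ D (h *: v + x, h * s + t).
  by move=> hh; apply: hd'; rewrite -ball_normE /= distrC.
have dH (h : R) w : `|h - 0| < d -> sphere w ->
    is_derive h 1 (fun h : R => H (pt (h *: v + x) w (h * s + t)) * q w)
      ('D_(pt v 0 s) H (pt (h *: v + x) w (h * s + t)) * q w).
  move=> hh Sw; have [_ Dh] := hd h hh.
  have d1 := @is_d_affine R^o H (fun h : R => pt (h *: v + x) w (h * s + t)) h 1 (pt v 0 s).
  apply: is_d_eq (is_dM (d1 _ _) (is_dcst (q w) h 1)) _.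
  - move=> k; have kA : k%:A = k :> R by rewrite /GRing.scale /= mulr1.
    by rewrite ptE scaler0 add0r kA scalerDl mulrDl !addrA.
  - by apply: smooth_differentiable => //; exact: sphere_neq0.
  - by rewrite mulr0 addr0.
rewrite [X in is_derive _ _ _ (E X)](_ : _ = fun w => 'D_(pt v 0 s) H (pt (0 *: v + x) w (0 * s + t)) * q w); last first.
  by apply/funext => w; rewrite scale0r mul0r !add0r.
apply: (@is_derive_smean _ _ _ hsigma (fun h w => H (pt (h *: v + x) w (h * s + t)) * q w) _ 0 d (M * N) d0).
- move=> h hh; have [_ Dh] := hd h hh.
  by apply: bmeasM => //; apply: scont_bmeas; exact: scont_phase.
- move=> h w hh Sw; have [h1 h2] := dH h w hh Sw; split=> //; rewrite h2 normrM.
  have [Mh _] := hd h hh.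
  by apply: ler_pM => //; [exact: Mh|exact: hN].
- by move=> w Sw; have [] := dH 0 w _ Sw; rewrite ?subrr ?normr0.
Qed.

Lemma is_d_smean_x H x t v (q : V -> R) : smooth H -> D (x, t) -> bmeas q ->
  is_derive x v (fun y => E (fun w => H (pt y w t) * q w))
    (E (fun w => 'D_(pt v 0 0) H (pt x w t) * q w)).
Proof.
move=> hH hD bq; apply/is_derive_lineP.
have := is_d_smean_line v 0 hH hD bq.
by under eq_fun do under eq_smean do rewrite mulr0 add0r.
Qed.

Lemma is_d_smean_t H x t (q : V -> R) : smooth H -> D (x, t) -> bmeas q ->
  is_derive t 1 (fun s => E (fun w => H (pt x w s) * q w))
    (E (fun w => 'D_(pt 0 0 1) H (pt x w t) * q w)).
Proof.
move=> hH hD bq; apply/is_derive_lineP.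
have := is_d_smean_line 0 1 hH hD bq.
by under eq_fun do under eq_smean do rewrite scaler0 add0r.
Qed.

End exchange.

End phase_calculus.

Lemma is_d_row (R : realType) (U : normedModType R) (n : nat) (F : U -> 'rV[R]_n) (d : 'rV[R]_n) (x v : U) :
  (forall j, is_derive x v (fun y => F y 0 j) (d 0 j)) -> is_derive x v F d.
Proof.
move=> h; have dF : derivable F x v.
  by apply/derivable_mxP => i j; rewrite ord1; case: (h j).
apply: DeriveDef => //; rewrite derive_mx //; apply/rowP => j; rewrite mxE.
by have [] := h j.
Qed.

Section phase_sphere.
Variables (R : realType) (n : nat) (D : set ('rV[R]_n * R)).
Hypothesis oD : open D.
Local Notation V := 'rV[R]_n.
Local Notation PS := (phase_space R n).
Local Notation smooth := (smooth_on (phase_dom D)).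
Implicit Types (H : PS -> R^o) (x v w : V) (t : R).

Definition phw (v : V) : PS := pt 0 v 0.

Definition gradw H x w t : V := \row_k 'D_(phw (ei R k)) H (pt x w t).

Lemma derive_phw H x w t v : differentiable H (pt x w t) ->
  'D_(phw v) H (pt x w t) = dotp v (gradw H x w t).
Proof.
move=> dH; have vE : phw v = \sum_k v 0 k *: phw (ei R k).
  have L : forall (s : seq 'I_n), phw (\sum_(k <- s) v 0 k *: ei R k) = \sum_(k <- s) v 0 k *: phw (ei R k).
    elim=> [|k s IH]; first by rewrite !big_nil.
    rewrite !big_cons -IH /phw; have := ptE (v 0 k) 0 (ei R k) 0 0 (\sum_(k0 <- s) v 0 k0 *: ei R k0) 0.
    by rewrite !(scaler0, mulr0, addr0) => ->.
  by rewrite {1}(rV_sum_ei v) L.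
rewrite deriveE // vE linear_sum /dotp; apply: eq_bigr => k _.
by rewrite linearZ /= mxE deriveE.
Qed.

Lemma differentiable_phase_w H x w t : differentiable H (pt x w t) ->
  differentiable (fun u => H (pt x u t) : R^o) w.
Proof.
move=> dH; apply: (@differentiable_comp _ _ _ _ (fun u => pt x u t) H) => //.
apply: (@differentiable_pair _ _ _ _ (fun u => (x, u)) (fun=> t : R^o)).
  by apply: differentiable_pair; [exact: differentiable_cst|exact: ex_diff].
exact: differentiable_cst.
Qed.

Lemma sdiff_phase H x t : smooth H -> D (x, t) -> sdiff (fun w => H (pt x w t)).
Proof.
move=> hH hD w Sw; have w0 := sphere_neq0 Sw.
apply: (@differentiable_comp _ _ _ _ (@unitv R n) (fun u => H (pt x u t) : R^o)).
  exact: differentiable_unitv.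
by apply: differentiable_phase_w; rewrite (unitvE Sw); apply: (smooth_differentiable hH).
Qed.

(** The projection is there because [H] need not be homogeneous of degree 0 in [w]: it is applied to
    derivatives of [extend0 f], which have lost this homogeneity. *)
Lemma sph_grad_phase H x t w : smooth H -> D (x, t) -> sphere w ->
  sph_grad (fun w => H (pt x w t)) w = Pperp w (gradw H x w t).
Proof.
move=> hH hD Sw; have w0 := sphere_neq0 Sw.
apply: sph_grad_val => //; first exact: sdiff_phase.
move=> v; have du := differentiable_unitv w0.
have dH : differentiable H (pt x w t) by exact: (smooth_differentiable hH).
have dK : differentiable (fun u => H (pt x u t) : R^o) (unitv w).
  by rewrite (unitvE Sw); exact: differentiable_phase_w.
have dKu : differentiable ((fun u => H (pt x u t) : R^o) \o @unitv R n) w.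
  exact: differentiable_comp.
apply: DeriveDef; first exact: diff_derivable.
rewrite (deriveE v dKu) (diff_comp du dK) /= (diff_unitv v Sw) -(deriveE _ dK) (unitvE Sw).
have [_ ->] := is_d_phase_w (Pperp w v) dH; rewrite derive_phw //.
by rewrite /Pperp dotpBl dotpBr dotpZl dotpZr (dotpC v w); ring.
Qed.

Lemma sC1_phase H x t : smooth H -> D (x, t) -> sC1 (fun w => H (pt x w t)).
Proof.
move=> hH hD; split; first exact: sdiff_phase.
have cg k : scont (fun w => 'D_(phw (ei R k)) H (pt x w t)).
  by apply: scont_phase (smooth_derive _ hH) hD.
move=> i; apply: (@scont_ext _ _ (fun w => 'D_(phw (ei R i)) H (pt x w t)
   - (\sum_k w 0 k * 'D_(phw (ei R k)) H (pt x w t)) * w 0 i)).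
  move=> w Sw; rewrite sph_grad_phase // /Pperp !mxE; congr (_ - _ * _).
  by apply: eq_bigr => k _; rewrite mxE.
apply: scontD; first exact: cg.
apply: scontN; apply: scontM; last exact: scont_coord.
by apply: scont_sum => k; apply: scontM; [exact: scont_coord|exact: cg].
Qed.

Section density.
Variables (f : V -> V -> R -> R) (x : V) (t : R).
Hypothesis (hf : smooth_density D f) (hD : D (x, t)).
Local Notation G := (extend0 f).
Local Notation p := (fun w => f x w t).

Lemma density_phase w : sphere w -> p w = G (pt x w t).
Proof. by move=> Sw; rewrite /extend0 /= unitvE. Qed.

Lemma sph_grad_density w : sphere w -> sph_grad p w = gradw G x w t.
Proof.
move=> Sw; apply/rowP => i; rewrite sph_gradE mxE.
have dG : differentiable G (pt x w t) by apply: (smooth_differentiable hf) => //; exact: sphere_neq0.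
by have [_ <-] := is_d_phase_w (ei R i) dG.
Qed.

Lemma sC2_density : sC2 p.
Proof.
split.
  by apply: sdiff_ext (sdiff_phase hf hD) => w Sw; rewrite density_phase.
move=> i; apply: (@sC1_ext _ _ (fun w => 'D_(phw (ei R i)) G (pt x w t))).
  by move=> w Sw; rewrite sph_grad_density // mxE.
exact: sC1_phase (smooth_derive _ hf) hD.
Qed.

(** Expresses the spherical Laplacian by iterated derivatives of the extended density, the
    quantities whose convergence [smooth_cvg] controls. *)
Lemma sph_lap_density w : sphere w -> sph_laplacian p w =
  \sum_i Pperp w (gradw ('D_(phw (ei R i)) G) x w t) 0 i.
Proof.
move=> Sw; rewrite /sph_laplacian sph_divE //; last by move=> i; case: (sC2_density.2 i).
apply: eq_bigr => i _.
have -> : sph_grad (fun u => sph_grad p u 0 i) w =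
    sph_grad (fun u => 'D_(phw (ei R i)) G (pt x u t) : R) w.
  by apply: sph_grad_ext => // u Su; rewrite sph_grad_density // mxE.
by rewrite (sph_grad_phase (smooth_derive _ hf) hD Sw).
Qed.

Lemma derive1_density w : sphere w -> derive1 (fun s => f x w s) t = 'D_(pt 0 0 1) G (pt x w t).
Proof.
move=> Sw; have w0 := sphere_neq0 Sw.
have [_ <-] := is_d_phase_t (smooth_differentiable hf hD w0).
have -> : (fun s => f x w s) = (fun s => G (pt x w s) : R); last by rewrite derive1E.
by apply/funext => s; rewrite /extend0 /= unitvE.
Qed.

Lemma grad_density w : sphere w -> grad (fun y => f y w t) x = \row_i 'D_(pt (ei R i) 0 0) G (pt x w t).
Proof.
move=> Sw; have w0 := sphere_neq0 Sw; apply/rowP => i; rewrite !mxE.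
have [_ <-] := is_d_phase_x (ei R i) (smooth_differentiable hf hD w0).
have -> // : (fun y => f y w t) = (fun y => G (pt y w t) : R).
by apply/funext => s; rewrite /extend0 /= unitvE.
Qed.

End density.

Section density_flux.
Variables (sigma : probability (borel_rV R n) R).
Hypothesis hsigma : uniform_sphere sigma.
Variables (f : V -> V -> R -> R).
Hypothesis (hf : smooth_density D f).
Local Notation G := (extend0 f).
Local Notation E := (smean sigma).

Lemma flux_density x t : flux sigma (fun u => f x u t) =
  \row_j E (fun w => G (pt x w t) * w 0 j).
Proof.
apply/rowP => j; rewrite !mxE; apply: eq_smean => w Sw.
by rewrite /extend0 /= unitvE.
Qed.

Lemma is_d_row_smean (H : PS -> R^o) x t v : smooth H -> D (x, t) ->
  is_derive x v (fun y => \row_j E (fun w => H (pt y w t) * w 0 j))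
    (\row_j E (fun w => 'D_(pt v 0 0) H (pt x w t) * w 0 j)).
Proof.
move=> hH hD; apply: is_d_row => j; rewrite mxE; under eq_fun do rewrite mxE.
exact: (is_d_smean_x oD hsigma v hH hD (bmeas_coord R j)).
Qed.

Lemma is_d_row_smean_t (H : PS -> R^o) x t : smooth H -> D (x, t) ->
  is_derive t 1 (fun s => \row_j E (fun w => H (pt x w s) * w 0 j))
    (\row_j E (fun w => 'D_(pt 0 0 1) H (pt x w t) * w 0 j)).
Proof.
move=> hH hD; apply: is_d_row => j; rewrite mxE; under eq_fun do rewrite mxE.
exact: (is_d_smean_t oD hsigma hH hD (bmeas_coord R j)).
Qed.

Lemma is_d_flux x t v : D (x, t) ->
  is_derive x v (fun y => flux sigma (fun u => f y u t))
    (\row_j E (fun w => 'D_(pt v 0 0) G (pt x w t) * w 0 j)).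
Proof.
move=> hD; under eq_fun do rewrite flux_density.
exact: is_d_row_smean.
Qed.

Lemma near_dom x t : D (x, t) -> \forall y \near x, D (y, t).
Proof.
move=> hD.
have c : (fun y => (y, t)) @ nbhs x --> (x, t) := cvg_pair cvg_id (cvg_cst t).
by apply: c; exact: open_nbhs_nbhs.
Qed.

Lemma vlaplacian_flux x t : D (x, t) ->
  vlaplacian (fun y => flux sigma (fun u => f y u t)) x =
  \sum_i \row_j E (fun w => 'D_(pt (ei R i) 0 0) ('D_(pt (ei R i) 0 0) G) (pt x w t) * w 0 j).
Proof.
move=> hD; rewrite /vlaplacian; apply: eq_bigr => i _.
have [_ <-] := is_d_row_smean (ei R i) (smooth_derive (pt (ei R i) 0 0) hf) hD.
apply: near_eq_derive; apply: filterS (near_dom hD) => y hy.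
by have [_ ->] := is_d_flux (ei R i) hy.
Qed.

End density_flux.

End phase_sphere.

(** * Passage to the limit *)

Section uniform_cvg.
Variables (R : realType) (n : nat) (sigma : probability (borel_rV R n) R).
Hypothesis hsigma : uniform_sphere sigma.
Variables (T : Type) (F : set_system T).
Context {FF : Filter F}.
Local Notation V := 'rV[R]_n.
Local Notation E := (smean sigma).
Implicit Types (PP QQ : T -> V -> R) (P Q : V -> R).

(** Uniform convergence on the sphere together with bounded measurability, which products need for
    their bounds and means for integrability. *)
Definition ucv PP P : Prop :=
  [/\ bmeas P, \forall a \near F, bmeas (PP a) &
      forall d : R, 0 < d -> \forall a \near F, forall w, sphere w -> `|PP a w - P w| <= d].

Lemma ucv_fix P : bmeas P -> ucv (fun=> P) P.
Proof.
move=> bP; split=> //; first exact: nearW.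
by move=> d d0; apply: nearW => a w _; rewrite subrr normr0 ltW.
Qed.

Lemma ucv_scal (c_ : T -> R) (c : R) : c_ @ F --> c -> ucv (fun a _ => c_ a) (fun=> c).
Proof.
move=> hc; split; [exact: bmeas_cst|by apply: nearW => a; exact: bmeas_cst|].
by move=> d d0; move/cvgrPdist_le: hc => /(_ d d0); apply: filterS => a h w _; rewrite distrC.
Qed.

Lemma ucv_ext PP QQ P Q : (\forall a \near F, forall w, sphere w -> PP a w = QQ a w) ->
  (forall w, sphere w -> P w = Q w) -> ucv PP P -> ucv QQ Q.
Proof.
move=> hPQ PQ [b1 b2 h]; split.
- exact: bmeas_ext b1.
- by apply: filterS2 hPQ b2 => a e; exact: bmeas_ext.
- move=> d d0; apply: filterS2 hPQ (h d d0) => a e k w Sw.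
  by rewrite -e // -PQ // k.
Qed.

Lemma ucvD PP QQ P Q : ucv PP P -> ucv QQ Q ->
  ucv (fun a w => PP a w + QQ a w) (fun w => P w + Q w).
Proof.
move=> [b1 b2 h] [c1 c2 k]; split; first exact: bmeasD.
  by apply: filterS2 b2 c2 => a; exact: bmeasD.
move=> d d0; have d2 : 0 < d / 2 by lra.
apply: filterS2 (h _ d2) (k _ d2) => a ha ka w Sw.
rewrite (_ : _ - _ = (PP a w - P w) + (QQ a w - Q w)); last by ring.
apply: le_trans (ler_normD _ _) _.
by have := ha w Sw; have := ka w Sw; lra.
Qed.

Lemma ucvM PP QQ P Q : ucv PP P -> ucv QQ Q ->
  ucv (fun a w => PP a w * QQ a w) (fun w => P w * Q w).
Proof.
move=> [b1 b2 h] [c1 c2 k]; split; first exact: bmeasM.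
  by apply: filterS2 b2 c2 => a; exact: bmeasM.
have [_ [M hM]] := b1; have [_ [N hN]] := c1.
move=> d d0; pose L := `|M| + `|N| + 1.
have L0 : 0 < L by rewrite /L; have := normr_ge0 M; have := normr_ge0 N; lra.
have d2 : 0 < Num.min 1 (d / L) by rewrite lt_min ltr01 divr_gt0.
apply: filterS2 (h _ d2) (k _ d2) => a ha ka w Sw.
have := ha w Sw; have := ka w Sw; rewrite !le_min => /andP[q1 q2] /andP[p1 p2].
have hMw : `|P w| <= `|M| by apply: le_trans (hM w Sw) (ler_norm _).
have hNw : `|Q w| <= `|N| by apply: le_trans (hN w Sw) (ler_norm _).
rewrite (_ : _ - _ = (PP a w - P w) * ((QQ a w - Q w) + Q w) + P w * (QQ a w - Q w)); last by ring.
apply: le_trans (ler_normD _ _) _; rewrite !normrM.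
have q3 : `|QQ a w - Q w + Q w| <= 1 + `|N| by apply: le_trans (ler_normD _ _) _; exact: lerD.
have -> : d = d / L * (1 + `|N|) + `|M| * (d / L) by rewrite /L; field; rewrite gt_eqF.
by apply: lerD; apply: ler_pM.
Qed.

Lemma ucvZ (c : R) PP P : ucv PP P -> ucv (fun a w => c * PP a w) (fun w => c * P w).
Proof. by apply: ucvM; apply: ucv_fix; exact: bmeas_cst. Qed.

Lemma ucvN PP P : ucv PP P -> ucv (fun a w => - PP a w) (fun w => - P w).
Proof.
move/(ucvZ (-1)); apply: ucv_ext; last by move=> w _; rewrite mulN1r.
by apply: nearW => a w _; rewrite mulN1r.
Qed.

Lemma ucvB PP QQ P Q : ucv PP P -> ucv QQ Q ->
  ucv (fun a w => PP a w - QQ a w) (fun w => P w - Q w).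
Proof. by move=> hP /ucvN; exact: ucvD. Qed.

Lemma ucv_sum (J : finType) (PP : J -> T -> V -> R) (P : J -> V -> R) :
  (forall j, ucv (PP j) (P j)) -> ucv (fun a w => \sum_j PP j a w) (fun w => \sum_j P j w).
Proof.
move=> h; elim: (index_enum J) => [|j s IH].
  apply: (@ucv_ext (fun _ _ => 0) _ (fun=> 0)); last by apply: ucv_fix; exact: bmeas_cst.
    by apply: nearW => a w _; rewrite big_nil.
  by move=> w _; rewrite big_nil.
apply: ucv_ext (ucvD (h j) IH); last by move=> w _; rewrite big_cons.
by apply: nearW => a w _; rewrite big_cons.
Qed.

Lemma ucv_coord i : ucv (fun _ w => w 0 i) (fun w => w 0 i).
Proof. by apply: ucv_fix; exact: bmeas_coord. Qed.

Lemma ucv_smean PP P : ucv PP P -> (fun a => E (PP a)) @ F --> E P.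
Proof.
move=> [b1 b2 h]; apply/cvgrPdist_le => d d0.
apply: filterS2 b2 (h d d0) => a ba ha.
rewrite -smeanB //; apply: le_norm_smean => //; first exact: bmeasB.
by move=> w Sw; rewrite distrC ha.
Qed.

End uniform_cvg.

Section vector_cvg.
Variables (R : realType) (n : nat) (T : Type) (F : set_system T).
Context {FF : Filter F}.
Local Notation V := 'rV[R]_n.

Lemma cvg_coord (J_ : T -> V) (J : V) i : J_ @ F --> J -> (fun a => J_ a 0 i) @ F --> J 0 i.
Proof.
move=> h; apply: (@cvg_comp _ _ _ J_ (fun u : V => u 0 i) F (nbhs J) (nbhs (J 0 i))) => //.
exact: coord_continuous.
Qed.

Lemma cvg_dotp (u_ v_ : T -> V) (u v : V) : u_ @ F --> u -> v_ @ F --> v ->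
  (fun a => dotp (u_ a) (v_ a)) @ F --> dotp u v.
Proof.
move=> hu hv; apply: (cvg_sumr (F := F)) => i.
by apply: cvgM; apply: cvg_coord.
Qed.

Lemma cvg_Pperp (u_ v_ : T -> V) (u v : V) : u_ @ F --> u -> v_ @ F --> v ->
  (fun a => Pperp (u_ a) (v_ a)) @ F --> Pperp u v.
Proof.
move=> hu hv; apply: cvgB => //; apply: cvgZ => //; exact: cvg_dotp.
Qed.

Lemma cvg_enorm (u_ : T -> V) (u : V) : u_ @ F --> u -> (fun a => enorm (u_ a)) @ F --> enorm u.
Proof.
move=> hu; apply: (@cvg_comp _ _ _ u_ (@enorm R n) F (nbhs u) (nbhs (enorm u))) => //.
exact: continuous_enorm.
Qed.

Lemma cvg_unitv (u_ : T -> V) (u : V) : u != 0 -> u_ @ F --> u ->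
  (fun a => unitv (u_ a)) @ F --> unitv u.
Proof.
move=> u0 hu; apply: (@cvg_comp _ _ _ u_ (@unitv R n) F (nbhs u) (nbhs (unitv u))) => //.
exact: continuous_unitv.
Qed.

Lemma cvg_smooth1 (nu : R -> R) (r_ : T -> R) (r : R) : smooth_on [set r : R^o | 0 < r] nu ->
  0 < r -> r_ @ F --> r -> (fun a => nu (r_ a)) @ F --> nu r /\
  (fun a => derive1 nu (r_ a)) @ F --> derive1 nu r.
Proof.
move=> h r0 hr; have c vs : {for r, continuous (iter_derive vs nu : R -> R)}.
  by apply: differentiable_continuous; exact: h.
split.
  apply: (@cvg_comp _ _ _ r_ nu F (nbhs r) (nbhs (nu r))) => //; exact: (c [::]).
apply: (@cvg_comp _ _ _ r_ (derive1 nu) F (nbhs r) (nbhs (derive1 nu r))) => //.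
rewrite (_ : derive1 nu = iter_derive [:: (1 : R^o)] nu); first exact: (c [:: (1 : R^o)]).
by apply/funext => s; rewrite derive1E.
Qed.

Lemma cvg_ell (nu : R -> R) (J_ L_ : T -> V) (J L : V) : smooth_on [set r : R^o | 0 < r] nu ->
  J != 0 -> J_ @ F --> J -> L_ @ F --> L ->
  (fun a => ell nu (J_ a) (L_ a)) @ F --> ell nu J L.
Proof.
move=> hnu J0 hJ hL; have r0 : 0 < enorm J by rewrite enorm_gt0.
have hr := cvg_enorm hJ; have [c0 c1] := cvg_smooth1 hnu r0 hr.
have hu := cvg_unitv J0 hJ; have hP := cvg_Pperp hu hL; have hd := cvg_dotp hu hL.
apply: cvgD; apply: cvgZ => //; last exact: cvgM.
by apply: cvgM => //; apply: cvgV => //; rewrite gt_eqF.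
Qed.

Lemma cvg_mcoef (tau : R -> R) (J_ L_ : T -> V) (J L : V) : smooth_on [set r : R^o | 0 < r] tau ->
  J != 0 -> J_ @ F --> J -> L_ @ F --> L ->
  (fun a => mcoef tau (J_ a) (L_ a)) @ F --> mcoef tau J L.
Proof.
move=> htau J0 hJ hL; have r0 : 0 < enorm J by rewrite enorm_gt0.
have [_ c1] := cvg_smooth1 htau r0 (cvg_enorm hJ).
by apply: cvgM => //; apply: cvg_dotp => //; exact: cvg_unitv.
Qed.

End vector_cvg.

Section kinetic_limit.
Variables (R : realType) (n : nat) (D : set ('rV[R]_n * R)).
Hypothesis oD : open D.
Local Notation V := 'rV[R]_n.
Local Notation PS := (phase_space R n).
Variables (f : R -> V -> V -> R -> R) (f0 : V -> V -> R -> R).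
Hypothesis hf : \forall eps \near 0^'+, smooth_density D (f eps).
Hypothesis hcvg : smooth_cvg D f f0.
Variables (sigma : probability (borel_rV R n) R).
Hypothesis hsigma : uniform_sphere sigma.
Variables (x : V) (t : R).
Hypothesis hD : D (x, t).
Local Notation E := (smean sigma).
Local Notation F := (0^'+ : set_system R).
Local Notation ucv := (ucv F).

Lemma uniform_le (A : set PS) (G_ : R -> PS -> R^o) (G0 : PS -> R^o) (d : R) : 0 < d ->
  {uniform A, G_ @ F --> G0} -> \forall eps \near F, forall z, A z -> `|G_ eps z - G0 z : R| <= d.
Proof.
move=> d0 h.
pose P : set (PS -> R^o) := [set h | forall z, A z -> `|h z - G0 z : R| <= d].
have : nbhs (G0 : {uniform` A -> R^o}) P.
  apply/uniform_nbhs; exists [set xy | ball xy.1 d xy.2]; split.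
    by rewrite -entourage_ballE; exists d.
  by move=> k hk z Az; have := hk z Az; rewrite /= -ball_normE /= distrC => /ltW.
exact: h.
Qed.

Lemma ucv_phase vs : ucv (fun eps w => iter_derive vs (extend0 (f eps)) (pt x w t))
  (fun w => iter_derive vs (extend0 f0) (pt x w t)).
Proof.
have [h0 hu] := hcvg.
have sm g : smooth_density D g -> smooth_on (phase_dom D) (iter_derive vs (extend0 g)).
  by move=> hg; elim: vs => [//|v vs IH] /=; exact: smooth_derive.
split.
- by apply: scont_bmeas; apply: (scont_phase (sm _ h0) hD).
- by apply: filterS hf => eps /sm h; apply: scont_bmeas; apply: (scont_phase h hD).
- move=> d d0; have := uniform_le d0 (hu vs); apply: filterS => eps h w Sw.
  exact: (h (pt x w t)).
Qed.

Local Notation G_ eps := (extend0 (f eps)).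
Local Notation G0 := (extend0 f0).

Lemma cvg_flux : (fun eps => flux sigma (fun u => f eps x u t)) @ F --> flux sigma (fun u => f0 x u t).
Proof.
rewrite flux_density; under eq_fun do rewrite flux_density.
apply: (cvg_row (F := F)) => j; rewrite mxE; under eq_fun do rewrite mxE.
apply: ucv_smean => //; apply: ucvM; first exact: (ucv_phase [::]).
exact: ucv_coord.
Qed.

Lemma cvg_vlap_flux :
  (fun eps => vlaplacian (fun y => flux sigma (fun u => f eps y u t)) x) @ F -->
  vlaplacian (fun y => flux sigma (fun u => f0 y u t)) x.
Proof.
pose c (g : V -> V -> R -> R) (i j : 'I_n) : R :=
  E (fun w => 'D_(pt (ei R i) 0 0) ('D_(pt (ei R i) 0 0) (extend0 g)) (pt x w t) * w 0 j).
(* [dd] is an explicit formula for the Laplacian of the flux. It agrees with it for smooth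
   densities, hence along the family only eventually as epsilon tends to 0. *)
have [dd ddE ddj] : exists2 dd : (V -> V -> R -> R) -> V, (forall g, smooth_density D g ->
    vlaplacian (fun y => flux sigma (fun u => g y u t)) x = dd g) &
    forall g j, dd g 0 j = \sum_i c g i j.
  exists (fun g => \row_j \sum_i c g i j); last by move=> g j; rewrite mxE.
  move=> g hg; rewrite (vlaplacian_flux oD hsigma hg hD); apply/rowP => j; rewrite summxE mxE.
  by apply: eq_bigr => i _; rewrite mxE.
rewrite (ddE _ hcvg.1).
have : (fun eps => dd (f eps)) @ F --> dd f0.
  apply: (cvg_row (F := F)) => j; rewrite ddj (funext (fun eps => ddj (f eps) j)).
  apply: (cvg_sumr (F := F)) => i.
  apply: ucv_smean => //; apply: ucvM; last exact: ucv_coord.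
  exact: (ucv_phase [:: pt (ei R i) 0 0; pt (ei R i) 0 0]).
apply: cvg_trans; apply: near_eq_cvg; apply: filterS hf => eps he.
by rewrite ddE.
Qed.

Definition transport (g : V -> V -> R -> R) w :=
  derive1 (fun s => g x w s) t + dotp w (grad (fun y => g y w t) x).

Lemma transportE g w : smooth_density D g -> sphere w -> transport g w =
  'D_(pt 0 0 1) (extend0 g) (pt x w t) + \sum_i w 0 i * 'D_(pt (ei R i) 0 0) (extend0 g) (pt x w t).
Proof.
move=> hg Sw; rewrite /transport (derive1_density hg hD Sw) (grad_density hg hD Sw); congr (_ + _).
by apply: eq_bigr => i _; rewrite mxE.
Qed.

Lemma ucv_transport : ucv (fun eps => transport (f eps)) (transport f0).
Proof.
apply: (@ucv_ext _ _ _ _ _ (fun eps w => 'D_(pt 0 0 1) (G_ eps) (pt x w t) +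
   \sum_i w 0 i * 'D_(pt (ei R i) 0 0) (G_ eps) (pt x w t)) _
  (fun w => 'D_(pt 0 0 1) G0 (pt x w t) + \sum_i w 0 i * 'D_(pt (ei R i) 0 0) G0 (pt x w t))).
- by apply: filterS hf => eps he w Sw; rewrite transportE.
- by move=> w Sw; rewrite transportE //; case: hcvg.
- apply: ucvD; first exact: (ucv_phase [:: pt 0 0 1]).
  apply: ucv_sum => i; apply: ucvM; first exact: ucv_coord.
  exact: (ucv_phase [:: pt (ei R i) 0 0]).
Qed.

Lemma ucv_lap : ucv (fun eps => sph_laplacian (fun u => f eps x u t)) (sph_laplacian (fun u => f0 x u t)).
Proof.
pose lap g w := \sum_i ('D_(phw (ei R i)) ('D_(phw (ei R i)) (extend0 g)) (pt x w t)
  - (\sum_k w 0 k * 'D_(phw (ei R k)) ('D_(phw (ei R i)) (extend0 g)) (pt x w t)) * w 0 i).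
have lapE g w : smooth_density D g -> sphere w -> lap g w = sph_laplacian (fun u => g x u t) w.
  move=> hg Sw; rewrite (sph_lap_density hg hD Sw); apply: eq_bigr => i _.
  by rewrite /Pperp !mxE; congr (_ - _ * _); apply: eq_bigr => k _; rewrite mxE.
apply: (@ucv_ext _ _ _ _ _ (fun eps => lap (f eps)) _ (lap f0)).
- by apply: filterS hf => eps he w Sw; rewrite lapE.
- by move=> w Sw; rewrite lapE //; case: hcvg.
- apply: ucv_sum => i; apply: ucvB; first exact: (ucv_phase [:: phw (ei R i); phw (ei R i)]).
  apply: ucvM; last exact: ucv_coord.
  apply: ucv_sum => k; apply: ucvM; first exact: ucv_coord.
  exact: (ucv_phase [:: phw (ei R k); phw (ei R i)]).
Qed.

Lemma sph_div_scale_Pperp (p : V -> R) (a w : V) : sC1 p -> sphere w ->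
  sph_div (fun u => p u *: Pperp u a) w = - (n%:R - 1) * (p w * dotp w a) + dotp (sph_grad p w) a.
Proof.
move=> hp Sw; have dp : sdiff p by case: hp.
rewrite sph_divZ //; last by move=> i; exact: sdiff_Pperp.
rewrite sph_div_Pperp //; have tg := sph_grad_tangent dp Sw; move: (sph_grad p w) tg => q tg.
by rewrite /Pperp dotpBr dotpZr (dotpC q w) tg; ring.
Qed.

Lemma ucv_drift (a_ : R -> V) (a : V) : a_ @ F --> a ->
  ucv (fun eps => sph_div (fun u => f eps x u t *: Pperp u (a_ eps)))
      (sph_div (fun u => f0 x u t *: Pperp u a)).
Proof.
move=> ha; pose dr g (b : V) w : R := - (n%:R - 1) * (extend0 g (pt x w t) * \sum_i w 0 i * b 0 i) +
   \sum_i 'D_(phw (ei R i)) (extend0 g) (pt x w t) * b 0 i.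
have drE g (b : V) w : smooth_density D g -> sphere w -> dr g b w = sph_div (fun u => g x u t *: Pperp u b) w.
  move=> hg Sw; rewrite sph_div_scale_Pperp //; last exact: (sC2_sC1 (sC2_density hg hD)).
  rewrite (sph_grad_density hg hD Sw) (density_phase _ _ _ Sw); congr (_ + _).
  by apply: eq_bigr => i _; rewrite mxE.
apply: (@ucv_ext _ _ _ _ _ (fun eps => dr (f eps) (a_ eps)) _ (dr f0 a)).
- by apply: filterS hf => eps he w Sw; rewrite drE.
- by move=> w Sw; rewrite drE //; case: hcvg.
- apply: ucvD.
    apply: ucvZ; apply: ucvM; first exact: (ucv_phase [::]).
    by apply: ucv_sum => i; apply: ucvM; [exact: ucv_coord|apply: ucv_scal; exact: cvg_coord].
  apply: ucv_sum => i; apply: ucvM; first exact: (ucv_phase [:: phw (ei R i)]).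
  by apply: ucv_scal; exact: cvg_coord.
Qed.

End kinetic_limit.

(** * Uniform convergence of the test functions *)

Section gci_test.
Variables (R : realType) (m : nat) (T : Type) (F : set_system T).
Context {FF : Filter F}.
Local Notation V := 'rV[R]_m.+2.
Variables (g : R -> R -> R).
Hypothesis hg : forall k, 0 < k -> gci_profile m.+2 k (g k).

Definition l1 (v : V) : R := \sum_i `|v 0 i|.

Lemma dotp_l1 (w v : V) : sphere w -> `|dotp w v| <= l1 v.
Proof.
move=> Sw; apply: le_trans (ler_norm_sum _ _ _) _; apply: ler_sum => i _.
by rewrite normrM ler_piMl // coord_norm_le1.
Qed.

Lemma cvg_l1 (v_ : T -> V) (v : V) : v_ @ F --> v -> (fun a => l1 (v_ a - v)) @ F --> (0 : R).
Proof.
move=> h; rewrite (_ : 0 = \sum_(i < m.+2) 0); last by rewrite big1.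
apply: (cvg_sumr (F := F)) => i.
have h0 : (fun e => v_ e 0 i - v 0 i) @ F --> (0 : R).
  rewrite -(subrr (v 0 i)); apply: cvgB; last exact: cvg_cst.
  exact: cvg_coord.
rewrite (_ : (fun e => _) = fun e => `|v_ e 0 i - v 0 i|); last by apply/funext => e; rewrite !mxE.
by rewrite -(normr0 R); exact: cvg_norm.
Qed.

Lemma h_of_lipschitz (k : R) (g0 : R -> R) (M : R) : gci_profile m.+2 k g0 ->
  (forall s : R, -1 < s < 1 -> `|prof_h1 g0 s| <= M) ->
  forall s s' : R, -1 < s < 1 -> -1 < s' < 1 -> `|h_of g0 s - h_of g0 s'| <= M * `|s - s'|.
Proof.
move=> hg0 hM.
have aux (s s' : R) : -1 < s < 1 -> -1 < s' < 1 -> s < s' -> `|h_of g0 s - h_of g0 s'| <= M * `|s - s'|.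
  move=> hs hs' ss'.
  have dh (y : R) : s <= y <= s' -> is_derive y 1 (h_of g0) (prof_h1 g0 y).
    by move=> hy; apply: (h_of_derive hg0); lra.
  have [c hc E] := MVT_cc ss' dh.
  by rewrite distrC E normrM [`|s - s'|]distrC; apply: ler_wpM2r => //; apply: hM; lra.
move=> s s' hs hs'; have [ss'|ss'|->] := ltgtP s s'; first exact: aux.
  by rewrite distrC [`|s - s'|]distrC; exact: aux.
by rewrite !subrr !normr0 mulr0.
Qed.

(* At a pole [|w . Om| = 1] the factor [w . a] vanishes, so that the jump of [h_of] there is harmless. *)
Lemma ucv_gci (k_ : T -> R) (Om_ a_ : T -> V) (k : R) (Om a : V) :
  0 < k -> k_ @ F --> k -> Om_ @ F --> Om -> a_ @ F --> a -> sphere Om -> dotp Om a = 0 ->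
  (\forall e \near F, [/\ 0 < k_ e, sphere (Om_ e) & dotp (Om_ e) (a_ e) = 0]) ->
  ucv F (fun e w => h_of (g (k_ e)) (dotp w (Om_ e)) * dotp w (a_ e))
        (fun w => h_of (g k) (dotp w Om) * dotp w a).
Proof.
move=> k0 ck cO ca SOm Oa hn.
have [M M0 hM] := prof_h_bounds (hg k0).
have [C C0 [d d0 hC]] := h_of_continuity hg k0.
split; first exact: (bmeas_h_zonal (hg k0) a SOm).
  by apply: filterS hn => e [ke Se _]; exact: (bmeas_h_zonal (hg ke) _ Se).
(* Three errors: the change of kappa in the profile, through [h_of_continuity]; the change of [Om],
   through the Lipschitz bound on [h_of (g k)]; and the change of [a]. *)
pose b e := C * `|k_ e - k| * (l1 a + l1 (a_ e - a)) + M * l1 (Om_ e - Om) * l1 a + M * l1 (a_ e - a).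
have cb : b @ F --> (0 : R).
  have c1 := cvg_l1 ca; have c2 := cvg_l1 cO.
  have c3 : (fun e => `|k_ e - k|) @ F --> (0 : R).
    rewrite -(normr0 R); apply: cvg_norm; rewrite -(subrr k).
    by apply: cvgB => //; exact: cvg_cst.
  rewrite (_ : (0 : R) = C * 0 * (l1 a + 0) + M * 0 * l1 a + M * 0); last by ring.
  have cc (c : R) : (fun=> c) @ F --> c by exact: cvg_cst.
  exact: (cvgD (cvgD (cvgM (cvgM (cc C) c3) (cvgD (cc _) c1)) (cvgM (cvgM (cc M) c2) (cc _))) (cvgM (cc M) c1)).
have kd : \forall e \near F, `|k_ e - k| < d.
  by move/cvgrPdist_lt: ck => /(_ d d0); apply: filterS => e; rewrite distrC.
move=> dd dd0; move/cvgrPdist_le: cb => /(_ dd dd0); apply: filterS3 hn kd => e [ke Se ae] kde.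
rewrite sub0r normrN => bdd w Sw; apply: le_trans (_ : b e <= _); last exact: le_trans (ler_norm _) bdd.
have hs := dotp_itv Sw SOm; have hs' := dotp_itv Sw Se.
have p0 : `|dotp w Om| = 1 -> dotp w a = 0.
  by move=> h; rewrite (dotp_pole Sw SOm h) dotpZl Oa mulr0.
have p1 : `|dotp w (Om_ e)| = 1 -> dotp w (a_ e) = 0.
  by move=> h; rewrite (dotp_pole Sw Se h) dotpZl ae mulr0.
have la := dotp_l1 a Sw; have lae := dotp_l1 (a_ e - a) Sw; have lO := dotp_l1 (Om_ e - Om) Sw.
rewrite /b; rewrite !dotpBr in lae lO.
have h1 := hC (k_ e) (dotp w (Om_ e)) kde hs'.
have [b0 _] := hM (dotp w Om); have {}b0 := b0 hs.
have [b1 _] := hM (dotp w (Om_ e)); have {}b1 := b1 hs'.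
have lip : -1 < dotp w Om < 1 -> -1 < dotp w (Om_ e) < 1 ->
    `|h_of (g k) (dotp w (Om_ e)) - h_of (g k) (dotp w Om)| <= M * `|dotp w (Om_ e) - dotp w Om|.
  by move=> i1 i2; apply: (h_of_lipschitz (hg k0)) => // s hs2; exact: (hM s).2.
have itvP (s : R) : -1 <= s <= 1 -> `|s| != 1 -> -1 < s < 1.
  by move=> h s1; rewrite -ltr_norml lt_neqAle s1 ler_norml.
move: p0 p1 la lae lO h1 b0 b1 lip.
move: (dotp w Om) (dotp w (Om_ e)) (dotp w a) (dotp w (a_ e)) hs hs' => s s' A A' hs hs'.
move: (l1 a) (l1 (a_ e - a)) (l1 (Om_ e - Om)) => La Ld Lo p0 p1 la lae lO h1 b0 b1 lip.
have X1 : `|(h_of (g (k_ e)) s' - h_of (g k) s') * A'| <= C * `|k_ e - k| * (La + Ld).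
  rewrite normrM; apply: ler_pM => //; rewrite -[A'](subrK A).
  by apply: le_trans (ler_normD _ _) _; rewrite addrC lerD.
have X2 : `|h_of (g k) s' * A' - h_of (g k) s * A| <= M * Lo * La + M * Ld.
  have La0 : 0 <= La := le_trans (normr_ge0 _) la.
  have Ld0 : 0 <= Ld := le_trans (normr_ge0 _) lae.
  have Lo0 : 0 <= Lo := le_trans (normr_ge0 _) lO.
  have MLo : 0 <= M * Lo * La by rewrite !mulr_ge0.
  have [e1|e1] := eqVneq `|s| 1.
    rewrite (p0 e1) mulr0 subr0 normrM; apply: ler_wpDl => //.
    by apply: ler_pM => //; move: lae; rewrite (p0 e1) subr0.
  have [e2|e2] := eqVneq `|s'| 1.
    rewrite (p1 e2) mulr0 sub0r normrN normrM; apply: ler_wpDl => //.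
    by apply: ler_pM => //; move: lae; rewrite (p1 e2) sub0r normrN.
  have l := lip (itvP _ hs e1) (itvP _ hs' e2).
  rewrite (_ : _ - _ = (h_of (g k) s' - h_of (g k) s) * A + h_of (g k) s' * (A' - A)); last by ring.
  apply: le_trans (ler_normD _ _) _; rewrite [X in X + _]normrM [X in _ + X]normrM.
  apply: lerD; apply: ler_pM => //.
  by apply: le_trans l _; apply: ler_wpM2l.
rewrite (_ : _ - _ = (h_of (g (k_ e)) s' - h_of (g k) s') * A' + (h_of (g k) s' * A' - h_of (g k) s * A)); last by ring.
by apply: le_trans (ler_normD _ _) _; rewrite -addrA lerD.
Qed.

End gci_test.

(** * The collision operator against the test functions *)

Section collision.
Variables (R : realType) (m : nat) (sigma : probability (borel_rV R m.+2) R).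
Hypothesis hsigma : uniform_sphere sigma.
Local Notation V := 'rV[R]_m.+2.
Local Notation E := (smean sigma).
Variables (nu tau k : R -> R) (g : R -> R -> R).
Hypothesis (htau : forall r, 0 <= r -> 0 < tau r)
  (hk : forall r, 0 <= r -> k r = nu r / tau r)
  (hg : forall kappa, 0 < kappa -> gci_profile m.+2 kappa (g kappa)).
Variables (p : V -> R).
Hypothesis hp : sC2 p.
Local Notation J := (flux sigma p).

Lemma bmeas_Qop : bmeas (Qop sigma nu tau p).
Proof.
by apply: bmeasD; apply: bmeasZ; [exact: (bmeas_drift (unitv J) (sC2_sC1 hp))|exact: bmeas_lap].
Qed.

Lemma smean_drift a : E (sph_div (fun u => p u *: Pperp u a)) = 0.
Proof.
apply: (smean_sph_div hsigma (V := fun u => p u *: Pperp u a)).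
  by move=> i; exact: (sC1_scale_Pperp a i (sC2_sC1 hp)).
by move=> w Sw; rewrite dotpZr Pperp_tangent // mulr0.
Qed.

Lemma smean_lap : E (sph_laplacian p) = 0.
Proof.
apply: (smean_sph_div hsigma (V := sph_grad p)); first by case: hp.
by move=> w Sw; rewrite sph_grad_tangent //; case: hp.
Qed.

Lemma smean_Qop : E (Qop sigma nu tau p) = 0.
Proof.
have bd := bmeas_drift (unitv J) (sC2_sC1 hp); have bl := bmeas_lap hp.
rewrite /Qop smeanD //; [|exact: bmeasZ|exact: bmeasZ].
by rewrite !smeanZ // smean_drift smean_lap !mulr0 addr0.
Qed.

Lemma dotp_flux a : dotp J a = E (fun w => p w * dotp w a).
Proof.
have bp : bmeas p by apply: sdiff_bmeas; case: hp.
rewrite /dotp; under eq_smean do rewrite mulr_sumr.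
rewrite smean_sum //; last first.
  by move=> i; apply: bmeasM => //; apply: bmeasM; [exact: bmeas_coord|exact: bmeas_cst].
apply: eq_bigr => i _; rewrite mxE -/(smean sigma _) mulrC -smeanZ //.
  by apply: eq_smean => w _; ring.
by apply: bmeasM => //; exact: bmeas_coord.
Qed.

Lemma smean_gci_Qop a (Om := unitv J) : J != 0 -> 0 < k (enorm J) -> dotp Om a = 0 ->
  E (fun w => h_of (g (k (enorm J))) (dotp w Om) * dotp w a * Qop sigma nu tau p w) = 0.
Proof.
move=> J0 k0 Oa; have r0 : 0 <= enorm J by exact: enorm_ge0.
have -> : Qop sigma nu tau p = fun w => - (k (enorm J) * tau (enorm J)) *
    sph_div (fun u => p u *: Pperp u Om) w + tau (enorm J) * sph_laplacian p w.
  by apply/funext => w; rewrite /Qop hk // divfK // gt_eqF // htau.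
apply: (smean_gci hsigma (hg k0)) => //; first exact: sphere_unitv.
rewrite -dotp_flux -[J in LHS]scale1r -(divff (_ : enorm J != 0)); last by rewrite enorm_eq0.
by rewrite -scalerA dotpZl Oa mulr0.
Qed.

End collision.

(** * The two identities satisfied by the limit density *)

Section limit_identities.
Variables (R : realType) (m : nat) (sigma : probability (borel_rV R m.+2) R).
Hypothesis hsigma : uniform_sphere sigma.
Local Notation n := m.+2.
Local Notation V := 'rV[R]_n.
Local Notation E := (smean sigma).
Local Notation F := (0^'+ : set_system R).
Variables (nu tau k : R -> R) (g : R -> R -> R).
Hypotheses (hnu_smooth : smooth_on [set r : R^o | 0 < r] nu)
  (htau_smooth : smooth_on [set r : R^o | 0 < r] tau)
  (hnu : forall r, 0 <= r -> 0 <= nu r)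
  (htau : forall r, 0 <= r -> 0 < tau r)
  (hk : forall r, 0 <= r -> k r = nu r / tau r)
  (hk_incr : forall r s, 0 <= r -> r < s -> k r < k s)
  (hg : forall kappa, 0 < kappa -> gci_profile n kappa (g kappa)).
Variables (K2 : R) (eta : R -> R) (K2lim : R).
Hypotheses (hK2_pos : 0 < K2) (heta : eta eps @[eps --> 0^'+] --> 0)
  (hK2lim : K2 * (eta eps ^+ 2 / eps) @[eps --> 0^'+] --> K2lim).
Variables (D : set (V * R)) (f rem : R -> V -> V -> R -> R) (f0 : V -> V -> R -> R).
Hypotheses (oD : open D)
  (hf : \forall eps \near 0^'+, smooth_density D (f eps))
  (heq : \forall eps \near 0^'+, forall x w t, D (x, t) -> sphere w ->
     flux sigma (fun u => f eps x u t) != 0 ->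
     kinetic_lhs sigma nu tau eps (K2 * eta eps ^+ 2) (f eps) x w t
     = Qop sigma nu tau (fun u => f eps x u t) w + rem eps x w t)
  (hrem_O : exists C : R, \forall eps \near 0^'+, forall x w t,
     D (x, t) -> sphere w -> `|rem eps x w t| <= C * eta eps ^+ 4)
  (hrem_int : \forall eps \near 0^'+, forall x t, D (x, t) ->
     (\int[sigma]_(w in @sphere R n) rem eps x w t)%R = 0)
  (hcvg : smooth_cvg D f f0).
Variables (x : V) (t : R).
Hypothesis hD : D (x, t).
Local Notation p eps := (fun u => f eps x u t).
Local Notation J g := (flux sigma (fun u => g x u t)).
Local Notation L g := (vlaplacian (fun y => flux sigma (fun u => g y u t)) x).
Hypothesis J0 : J f0 != 0.

(** The bracket that [K_2 eta^2] multiplies in [kinetic_lhs]. *)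
Definition perturbation (h : V -> V -> R -> R) (w : V) : R :=
  sph_div (fun u => h x u t *: Pperp u (ell nu (J h) (L h))) w
  - mcoef tau (J h) (L h) * sph_laplacian (fun u => h x u t) w.
Local Notation Tr h := (transport x t h).

Lemma k_gt0 r : 0 < r -> 0 < k r.
Proof.
move=> r0; apply: le_lt_trans (hk_incr (lexx 0) r0).
by rewrite hk // divr_ge0 ?hnu // ltW // htau.
Qed.

Lemma cvg_J : (fun eps => J (f eps)) @ F --> J f0.
Proof. exact: (cvg_flux hf hcvg hsigma hD). Qed.

Lemma cvg_L : (fun eps => L (f eps)) @ F --> L f0.
Proof. exact: (cvg_vlap_flux oD hf hcvg hsigma hD). Qed.

Lemma ucv_perturbation : ucv F (fun eps => perturbation (f eps)) (perturbation f0).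
Proof.
apply: ucvB; first exact: (ucv_drift hf hcvg hD (cvg_ell hnu_smooth J0 cvg_J cvg_L)).
apply: ucvM; first exact: ucv_scal (cvg_mcoef htau_smooth J0 cvg_J cvg_L).
exact: (ucv_lap hf hcvg hD).
Qed.

Lemma near_J0 : \forall eps \near F, J (f eps) != 0.
Proof. exact: (cvg_J (near_neq0 J0)). Qed.

Definition kinetic_at eps : Prop :=
  [/\ 0 < eps, sC2 (p eps), J (f eps) != 0 &
   [/\ bmeas (Tr (f eps)), bmeas (perturbation (f eps)),
     bmeas (fun w => rem eps x w t), E (fun w => rem eps x w t) = 0 &
    forall w, sphere w -> eps * Tr (f eps) w + K2 * eta eps ^+ 2 * perturbation (f eps) w =
      Qop sigma nu tau (p eps) w + rem eps x w t]].

Lemma near_kinetic_at : \forall eps \near F, kinetic_at eps.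
Proof.
have [_ bT _] := ucv_transport hf hcvg hD; have [_ bP _] := ucv_perturbation.
near=> eps.
have e0 : 0 < eps by near: eps; exact: nbhs_right_gt.
have hfe : smooth_density D (f eps) by near: eps.
have hp : sC2 (p eps) := sC2_density hfe hD.
have Je : J (f eps) != 0 by near: eps; exact: near_J0.
have b1 : bmeas (Tr (f eps)) by near: eps.
have b2 : bmeas (perturbation (f eps)) by near: eps.
have eqn w : sphere w -> eps * Tr (f eps) w + K2 * eta eps ^+ 2 * perturbation (f eps) w =
      Qop sigma nu tau (p eps) w + rem eps x w t.
  move=> Sw; have : forall x w t, D (x, t) -> sphere w -> flux sigma (fun u => f eps x u t) != 0 ->
     kinetic_lhs sigma nu tau eps (K2 * eta eps ^+ 2) (f eps) x w t
     = Qop sigma nu tau (fun u => f eps x u t) w + rem eps x w t by near: eps.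
  by move=> /(_ x w t hD Sw Je) <-.
(* Measurability of the remainder is read off from the equation, all other terms of which are
   measurable. *)
have b3 : bmeas (fun w => rem eps x w t).
  apply: (@bmeas_ext _ _ (fun w => eps * Tr (f eps) w + K2 * eta eps ^+ 2 * perturbation (f eps) w
    - Qop sigma nu tau (p eps) w)).
    by move=> w Sw; rewrite eqn //; ring.
  by apply: bmeasB; [apply: bmeasD; exact: bmeasZ|exact: bmeas_Qop].
have i0 : E (fun w => rem eps x w t) = 0.
  by have : forall x t, D (x, t) -> (\int[sigma]_(w in @sphere R n) rem eps x w t)%R = 0
    by [near: eps]; exact.
by split.
Unshelve. all: by end_near.
Qed.

Lemma smean_perturbation h : smooth_density D h -> E (perturbation h) = 0.
Proof.
move=> hh; have hp := sC2_density hh hD.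
have bd := bmeas_drift (ell nu (J h) (L h)) (sC2_sC1 hp); have bl := bmeas_lap hp.
rewrite /perturbation smeanB //; last exact: bmeasZ.
by rewrite smeanZ // smean_drift // smean_lap // mulr0 subr0.
Qed.

(** For each small epsilon the collision term, the perturbation and the remainder all have mean 0
    exactly, so [eps * E (Tr (f eps)) = 0] before the limit. *)
Lemma limit_mass : E (Tr f0) = 0.
Proof.
have c : (fun eps => E (Tr (f eps))) @ F --> E (Tr f0).
  exact: (ucv_smean hsigma (ucv_transport hf hcvg hD)).
have e : \forall eps \near F, E (Tr (f eps)) = 0.
  apply: filterS2 near_kinetic_at hf => eps [e0 hp Je [bT bP br ir eqn]] hfe.
  have bQ := bmeas_Qop sigma nu tau hp.
  have : E (fun w => eps * Tr (f eps) w + K2 * eta eps ^+ 2 * perturbation (f eps) w) =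
    E (fun w => Qop sigma nu tau (p eps) w + rem eps x w t) by exact: eq_smean.
  have -> : E (fun w => eps * Tr (f eps) w + K2 * eta eps ^+ 2 * perturbation (f eps) w) =
      eps * E (Tr (f eps)) + K2 * eta eps ^+ 2 * E (perturbation (f eps)).
    by rewrite smeanD ?smeanZ //; exact: bmeasZ.
  rewrite (smeanD hsigma bQ br) smean_Qop // ir smean_perturbation // mulr0 !addr0 => /eqP.
  by rewrite mulf_eq0 gt_eqF //= => /eqP.
have c0 : (fun eps => E (Tr (f eps))) @ F --> (0 : R).
  have : (fun=> 0 : R) @ F --> (0 : R) by exact: cvg_cst.
  by apply: cvg_trans; apply: near_eq_cvg; apply: filterS e => eps ->.
have := cvg_lim (@norm_hausdorff _ _) c; rewrite (cvg_lim (@norm_hausdorff _ _) c0).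
by move=> h; rewrite -[LHS]h.
Qed.

Lemma limit_gci A (Om := unitv (J f0)) (kap := k (enorm (J f0))) : dotp Om A = 0 ->
  E (fun w => Tr f0 w * (h_of (g kap) (dotp w Om) * dotp w A))
  + K2lim * E (fun w => perturbation f0 w * (h_of (g kap) (dotp w Om) * dotp w A)) = 0.
Proof.
move=> OA; have SOm : sphere Om := sphere_unitv J0.
have r0 : 0 < enorm (J f0) by rewrite enorm_gt0.
have kap0 : 0 < kap := k_gt0 r0.
have cO := cvg_unitv J0 cvg_J.
(* [A] is orthogonal to the limit orientation only. Its projection orthogonal to the orientation of
   f^epsilon is an admissible test vector and converges to [A]. *)
have cA : (fun eps => Pperp (unitv (J (f eps))) A) @ F --> A.
  have := cvg_Pperp cO (cvg_cst A); rewrite {2}/Pperp -/Om OA scale0r subr0; exact.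
have ck : (fun eps => k (enorm (J (f eps)))) @ F --> kap.
  have cr := cvg_enorm cvg_J.
  have [c1 _] := cvg_smooth1 hnu_smooth r0 cr; have [c2 _] := cvg_smooth1 htau_smooth r0 cr.
  rewrite /kap hk ?enorm_ge0 // (_ : (fun eps => _) = fun eps => nu (enorm (J (f eps))) / tau (enorm (J (f eps)))).
    by apply: cvgM => //; apply: cvgV => //; rewrite gt_eqF // htau // ltW.
  by apply/funext => eps; rewrite hk // enorm_ge0.
pose psi eps w := h_of (g (k (enorm (J (f eps))))) (dotp w (unitv (J (f eps)))) *
   dotp w (Pperp (unitv (J (f eps))) A).
have cpsi : ucv F psi (fun w => h_of (g kap) (dotp w Om) * dotp w A).
  apply: ucv_gci => //; apply: filterS near_J0 => eps Je; split.
  - by apply: k_gt0; rewrite enorm_gt0.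
  - exact: sphere_unitv.
  - by apply: Pperp_tangent; exact: sphere_unitv.
have [[_ [M hM]] bpsi upsi] := cpsi.
have [C hC] := hrem_O.
have c1 : (fun eps => E (fun w => Tr (f eps) w * psi eps w)) @ F -->
    E (fun w => Tr f0 w * (h_of (g kap) (dotp w Om) * dotp w A)).
  exact: (ucv_smean hsigma (ucvM (ucv_transport hf hcvg hD) cpsi)).
have c2 : (fun eps => E (fun w => perturbation (f eps) w * psi eps w)) @ F -->
    E (fun w => perturbation f0 w * (h_of (g kap) (dotp w Om) * dotp w A)).
  exact: (ucv_smean hsigma (ucvM ucv_perturbation cpsi)).
pose q eps := K2 * (eta eps ^+ 2 / eps).
have c3 : (fun eps => E (fun w => Tr (f eps) w * psi eps w) +
    q eps * E (fun w => perturbation (f eps) w * psi eps w)) @ F -->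
    E (fun w => Tr f0 w * (h_of (g kap) (dotp w Om) * dotp w A)) +
    K2lim * E (fun w => perturbation f0 w * (h_of (g kap) (dotp w Om) * dotp w A)).
  exact: (cvgD c1 (cvgM hK2lim c2)).
(* Bound for the tested remainder divided by epsilon: [eta^4 / eps = (q / K2) * eta^2], while the
   test functions are eventually bounded by [|M| + 1]. *)
pose b eps := `|C| * (`|M| + 1) / K2 * (q eps * (eta eps * eta eps)).
have cb : b @ F --> (0 : R).
  suff : b @ F --> `|C| * (`|M| + 1) / K2 * (K2lim * (0 * 0)) by rewrite !mulr0.
  exact: (cvgM (cvg_cst _) (cvgM hK2lim (cvgM heta heta))).
have key : \forall eps \near F, `|E (fun w => Tr (f eps) w * psi eps w) +
    q eps * E (fun w => perturbation (f eps) w * psi eps w)| <= b eps.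
  have u1 := upsi 1 ltr01.
  near=> eps.
  have [e0 hp Je [bT bP br ir eqn]] : kinetic_at eps by near: eps; exact: near_kinetic_at.
  have bp : bmeas (psi eps) by near: eps.
  have ps w : sphere w -> `|psi eps w| <= `|M| + 1.
    have : forall w, sphere w -> `|psi eps w - h_of (g kap) (dotp w Om) * dotp w A| <= 1 by near: eps.
    move=> + Sw => /(_ w Sw) h; have := hM w Sw; have := ler_norm M.
    by have := ler_normD (psi eps w - h_of (g kap) (dotp w Om) * dotp w A) (h_of (g kap) (dotp w Om) * dotp w A);
      rewrite subrK; move: h; lra.
  have rm w : sphere w -> `|rem eps x w t| <= C * eta eps ^+ 4.
    by have : forall x w t, D (x, t) -> sphere w -> `|rem eps x w t| <= C * eta eps ^+ 4
      by [near: eps]; move=> /(_ x w t hD).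
  have bQ := bmeas_Qop sigma nu tau hp.
  have Q0 : E (fun w => psi eps w * Qop sigma nu tau (p eps) w) = 0.
    apply: (smean_gci_Qop hsigma htau hk hg hp Je); first by apply: k_gt0; rewrite enorm_gt0.
    by apply: Pperp_tangent; exact: sphere_unitv.
  have : E (fun w => eps * (Tr (f eps) w * psi eps w) +
       K2 * eta eps ^+ 2 * (perturbation (f eps) w * psi eps w)) =
    E (fun w => psi eps w * Qop sigma nu tau (p eps) w + rem eps x w t * psi eps w).
    by apply: eq_smean => w Sw; have := eqn w Sw; move=> h;
      rewrite [RHS](_ : _ = psi eps w * (Qop sigma nu tau (p eps) w + rem eps x w t)); [rewrite -h|]; ring.
  have bTp := bmeasM bT bp; have bPp := bmeasM bP bp; have brp := bmeasM br bp.
  have -> : E (fun w => eps * (Tr (f eps) w * psi eps w) +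
       K2 * eta eps ^+ 2 * (perturbation (f eps) w * psi eps w)) =
      eps * E (fun w => Tr (f eps) w * psi eps w) +
      K2 * eta eps ^+ 2 * E (fun w => perturbation (f eps) w * psi eps w).
    by rewrite smeanD ?smeanZ //; exact: bmeasZ.
  rewrite (smeanD hsigma (bmeasM bp bQ) brp) Q0 add0r => e.
  have re : `|E (fun w => rem eps x w t * psi eps w)| <= `|C| * eta eps ^+ 4 * (`|M| + 1).
    apply: le_norm_smean => // w Sw; rewrite normrM; apply: ler_pM => //; last exact: ps.
    apply: le_trans (rm w Sw) _; apply: ler_wpM2r; last exact: ler_norm.
    exact: exprn_even_ge0.
  move: e re; rewrite /b /q.
  move: (E (fun w => Tr (f eps) w * psi eps w)) (E (fun w => perturbation (f eps) w * psi eps w))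
    (E (fun w => rem eps x w t * psi eps w)) => X Y Z e re.
  have -> : X + K2 * (eta eps ^+ 2 / eps) * Y = Z / eps by rewrite -e; field; rewrite gt_eqF.
  rewrite normrM normfV (gtr0_norm e0) ler_pdivrMr //.
  rewrite (_ : _ * eps = `|C| * eta eps ^+ 4 * (`|M| + 1)) //; field.
  by rewrite !gt_eqF.
apply/eqP; rewrite -normr_eq0 eq_le normr_ge0 andbT.
apply: (ler_cvg_to (cvg_norm c3) cb key).
Unshelve. all: by end_near.
Qed.

End limit_identities.

(** * Local equilibria *)

Section von_mises.
Variables (R : realType) (m : nat) (sigma : probability (borel_rV R m.+2) R).
Hypothesis hsigma : uniform_sphere sigma.
Local Notation n := m.+2.
Local Notation V := 'rV[R]_n.
Local Notation E := (smean sigma).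
Local Notation e := (ei R (ord0 : 'I_n)).
Implicit Types (k : R) (Om w : V).

Definition partition k : R := E (fun w => expR (k * dotp w e)).

Lemma smean_zonal_indep (phi : R -> R) (u v : V) : sphere u -> sphere v ->
  (forall s : R, -1 <= s <= 1 -> {for s, continuous phi}) ->
  E (fun w => phi (dotp w u)) = E (fun w => phi (dotp w v)).
Proof.
move=> Su Sv c; apply: (mulIf (lt0r_neq0 (wallis_gt0 R m))).
by rewrite (smean_zonal_int hsigma Su c) (smean_zonal_int hsigma Sv c).
Qed.

Lemma partitionE k Om : sphere Om -> E (fun w => expR (k * dotp w Om)) = partition k.
Proof.
move=> SOm; apply: (smean_zonal_indep (phi := fun s => expR (k * s))) => //; first exact: sphere_ei.
by move=> s _; exact: continuous_expM.
Qed.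

Lemma partition_gt0 k : 0 < partition k.
Proof. by apply: (smean_exp_gt0 hsigma); exact: sphere_ei. Qed.

Lemma partition_derive k : is_derive k 1 partition (c_of n k * partition k).
Proof.
have := is_derive_exp_mean hsigma 0 k.
rewrite (_ : (fun k => _) = partition); last first.
  by apply/funext => k'; apply: eq_smean => w _; rewrite mul1r.
congr is_derive; rewrite /partition (c_ofE hsigma (sphere_ei R (ord0 : 'I_n))).
by apply: eq_smean => w _; rewrite expr1.
Qed.

Lemma vonMisesE k Om w : sphere Om -> vonMises sigma k Om w = expR (k * dotp w Om) / partition k.
Proof. by move=> SOm; rewrite /vonMises -/(smean sigma _) partitionE. Qed.

Lemma smean_vonMises k Om : sphere Om -> E (vonMises sigma k Om) = 1.
Proof.
move=> SOm; rewrite (@eq_smean _ _ _ _ (fun w => (partition k)^-1 * expR (k * dotp w Om))).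
  by rewrite smeanZ ?partitionE ?mulVf // ?gt_eqF ?partition_gt0 //; exact: bmeas_expM.
by move=> w _; rewrite vonMisesE // mulrC.
Qed.

Lemma flux_vonMises k Om : sphere Om -> flux sigma (vonMises sigma k Om) = c_of n k *: Om.
Proof.
move=> SOm; apply/rowP => i; rewrite !mxE -/(smean sigma _).
have P0 := partition_gt0 k; have be := bmeas_expM Om k.
have b1 : bmeas (fun w => expR (k * dotp w Om) * dotp w Om) by apply: bmeasM => //; exact: bmeas_dotpl.
have b2 : bmeas (fun w => expR (k * dotp w Om) * dotp w (Pperp Om (ei R i))).
  by apply: bmeasM => //; exact: bmeas_dotpl.
rewrite (@eq_smean _ _ _ _ (fun w => (partition k)^-1 * (expR (k * dotp w Om) * dotp w (Pperp Om (ei R i))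
   + Om 0 i * (expR (k * dotp w Om) * dotp w Om)))); last first.
  move=> w _; rewrite vonMisesE // /Pperp dotpBr dotpZr !dotp_ei; ring.
have z := smean_zonal_dotp hsigma (g := fun s => expR (k * s)) be (Pperp_tangent (ei R i) SOm).
rewrite (smeanZ hsigma); last by apply: bmeasD => //; exact: bmeasZ.
rewrite smeanD //; last exact: bmeasZ.
rewrite z add0r smeanZ // (@eq_smean _ _ _ _ (fun w => dotp w Om * expR (k * dotp w Om))).
  rewrite -(c_ofE hsigma SOm) partitionE //; field; exact: lt0r_neq0.
by move=> w _; rewrite mulrC.
Qed.

End von_mises.

Section von_mises_derivative.
Variables (R : realType) (m : nat) (sigma : probability (borel_rV R m.+2) R).
Hypothesis hsigma : uniform_sphere sigma.
Local Notation n := m.+2.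
Local Notation V := 'rV[R]_n.
Variables (kap : R -> R) (U : normedModType R) (r : U -> R) (O : U -> V) (a v : U) (dr : R) (dO : V).
Hypotheses (hr : is_derive a v r dr) (hO : is_derive a v O dO)
  (SO : \forall y \near a, sphere (O y)) (r0 : 0 < r a) (hkap : derivable kap (r a) 1).

Lemma sphere_derive_perp : dotp (O a) dO = 0.
Proof.
have hi i : is_derive a v (fun y => O y 0 i) (dO 0 i).
  have [h1 h2] := hO; apply: DeriveDef; first by move/derivable_mxP: h1 => /(_ 0 i).
  by have := derive_mx h1; rewrite h2 => /rowP /(_ i); rewrite mxE.
have d : is_derive a v (fun y => dotp (O y) (O y)) (\sum_i (dO 0 i * O a 0 i + O a 0 i * dO 0 i)).
  by apply: is_d_sum => i; exact: is_dM.
have d0 : is_derive a v (fun y => dotp (O y) (O y)) 0.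
  apply: near_eq_is_derive (is_dcst 1 a v).
  by apply: filterS SO => y /sphereE ->.
have := is_d_val d d0 => e.
have : 2 * dotp (O a) dO = 0 by rewrite -e /dotp mulr_sumr; apply: eq_bigr => i _; ring.
by move/eqP; rewrite mulf_eq0 pnatr_eq0 /= => /eqP.
Qed.

Lemma von_mises_derive w (k := kap (r a)) :
  is_derive a v (fun y => r y * vonMises sigma (kap (r y)) (O y) w)
    (r a * vonMises sigma k (O a) w *
     (dr * ((r a)^-1 + derive1 kap (r a) * (dotp w (O a) - c_of n k)) + k * dotp w dO)).
Proof.
have Sa : sphere (O a) by exact: nbhs_singleton SO.
have hi i : is_derive a v (fun y => O y 0 i) (dO 0 i).
  have [h1 h2] := hO; apply: DeriveDef; first by move/derivable_mxP: h1 => /(_ 0 i).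
  by have := derive_mx h1; rewrite h2 => /rowP /(_ i); rewrite mxE.
have dw : is_derive a v (fun y => dotp w (O y)) (dotp w dO).
  have := @is_d_sum _ _ _ (fun i y => w 0 i * O y 0 i) (fun i => w 0 i * dO 0 i) a v.
  by apply=> i; exact: is_dZ.
have dk : is_derive a v (fun y => kap (r y)) (derive1 kap (r a) * dr).
  apply: is_d_comp hr _; apply: DeriveDef => //; by rewrite derive1E.
have P0 : partition sigma k != 0 by rewrite gt_eqF // partition_gt0.
have dP := is_d_comp dk (partition_derive hsigma k).
have de := is_d_comp (is_dM dk dw) (is_derive_expR _).
have d := is_dM hr (is_dM de (is_dV (f := fun y => partition sigma (kap (r y))) P0 dP)).
have near_eq : \forall y \near a, r y * (expR (kap (r y) * dotp w (O y)) / partition sigma (kap (r y))) =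
    r y * vonMises sigma (kap (r y)) (O y) w.
  by apply: filterS SO => y Sy; rewrite vonMisesE.
apply: is_d_eq (near_eq_is_derive near_eq d) _.
rewrite vonMisesE // -/k; have r1 : r a != 0 by rewrite gt_eqF.
move: P0 r1; move: (expR (k * dotp w (O a))) (partition sigma k) (derive1 kap (r a)) (c_of n k) => X Z k' c Z0 r1.
by field; rewrite Z0 r1.
Qed.

End von_mises_derivative.

(** * Moments of the transport and perturbation terms *)

Section moment_integrals.
Variables (R : realType) (m : nat) (sigma : probability (borel_rV R m.+2) R).
Hypothesis hsigma : uniform_sphere sigma.
Local Notation n := m.+2.
Local Notation V := 'rV[R]_n.
Local Notation E := (smean sigma).
Variables (h : R -> R) (Om A : V) (k C : R).
Hypotheses (SOm : sphere Om) (OA : dotp Om A = 0) (bh : bmeas (fun w => h (dotp w Om))).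
Local Notation a := (E (fun w => h (dotp w Om) * expR (k * dotp w Om) * (1 - dotp w Om ^+ 2))).
Local Notation b := (E (fun w => h (dotp w Om) * expR (k * dotp w Om) * dotp w Om * (1 - dotp w Om ^+ 2))).

Let bG : bmeas (fun w => h (dotp w Om) * expR (k * dotp w Om)).
Proof. by apply: bmeasM => //; exact: bmeas_expM. Qed.

Let bGp (u v : R) : bmeas (fun w => h (dotp w Om) * expR (k * dotp w Om) * (u + v * dotp w Om)).
Proof.
apply: bmeasM => //; apply: bmeasD; first exact: bmeas_cst.
by apply: bmeasZ; exact: bmeas_dotpl.
Qed.

Let b1 : bmeas (fun w => 1 - dotp w Om ^+ 2).
Proof. by apply: bmeasB; [exact: bmeas_cst|exact: bmeas_expr]. Qed.

Lemma smean_affine (u v : R) :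
  E (fun w => h (dotp w Om) * expR (k * dotp w Om) * (u + v * dotp w Om) * (1 - dotp w Om ^+ 2)) = u * a + v * b.
Proof.
have c1 : bmeas (fun w => h (dotp w Om) * expR (k * dotp w Om) * (1 - dotp w Om ^+ 2)) by exact: bmeasM.
have c2 : bmeas (fun w => h (dotp w Om) * expR (k * dotp w Om) * dotp w Om * (1 - dotp w Om ^+ 2)).
  by apply: bmeasM => //; apply: bmeasM => //; exact: bmeas_dotpl.
rewrite -!smeanZ // -smeanD //; [|exact: bmeasZ|exact: bmeasZ].
by apply: eq_smean => w _; ring.
Qed.

Lemma smean_affine1 (u v : R) (c : V) :
  (m%:R + 1) * E (fun w => h (dotp w Om) * expR (k * dotp w Om) * (u + v * dotp w Om) * (dotp w A * dotp w c)) =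
  dotp A c * (u * a + v * b).
Proof.
have := smean_zonal_dotp2 hsigma SOm (g := fun s => h s * expR (k * s) * (u + v * s)) c (bGp u v) OA.
by rewrite smean_affine -[n%:R]natr1 addrK -natr1.
Qed.

Lemma smean_affine0 (u v : R) :
  E (fun w => h (dotp w Om) * expR (k * dotp w Om) * (u + v * dotp w Om) * dotp w A) = 0.
Proof. exact: (smean_zonal_dotp hsigma (g := fun s => h s * expR (k * s) * (u + v * s)) (bGp u v) OA). Qed.

Lemma smean_quadratic (c d : V) : dotp Om d = 0 ->
  (m%:R + 1) * E (fun w => h (dotp w Om) * expR (k * dotp w Om) * (dotp w A * dotp w c * dotp w d)) =
  dotp A d * dotp Om c * b.
Proof.
move=> Od; have := smean_zonal_dotp3 hsigma SOm (g := fun s => h s * expR (k * s)) c d bG OA.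
by rewrite Od mulr0 add0r -[n%:R]natr1 addrK -natr1.
Qed.

Variables (rt al be : R) (gr Ot : V) (Ox : 'I_n -> V).
Hypothesis OOx : forall i, dotp Om (Ox i) = 0.

(** All terms reduce to the two moments [a] and [b], whose quotient [b / a] will be [ctilde]. The
    time derivative of the density multiplies a zonal function times [w.A], which has mean 0. The
    last sum collects into the convective derivative because each [Ox i] is orthogonal to [Om]. *)
Lemma smean_transport_gci :
  (m%:R + 1) * E (fun w => C * expR (k * dotp w Om) *
     ((rt + dotp w gr) * (al + be * dotp w Om) + k * (dotp w Ot + \sum_i w 0 i * dotp w (Ox i)))
     * (h (dotp w Om) * dotp w A)) =
  C * (dotp A gr * (al * a + be * b) + k * (dotp A Ot * a + dotp A (\sum_i Om 0 i *: Ox i) * b)).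
Proof.
have bA c : bmeas (fun w : V => dotp w c) by exact: bmeas_dotpl.
have e1 := smean_affine0 al be; have e2 := smean_affine1 al be gr.
have e3 := smean_affine1 1 0 Ot; have e4 i := smean_quadratic (ei R i) (OOx i).
have q1 : bmeas (fun w => h (dotp w Om) * expR (k * dotp w Om) * (al + be * dotp w Om) * dotp w A).
  exact: bmeasM.
have q2 : bmeas (fun w => h (dotp w Om) * expR (k * dotp w Om) * (al + be * dotp w Om) * (dotp w A * dotp w gr)).
  by apply: bmeasM => //; exact: bmeasM.
have q3 : bmeas (fun w => h (dotp w Om) * expR (k * dotp w Om) * (1 + 0 * dotp w Om) * (dotp w A * dotp w Ot)).
  by apply: bmeasM => //; exact: bmeasM.
have q4 i : bmeas (fun w => h (dotp w Om) * expR (k * dotp w Om) * (dotp w A * dotp w (ei R i) * dotp w (Ox i))).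
  by apply: bmeasM => //; apply: bmeasM => //; exact: bmeasM.
have -> : E (fun w => C * expR (k * dotp w Om) *
     ((rt + dotp w gr) * (al + be * dotp w Om) + k * (dotp w Ot + \sum_i w 0 i * dotp w (Ox i)))
     * (h (dotp w Om) * dotp w A)) =
  C * (rt * E (fun w => h (dotp w Om) * expR (k * dotp w Om) * (al + be * dotp w Om) * dotp w A) +
   E (fun w => h (dotp w Om) * expR (k * dotp w Om) * (al + be * dotp w Om) * (dotp w A * dotp w gr)) +
   k * (E (fun w => h (dotp w Om) * expR (k * dotp w Om) * (1 + 0 * dotp w Om) * (dotp w A * dotp w Ot)) +
    \sum_i E (fun w => h (dotp w Om) * expR (k * dotp w Om) * (dotp w A * dotp w (ei R i) * dotp w (Ox i))))).
  have b5 := bmeasZ k (bmeasD q3 (bmeas_sum q4)).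
  have b6 := bmeasD (bmeasZ rt q1) q2.
  rewrite -(smean_sum hsigma q4) -(smeanD hsigma q3 (bmeas_sum q4)) -(smeanZ hsigma k (bmeasD q3 (bmeas_sum q4))).
  rewrite -(smeanZ hsigma rt q1) -(smeanD hsigma (bmeasZ rt q1) q2) -(smeanD hsigma b6 b5).
  rewrite -(smeanZ hsigma C (bmeasD b6 b5)).
  apply: eq_smean => w _.
  have -> : \sum_i h (dotp w Om) * expR (k * dotp w Om) * (dotp w A * dotp w (ei R i) * dotp w (Ox i)) =
     h (dotp w Om) * expR (k * dotp w Om) * dotp w A * \sum_i w 0 i * dotp w (Ox i).
    by rewrite mulr_sumr; apply: eq_bigr => i _; rewrite dotp_ei; ring.
  by ring.
have e5 : (m%:R + 1) * (\sum_i E (fun w => h (dotp w Om) * expR (k * dotp w Om) *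
    (dotp w A * dotp w (ei R i) * dotp w (Ox i)))) = dotp A (\sum_i Om 0 i *: Ox i) * b.
  rewrite mulr_sumr (eq_bigr _ (fun i _ => e4 i)) dotp_sumr mulr_suml.
  by apply: eq_bigr => i _; rewrite dotpZr dotp_ei; ring.
move: e1 e2 e3 e5; rewrite mul1r mul0r addr0.
move: (E (fun w => h (dotp w Om) * expR (k * dotp w Om) * (al + be * dotp w Om) * dotp w A))
  (E (fun w => h (dotp w Om) * expR (k * dotp w Om) * (al + be * dotp w Om) * (dotp w A * dotp w gr)))
  (E (fun w => h (dotp w Om) * expR (k * dotp w Om) * (1 + 0 * dotp w Om) * (dotp w A * dotp w Ot)))
  (\sum_i E (fun w => h (dotp w Om) * expR (k * dotp w Om) * (dotp w A * dotp w (ei R i) * dotp w (Ox i))))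
  => X1 X2 X3 X4 -> e2 e3 e5.
rewrite mulr0 add0r -e2 -e3 -e5; ring.
Qed.

(** The Laplacian of a zonal density is zonal, and so is the drift along [Om]; against [w.A] both
    have mean 0. Only the part of [l] orthogonal to [Om] is left, which explains why neither [nu']
    nor [tau'] enters [delta]. *)
Lemma smean_perturbation_gci (p : V -> R) (l : V) (mu : R) :
  (forall w, sphere w -> p w = C * expR (k * dotp w Om)) -> sC2 p ->
  (m%:R + 1) * E (fun w => (sph_div (fun u => p u *: Pperp u l) w - mu * sph_laplacian p w)
     * (h (dotp w Om) * dotp w A)) =
  - (C * dotp A l * ((m%:R + 1) * a + k * b)).
Proof.
move=> pE hp.
have S1 := (sphereE Om).1 SOm.
have dphi (s : R) : is_derive s 1 (fun s : R => C * expR (k * s)) (C * k * expR (k * s)).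
  apply: is_d_eq (is_dZ C (is_d_comp (is_dZ k (is_derive_id s 1)) (is_derive_expR _))) _.
  by rewrite mulr1; ring.
have dphi1 (s : R) : is_derive s 1 (fun s : R => C * k * expR (k * s)) (C * k * k * expR (k * s)).
  apply: is_d_eq (is_dZ (C * k) (is_d_comp (is_dZ k (is_derive_id s 1)) (is_derive_expR _))) _.
  by rewrite mulr1; ring.
have [hq gq] := sC1_zonal SOm (fun s _ => dphi s) (fun s _ => is_d_continuous (dphi1 s)).
have [hq1 gq1] := sC1_zonal SOm (fun s _ => dphi1 s) (fun s _ => cvgM (cvg_cst _) (@continuous_expM R k s)).
have gp w : sphere w -> sph_grad p w = (C * k * expR (k * dotp w Om)) *: Pperp w Om.
  by move=> Sw; rewrite (sph_grad_ext pE) // gq.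
have div w : sphere w -> sph_div (fun u => p u *: Pperp u l) w =
    C * expR (k * dotp w Om) * (- ((m%:R + 1) + k * dotp w Om) * dotp w l + k * dotp Om l).
  move=> Sw; rewrite sph_div_scale_Pperp //; last exact: sC2_sC1.
  rewrite gp // pE // dotpZl /Pperp dotpBl dotpZl -[n%:R]natr1 addrK -natr1; ring.
have lap w : sphere w -> sph_laplacian p w = C * expR (k * dotp w Om) *
    (k ^+ 2 * (1 - dotp w Om ^+ 2) - (m%:R + 1) * k * dotp w Om).
  move=> Sw; rewrite /sph_laplacian.
  rewrite (@sph_div_ext _ _ _ (fun w => (C * k * expR (k * dotp w Om)) *: Pperp w Om)) //.
  rewrite sph_div_scale_Pperp // gq1 // dotpZl /Pperp dotpBl dotpZl S1 -[n%:R]natr1 addrK -natr1; ring.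
have bA c : bmeas (fun w : V => dotp w c) by exact: bmeas_dotpl.
have q1 : bmeas (fun w => h (dotp w Om) * expR (k * dotp w Om) * ((m%:R + 1) + k * dotp w Om) * (dotp w A * dotp w l)).
  by apply: bmeasM => //; exact: bmeasM.
pose G2 s := h s * expR (k * s) * (k * dotp Om l - mu * (k ^+ 2 * (1 - s ^+ 2) - (m%:R + 1) * k * s)).
have bG2 : bmeas (fun w => G2 (dotp w Om)).
  apply: bmeasM => //; apply: bmeasB; first exact: bmeas_cst.
  by apply: bmeasZ; apply: bmeasB; apply: bmeasZ.
have z : E (fun w => G2 (dotp w Om) * dotp w A) = 0 := smean_zonal_dotp hsigma bG2 OA.
have q2 : bmeas (fun w => G2 (dotp w Om) * dotp w A) by exact: bmeasM.
rewrite (@eq_smean _ _ _ _ (fun w => C * (- (h (dotp w Om) * expR (k * dotp w Om) * ((m%:R + 1) + k * dotp w Om) *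
   (dotp w A * dotp w l)) + G2 (dotp w Om) * dotp w A))); last first.
  by move=> w Sw; rewrite div // lap // /G2; ring.
rewrite smeanZ //; last by apply: bmeasD => //; exact: bmeasN.
rewrite smeanD //; last exact: bmeasN.
rewrite z addr0 smeanN // mulrN mulrN mulrCA (smean_affine1 (m%:R + 1) k l).
by rewrite mulrA.
Qed.

End moment_integrals.

Section transport_calculus.
Variables (R : realType) (n : nat) (sigma : probability (borel_rV R n) R).
Hypothesis hsigma : uniform_sphere sigma.
Local Notation V := 'rV[R]_n.
Local Notation E := (smean sigma).
Variables (D : set (V * R)) (g : V -> V -> R -> R) (x : V) (t : R).

Lemma transport_val w (dt : R) (dx : 'I_n -> R) : is_derive t 1 (fun s => g x w s) dt ->
  (forall i, is_derive x (ei R i) (fun y => g y w t) (dx i)) ->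
  transport x t g w = dt + \sum_i w 0 i * dx i.
Proof.
move=> [_ e] h; rewrite /transport derive1E e; congr (_ + _).
by apply: eq_bigr => i _; rewrite mxE; have [_ ->] := h i.
Qed.

Lemma smean_transport : smooth_density D g -> D (x, t) ->
  E (transport x t g) = E (fun w => 'D_(pt 0 0 1) (extend0 g) (pt x w t) * 1) +
    \sum_i E (fun w => 'D_(pt (ei R i) 0 0) (extend0 g) (pt x w t) * w 0 i).
Proof.
move=> hg hD.
have bD v : bmeas (fun w => 'D_v (extend0 g) (pt x w t)).
  by apply: scont_bmeas; exact: (scont_phase (smooth_derive v hg) hD).
have b1 i : bmeas (fun w => 'D_(pt (ei R i) 0 0) (extend0 g) (pt x w t) * w 0 i).
  by apply: bmeasM => //; exact: bmeas_coord.
have b2 : bmeas (fun w => 'D_(pt 0 0 1) (extend0 g) (pt x w t) * 1).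
  by apply: bmeasM => //; exact: bmeas_cst.
rewrite -(smean_sum hsigma b1) -(smeanD hsigma b2 (bmeas_sum b1)).
apply: eq_smean => w Sw; rewrite (transportE hD hg Sw) mulr1; congr (_ + _).
by apply: eq_bigr => i _; rewrite mulrC.
Qed.

End transport_calculus.

Section equilibrium_regularity.
Variables (R : realType) (m : nat) (sigma : probability (borel_rV R m.+2) R).
Hypothesis hsigma : uniform_sphere sigma.
Local Notation n := m.+2.
Local Notation V := 'rV[R]_n.
Local Notation E := (smean sigma).

Lemma bmeas_vonMises k (Om : V) : sphere Om -> bmeas (vonMises sigma k Om).
Proof.
move=> SOm; apply: (@bmeas_ext _ _ (fun w => (partition sigma k)^-1 * expR (k * dotp w Om))).
  by move=> w _; rewrite vonMisesE // mulrC.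
by apply: bmeasZ; exact: bmeas_expM.
Qed.

Lemma smean_equilibrium r k (Om : V) : sphere Om -> E (fun w => r * vonMises sigma k Om w) = r.
Proof.
by move=> SOm; rewrite (smeanZ hsigma r (bmeas_vonMises k SOm)) (smean_vonMises hsigma k SOm) mulr1.
Qed.

Lemma flux_equilibrium r k (Om : V) : sphere Om ->
  flux sigma (fun w => r * vonMises sigma k Om w) = (r * c_of n k) *: Om.
Proof.
move=> SOm; rewrite -scalerA -(flux_vonMises hsigma) //; apply/rowP => i.
rewrite !mxE -!/(smean sigma _) -smeanZ //; last first.
  by apply: bmeasM; [exact: bmeas_vonMises|exact: bmeas_coord].
by apply: eq_smean => w _; rewrite mulrA.
Qed.

Lemma orientation_derivable (U : normedModType R) (kap : R -> R) (r : U -> R) (O Jf : U -> V) (a v : U)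
    (dr : R) (dJ : V) :
  is_derive a v r dr -> is_derive a v Jf dJ -> 0 < r a -> derivable kap (r a) 1 -> 0 < kap (r a) ->
  (\forall y \near a, 0 < r y /\ 0 < kap (r y)) ->
  (\forall y \near a, Jf y = (r y * c_of n (kap (r y))) *: O y) ->
  derivable O a v.
Proof.
move=> hr hJ r0 hkap k0 near0 hO.
have dk : is_derive a v (fun y => kap (r y)) (derive1 kap (r a) * dr).
  by apply: is_d_comp hr _; apply: DeriveDef => //; rewrite derive1E.
have drc := is_dM hr (is_d_comp dk (c_of_derive hsigma k0)).
have rc0 : r a * c_of n (kap (r a)) != 0 by rewrite mulf_neq0 // gt_eqF // (c_of_gt0 hsigma).
have di := is_dV (f := fun y => r y * c_of n (kap (r y))) rc0 drc.
have hJi i : is_derive a v (fun y => Jf y 0 i) (dJ 0 i).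
  have [h1 h2] := hJ; apply: DeriveDef; first by move/derivable_mxP: h1 => /(_ 0 i).
  by have := derive_mx h1; rewrite h2 => /rowP /(_ i); rewrite mxE.
apply/derivable_mxP => i j; rewrite ord1.
have := near_eq_is_derive (g := fun y => O y 0 j) _ (is_dM di (hJi j)).
case=> //; apply: filterS2 near0 hO => y [ry ky] ->.
have : r y * c_of n (kap (r y)) != 0 by apply: mulf_neq0; rewrite gt_eqF // (c_of_gt0 hsigma).
by rewrite mxE; move: (r y * _) => q q0; rewrite mulrA mulVf // mul1r.
Qed.

End equilibrium_regularity.

(** * Regularity of the limit fields and the continuity equation *)

Section hydrodynamic_fields.
Variables (R : realType) (m : nat) (sigma : probability (borel_rV R m.+2) R).
Hypothesis hsigma : uniform_sphere sigma.
Local Notation n := m.+2.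
Local Notation V := 'rV[R]_n.
Local Notation E := (smean sigma).
Variables (D : set (V * R)) (I : set R) (kap : R -> R) (rho : V -> R -> R) (Om : V -> R -> V).
Hypotheses (oD : open D) (hkap_diff : forall r, I r -> derivable kap r 1)
  (hkap_pos : forall r, I r -> 0 < kap r)
  (hrho : forall x t, D (x, t) -> 0 < rho x t /\ I (rho x t))
  (hOm : forall x t, D (x, t) -> sphere (Om x t)).
Local Notation f0 := (fun x w t => rho x t * vonMises sigma (kap (rho x t)) (Om x t) w).
Hypothesis hs : smooth_density D f0.
Local Notation G := (extend0 f0).
Local Notation c := (c_of n).
Variables (x : V) (t : R).
Hypothesis hD : D (x, t).

Let near_x : \forall y \near x, D (y, t) := near_dom oD hD.

Let near_t : \forall s \near t, D (x, s).
Proof.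
have h : (fun s => (x, s)) @ nbhs t --> (x, t) := cvg_pair (cvg_cst x) cvg_id.
by apply: h; exact: open_nbhs_nbhs.
Qed.

(** The factor 1 is the weight [q] expected by [is_d_smean_x] and [is_d_smean_t]. *)
Lemma smean_phase y s : D (y, s) -> E (fun w => G (pt y w s) * 1) = rho y s.
Proof.
move=> hy; rewrite -[RHS](smean_equilibrium hsigma (rho y s) (kap (rho y s)) (hOm hy)).
by apply: eq_smean => w Sw; rewrite mulr1 (density_phase f0 y s Sw).
Qed.

Lemma flux_phase y s : D (y, s) ->
  flux sigma (fun w => f0 y w s) = (rho y s * c (kap (rho y s))) *: Om y s.
Proof. by move=> /hOm; exact: flux_equilibrium. Qed.

Lemma is_d_rho_x v : is_derive x v (fun y => rho y t) (E (fun w => 'D_(pt v 0 0) G (pt x w t) * 1)).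
Proof.
have d := is_d_smean_x oD hsigma v hs hD (bmeas_cst n (1 : R)).
have e : \forall y \near x, E (fun w => G (pt y w t) * 1) = rho y t by apply: filterS near_x => y /smean_phase.
exact: near_eq_is_derive e d.
Qed.

Lemma is_d_rho_t : is_derive t 1 (rho x) (E (fun w => 'D_(pt 0 0 1) G (pt x w t) * 1)).
Proof.
have d := is_d_smean_t oD hsigma hs hD (bmeas_cst n (1 : R)).
have e : \forall s \near t, E (fun w => G (pt x w s) * 1) = rho x s by apply: filterS near_t => s /smean_phase.
exact: near_eq_is_derive e d.
Qed.

Let r0 : 0 < rho x t. Proof. by case: (hrho hD). Qed.
Let dkap : derivable kap (rho x t) 1. Proof. by apply: hkap_diff; case: (hrho hD). Qed.
Let k0 : 0 < kap (rho x t). Proof. by apply: hkap_pos; case: (hrho hD). Qed.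

Let pos y s : D (y, s) -> 0 < rho y s /\ 0 < kap (rho y s).
Proof. by move=> /hrho [? /hkap_pos]. Qed.

Lemma derivable_Om_x v : derivable (fun y => Om y t) x v.
Proof.
apply: (orientation_derivable hsigma (kap := kap) (is_d_rho_x v) (is_d_flux oD hsigma hs v hD)) => //.
- by apply: filterS near_x => y /pos.
- by apply: filterS near_x => y /flux_phase.
Qed.

Lemma derivable_Om_t : derivable (Om x) t 1.
Proof.
apply: (orientation_derivable hsigma (kap := kap) is_d_rho_t (is_d_row_smean_t oD hsigma hs hD)) => //.
- by apply: filterS near_t => y /pos.
- by apply: filterS near_t => s /flux_phase; exact: etrans (esym (flux_density sigma f0 x s)).
Qed.

Lemma Om_perp_x v : dotp (Om x t) ('D_v (fun y => Om y t) x) = 0.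
Proof.
apply: (@sphere_derive_perp _ _ _ (fun y => Om y t) x v).
  by apply: DeriveDef => //; exact: derivable_Om_x.
by apply: filterS near_x => y /hOm.
Qed.

Lemma Om_perp_t : dotp (Om x t) (derive1 (Om x) t) = 0.
Proof.
apply: (@sphere_derive_perp _ _ _ (Om x) t 1).
  by apply: DeriveDef; [exact: derivable_Om_t|rewrite derive1E].
by apply: filterS near_t => y /hOm.
Qed.

Lemma transport_equilibrium w (k := kap (rho x t)) :
  transport x t f0 w = rho x t * vonMises sigma k (Om x t) w *
    ((derive1 (rho x) t + dotp w (grad (fun y => rho y t) x)) *
       ((rho x t)^-1 + derive1 kap (rho x t) * (dotp w (Om x t) - c k)) +
     k * (dotp w (derive1 (Om x) t) + \sum_i w 0 i * dotp w ('D_(ei R i) (fun y => Om y t) x))).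
Proof.
have dt : is_derive t 1 (rho x) (derive1 (rho x) t).
  by have [h _] := is_d_rho_t; apply: DeriveDef => //; rewrite derive1E.
have dx i : is_derive x (ei R i) (fun y => rho y t) (grad (fun y => rho y t) x 0 i).
  by have [h _] := is_d_rho_x (ei R i); apply: DeriveDef => //; rewrite mxE.
have Dt : is_derive t 1 (Om x) (derive1 (Om x) t).
  by apply: DeriveDef; [exact: derivable_Om_t|rewrite derive1E].
have Dx i : is_derive x (ei R i) (fun y => Om y t) ('D_(ei R i) (fun y => Om y t) x).
  by apply: DeriveDef => //; exact: derivable_Om_x.
have St : \forall s \near t, sphere (Om x s) by apply: filterS near_t => s /hOm.
have Sx : \forall y \near x, sphere (Om y t) by apply: filterS near_x => s /hOm.
rewrite (transport_val (g := f0) (von_mises_derive hsigma dt Dt St r0 dkap w)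
  (fun i => von_mises_derive hsigma (dx i) (Dx i) Sx r0 dkap w)).
have -> : dotp w (grad (fun y => rho y t) x) = \sum_i w 0 i * grad (fun y => rho y t) x 0 i by [].
rewrite -/k; move: ((rho x t)^-1 + _ * _) => Y.
rewrite (eq_bigr (fun i => rho x t * vonMises sigma k (Om x t) w * (Y * (w 0 i * grad (fun y => rho y t) x 0 i)
   + k * (w 0 i * dotp w ('D_(ei R i) (fun y => Om y t) x))))); last by move=> i _; ring.
rewrite -mulr_sumr big_split /= -!mulr_sumr; ring.
Qed.

Lemma continuity_equation : E (transport x t f0) = 0 ->
  derive1 (rho x) t + div (fun y => (rho y t * c (kap (rho y t))) *: Om y t) x = 0.
Proof.
rewrite (smean_transport hsigma hs hD) => <-; congr (_ + _).
  by have [_ <-] := is_d_rho_t; rewrite derive1E.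
apply: eq_bigr => i _.
have [_ <-] := is_d_smean_x oD hsigma (ei R i) hs hD (bmeas_coord R i).
apply: near_eq_derive; apply: filterS near_x => y hy.
have := etrans (esym (flux_density sigma f0 y t)) (flux_phase hy).
by move/rowP => /(_ i) <-; rewrite mxE.
Qed.

End hydrodynamic_fields.

Lemma near_eq_vlaplacian (R : realType) n (V W : 'rV[R]_n -> 'rV[R]_n) (A : set 'rV[R]_n) x :
  open A -> A x -> (forall y, A y -> V y = W y) -> vlaplacian V x = vlaplacian W x.
Proof.
move=> oA Ax VW; apply: eq_bigr => i _; apply: near_eq_derive.
have nA y : A y -> \forall z \near y, A z by move=> Ay; exact: open_nbhs_nbhs.
apply: filterS (nA x Ax) => y Ay; apply: near_eq_derive.
by apply: filterS (nA y Ay) => z; exact: VW.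
Qed.
(** Here [M = n - 1]; [T] and [B] are the means of the transport and perturbation terms, [q] is the
    limit of [K_2 eta^2 / eps], [be] is the derivative of kappa and [N] the value of [nu]. [Agr],
    [At], [Ac], [Al] and [AL] are the products of [A] with the gradient of rho, the time and
    convective derivatives of [Om], the field [ell] and the Laplacian of the flux. *)
Lemma orientation_algebra (R : realType) (M T B C al be a b k c ct r q N Agr At Ac Al AL : R) :
  0 < C -> 0 < a -> 0 < k -> 0 < r -> 0 < c ->
  M * T = C * (Agr * (al * a + be * b) + k * (At * a + Ac * b)) ->
  M * B = - (C * Al * (M * a + k * b)) -> T + q * B = 0 ->
  b = ct * a -> Al = N / (r * c) * AL -> al = r^-1 - be * c ->
  r * (At + ct * Ac) + (k^-1 + (ct - c) * (r / k) * be) * Agr = q * (N / c * (M / k + ct)) * AL.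
Proof.
move=> C0 a0 k0 r0 c0 eT eB e eb el ea; move: eT eB; rewrite {}eb {}el {}ea => eT eB.
(* Multiplied by [C * a * k / r], the difference of the two sides is exactly
   [M * T + q * (M * B)]. *)
apply/eqP; rewrite -subr_eq0; apply/eqP; apply: (mulfI (_ : C * a * k / r != 0)).
  by rewrite gt_eqF // divr_gt0 // !mulr_gt0.
have z : M * T + q * (M * B) = 0 by rewrite mulrCA -mulrDr e mulr0.
rewrite mulr0 -[RHS]z eT eB; field.
by rewrite !gt_eqF.
Qed.

Lemma tangent_eq0 (R : realType) n (Om X : 'rV[R]_n) : dotp Om X = 0 ->
  (forall A, dotp Om A = 0 -> dotp A X = 0) -> X = 0.
Proof. by move=> OX h; apply/eqP; rewrite -dotp_eq0 h. Qed.

Lemma dotp_Pperp (R : realType) n (Om A v : 'rV[R]_n) : dotp Om A = 0 ->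
  dotp A (Pperp Om v) = dotp A v.
Proof. by move=> OA; rewrite /Pperp dotpBr dotpZr (dotpC A Om) OA mulr0 subr0. Qed.

(** * The equation for the orientation *)

Section orientation_equation.
Variables (R : realType) (m : nat) (sigma : probability (borel_rV R m.+2) R).
Hypothesis hsigma : uniform_sphere sigma.
Local Notation n := m.+2.
Local Notation V := 'rV[R]_n.
Local Notation E := (smean sigma).
Local Notation c := (c_of n).
Variables (nu tau k : R -> R) (g : R -> R -> R) (K2lim : R).
Hypothesis (hg : forall kappa, 0 < kappa -> gci_profile n kappa (g kappa)).
Variables (D : set (V * R)) (I : set R) (kap : R -> R) (rho : V -> R -> R) (Om : V -> R -> V).
Hypotheses (oD : open D) (hkap_diff : forall r, I r -> derivable kap r 1)
  (hkap_pos : forall r, I r -> 0 < kap r)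
  (hkap_inv : forall r, I r -> k (r * c (kap r)) = kap r)
  (hrho : forall x t, D (x, t) -> 0 < rho x t /\ I (rho x t))
  (hOm : forall x t, D (x, t) -> sphere (Om x t)).
Local Notation f0 := (fun x w t => rho x t * vonMises sigma (kap (rho x t)) (Om x t) w).
Hypothesis hs : smooth_density D f0.
Variables (x : V) (t : R).
Hypothesis hD : D (x, t).
Let J := flux sigma (fun u => f0 x u t).
Let L := vlaplacian (fun y => (rho y t * c (kap (rho y t))) *: Om y t) x.
Let ct := ctilde_of n (kap (rho x t)) (g (kap (rho x t))).
Let r := rho x t.
Let kr := kap r.
Let O := Om x t.

Let r0 : 0 < r. Proof. by case: (hrho hD). Qed.
Let k0 : 0 < kr. Proof. by apply: hkap_pos; case: (hrho hD). Qed.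
Let c0 : 0 < c kr. Proof. exact: (c_of_gt0 hsigma). Qed.
Let rc0 : 0 < r * c kr. Proof. exact: mulr_gt0. Qed.
Let SO : sphere O. Proof. exact: hOm. Qed.

Let JE : J = (r * c kr) *: O.
Proof. by apply: flux_phase hD. Qed.

Lemma enorm_flux_equilibrium : enorm J = r * c kr.
Proof. by rewrite JE enormZ (gtr0_norm rc0) (_ : enorm O = 1) ?mulr1 //; exact: SO. Qed.

Lemma unitv_flux_equilibrium : unitv J = O.
Proof. by rewrite /unitv enorm_flux_equilibrium JE scalerA mulVf ?scale1r // gt_eqF. Qed.

Lemma flux_equilibrium_neq0 : J != 0.
Proof. by rewrite -enorm_gt0 enorm_flux_equilibrium. Qed.

Lemma vlaplacian_flux_equilibrium : vlaplacian (fun y => flux sigma (fun u => f0 y u t)) x = L.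
Proof.
have oA : open [set y | D (y, t)].
  by rewrite openE => y; exact: (near_dom oD).
by apply: (near_eq_vlaplacian oA hD) => y; by move=> hy; apply: flux_phase hy.
Qed.

Hypothesis gci : forall A, dotp (unitv J) A = 0 ->
  E (fun w => transport x t f0 w * (h_of (g (k (enorm J))) (dotp w (unitv J)) * dotp w A))
  + K2lim * E (fun w => perturbation sigma nu tau x t f0 w *
      (h_of (g (k (enorm J))) (dotp w (unitv J)) * dotp w A)) = 0.

Let Ot := derive1 (Om x) t.
Let Oc := convective O (fun y => Om y t) x.
Let gr := grad (fun y => rho y t) x.

Lemma orientation_weak A : dotp O A = 0 ->
  r * (dotp A Ot + ct * dotp A Oc) + (kr^-1 + (ct - c kr) * (r / kr) * derive1 kap r) * dotp A gr =
  K2lim * (nu (r * c kr) / c kr * ((m%:R + 1) / kr + ct)) * dotp A L.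
Proof.
move=> OA; have := gci; rewrite unitv_flux_equilibrium enorm_flux_equilibrium hkap_inv; last by case: (hrho hD).
move=> /(_ A OA); rewrite -/kr => e.
have bh := bmeas_h (hg k0) SO.
pose C := r / partition sigma kr.
have C0 : 0 < C by rewrite divr_gt0 // partition_gt0.
have fE w : r * vonMises sigma kr O w = C * expR (kr * dotp w O).
  by rewrite vonMisesE // /C; ring.
have OOx i : dotp O ('D_(ei R i) (fun y => Om y t) x) = 0.
  exact: (Om_perp_x hsigma oD hkap_diff hkap_pos hrho hOm hs hD).
have eT := smean_transport_gci hsigma kr C SO OA bh (derive1 (rho x) t) (r^-1 - derive1 kap r * c kr)
  (derive1 kap r) gr Ot OOx.
have eB := smean_perturbation_gci hsigma SO OA bh (ell nu J L) (mcoef tau J L) (fun w _ => fE w)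
  (sC2_density hs hD).
have a0 := smean_hexp_gt0 hsigma SO k0 (hg k0); have eb := ctilde_ofE hsigma SO k0 (hg k0).
have el : dotp A (ell nu J L) = nu (r * c kr) / (r * c kr) * dotp A L.
  rewrite /ell unitv_flux_equilibrium enorm_flux_equilibrium dotpDr !dotpZr dotp_Pperp //.
  by rewrite (dotpC A O) OA mulr0 addr0.
have e1 w : sphere w -> transport x t f0 w * (h_of (g kr) (dotp w O) * dotp w A) =
    C * expR (kr * dotp w O) * ((derive1 (rho x) t + dotp w gr) *
      (r^-1 - derive1 kap r * c kr + derive1 kap r * dotp w O) +
      kr * (dotp w Ot + \sum_i w 0 i * dotp w ('D_(ei R i) (fun y => Om y t) x))) *
     (h_of (g kr) (dotp w O) * dotp w A).
  move=> _; rewrite (transport_equilibrium hsigma oD hkap_diff hkap_pos hrho hOm hs hD) -/r -/kr -/O fE.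
  by congr (_ * _ * _); congr (_ * _ + _); rewrite -addrA mulrBr (addrC (derive1 kap r * _)).
have e2 w : sphere w -> perturbation sigma nu tau x t f0 w * (h_of (g kr) (dotp w O) * dotp w A) =
    (sph_div (fun u => (r * vonMises sigma kr O u) *: Pperp u (ell nu J L)) w -
     mcoef tau J L * sph_laplacian (fun u => r * vonMises sigma kr O u) w) * (h_of (g kr) (dotp w O) * dotp w A).
  by move=> _; rewrite /perturbation vlaplacian_flux_equilibrium.
rewrite (eq_smean sigma e1) (eq_smean sigma e2) in e.
exact: (orientation_algebra C0 a0 k0 r0 c0 eT eB e (esym eb) el erefl).
Qed.

Lemma orientation_equation : r *: (Ot + ct *: Oc) + (kr^-1 + (ct - c kr) * (r / kr) * derive1 kap r) *: Pperp O gr =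
  (K2lim * (nu (r * c kr) / c kr * ((m%:R + 1) / kr + ct))) *: Pperp O L.
Proof.
have OOt : dotp O Ot = 0 by exact: (Om_perp_t hsigma oD hkap_diff hkap_pos hrho hOm hs hD).
have OOc : dotp O Oc = 0.
  rewrite /Oc /convective dotp_sumr big1 // => i _.
  by rewrite dotpZr (Om_perp_x hsigma oD hkap_diff hkap_pos hrho hOm hs hD) mulr0.
apply/eqP; rewrite -subr_eq0; apply/eqP; apply: (@tangent_eq0 _ _ O).
  by rewrite dotpBr dotpDr !dotpZr dotpDr dotpZr OOt OOc !(Pperp_tangent _ SO) !(mulr0, addr0, subr0).
move=> A OA; rewrite dotpBr dotpDr !dotpZr dotpDr dotpZr !(dotp_Pperp _ OA).
by apply/eqP; rewrite subr_eq0 orientation_weak.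
Qed.

End orientation_equation.
Unset Implicit Arguments.

Theorem theorem4 (R : realType) (n : nat) (hn : (2 <= n)%N)
  (sigma : probability (borel_rV R n) R) (hsigma : uniform_sphere sigma)
  (* the coefficients nu, tau, with k = nu / tau increasing of inverse j *)
  (nu tau k j : R -> R)
  (hnu_smooth : smooth_on [set r : R^o | 0 < r] nu)
  (htau_smooth : smooth_on [set r : R^o | 0 < r] tau)
  (hnu : forall r, 0 <= r -> 0 <= nu r)
  (htau : forall r, 0 <= r -> 0 < tau r)
  (hnu_lip : [lipschitz nu r / r | r in [set r : R^o | 0 < r]])
  (hnu_bnd : [bounded nu r / r | r in [set r : R^o | 0 < r]])
  (htau_lip : [lipschitz tau r | r in [set r : R^o | 0 <= r]])
  (htau_bnd : [bounded tau r | r in [set r : R^o | 0 <= r]])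
  (hk : forall r, 0 <= r -> k r = nu r / tau r)
  (hk_incr : forall r s, 0 <= r -> r < s -> k r < k s)
  (hj : forall r, 0 <= r -> j (k r) = r)
  (hj_diff : forall r, 0 < r -> derivable j (k r) 1)
  (* the observation kernel *)
  (lam : {measure set (borel_rV R n) -> \bar R}) (hlam : lebesgue_rV lam)
  (K : R -> R) (hK : observation_kernel lam K) (K2 : R)
  (hK2 : K2 = kernel_K2 lam K) (hK2_pos : 0 < K2)
  (* the profiles g_kappa *)
  (g : R -> R -> R) (hg : forall kappa, 0 < kappa -> gci_profile n kappa (g kappa))
  (* the scaling *)
  (eta : R -> R) (heta : eta eps @[eps --> 0^'+] --> 0)
  (K2lim : R) (hK2lim_ge0 : 0 <= K2lim)
  (hK2lim : K2 * (eta eps ^+ 2 / eps) @[eps --> 0^'+] --> K2lim)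
  (* the solutions f^eps, with remainder rem^eps *)
  (D : set ('rV[R]_n * R)) (hD : open D) (hDt : forall x t, D (x, t) -> 0 < t)
  (f rem : R -> 'rV[R]_n -> 'rV[R]_n -> R -> R)
  (hf : \forall eps \near 0^'+, smooth_density D (f eps))
  (heq : \forall eps \near 0^'+, forall x w t, D (x, t) -> sphere w ->
     flux sigma (fun u => f eps x u t) != 0 ->
     kinetic_lhs sigma nu tau eps (K2 * eta eps ^+ 2) (f eps) x w t
     = Qop sigma nu tau (fun u => f eps x u t) w + rem eps x w t)
  (hrem_O : exists C : R, \forall eps \near 0^'+, forall x w t,
     D (x, t) -> sphere w -> `|rem eps x w t| <= C * eta eps ^+ 4)
  (hrem_int : \forall eps \near 0^'+, forall x t, D (x, t) ->
     (\int[sigma]_(w in @sphere R n) rem eps x w t)%R = 0)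
  (* the branch kappa(rho) *)
  (I : set R) (hI : open I) (kap : R -> R)
  (hkap_diff : forall r, I r -> derivable kap r 1)
  (hkap_pos : forall r, I r -> 0 < kap r)
  (hkap_dom : forall r, I r -> exists2 s, 0 <= s & k s = kap r)
  (hkap : forall r, I r -> j (kap r) / c_of n (kap r) = r)
  (* the limit *)
  (rho : 'rV[R]_n -> R -> R) (Om : 'rV[R]_n -> R -> 'rV[R]_n)
  (hrho : forall x t, D (x, t) -> 0 < rho x t /\ I (rho x t))
  (hOm : forall x t, D (x, t) -> sphere (Om x t))
  (hcvg : smooth_cvg D f
     (fun x w t => rho x t * vonMises sigma (kap (rho x t)) (Om x t) w)) :
  let c1 := fun r => c_of n (kap r) in
  let c2 := fun r => ctilde_of n (kap r) (g (kap r)) in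
  let Theta := fun r =>
    (kap r)^-1 + (c2 r - c1 r) * (r / kap r) * derive1 kap r in
  let Theta' := fun r =>
    let kp := kap r in let c := c_of n kp in let ct := ctilde_of n kp (g kp) in
    (n%:R - kp / c + kp * ct - 1 + kp / j kp * derive1 j kp) /
    (kp * (n%:R - kp / c + kp * c - 1 + kp / j kp * derive1 j kp)) in
  let delta := fun r =>
    nu (j (kap r)) / c1 r * ((n%:R - 1) / kap r + c2 r) in
  (forall r, I r -> Theta r = Theta' r) /\
  forall x t, D (x, t) ->
    derive1 (fun s => rho x s) t
      + div (fun y => (rho y t * c1 (rho y t)) *: Om y t) x = 0 /\
    rho x t *: (derive1 (fun s => Om x s) t
                + c2 (rho x t) *: convective (Om x t) (fun y => Om y t) x)
      + Theta (rho x t) *: Pperp (Om x t) (grad (fun y => rho y t) x)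
    = (K2lim * delta (rho x t)) *:
        Pperp (Om x t)
          (vlaplacian (fun y => (rho y t * c1 (rho y t)) *: Om y t) x).
Proof.
case: n hn sigma hsigma lam hlam hK hK2 g hg D hD hDt f rem hf heq hrem_O hrem_int kap hkap_diff hkap_pos
  hkap_dom hkap rho Om hrho hOm hcvg => [|[|m]] // {}hn {}sigma {}hsigma {}lam {}hlam {}hK {}hK2 {}g {}hg
  {}D {}hD {}hDt {}f {}rem {}hf {}heq {}hrem_O {}hrem_int {}kap {}hkap_diff {}hkap_pos {}hkap_dom {}hkap
  {}rho {}Om {}hrho {}hOm {}hcvg c1 c2 Theta Theta' delta.
have hTheta r : I r -> Theta r = Theta' r.
  exact: (ThetaE hsigma hj hj_diff hI hkap_diff hkap_pos hkap_dom hkap).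
split=> [//|x t hxt].
(* The limit flux has norm [rho * c = j (kappa)], so that [k] of this norm is kappa: the profile
   selected by the flux is the one in the coefficients. *)
have jE r : I r -> j (kap r) = r * c_of m.+2 (kap r).
  move=> Ir; rewrite -{2}(hkap _ Ir) divfK // gt_eqF // (c_of_gt0 hsigma) //; exact: hkap_pos.
have hkap_inv r : I r -> k (r * c_of m.+2 (kap r)) = kap r.
  by move=> Ir; rewrite -jE //; exact: (compat_kj hj hkap_dom).
have hs := hcvg.1.
have J0 := flux_equilibrium_neq0 hsigma hkap_pos hrho hOm hxt.
have mass := limit_mass hsigma hnu_smooth htau_smooth hD hf heq hrem_int hcvg hxt J0.
split; first exact: (continuity_equation hsigma hD hOm hs hxt mass).
have gci := limit_gci hsigma hnu_smooth htau_smooth hnu htau hk hk_incr hg hK2_pos heta hK2lim hD hf heq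
  hrem_O hrem_int hcvg hxt J0.
have := orientation_equation hsigma hg hD hkap_diff hkap_pos hkap_inv hrho hOm hs hxt gci.
rewrite -(jE _ (hrho _ _ hxt).2) => ->.
by rewrite /delta /c1 /c2 -[m.+2%:R]natr1 addrK -natr1.
Qed.
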